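(* Let $N\ge1$ be an integer, $p=2N+1$, and let $\Delta$ be the operator on $\ell^2(\Gamma)$ defined in the context (the case $V=0$). Put $c_k=\cos\frac{k\pi}{N+1}$, $s_k=\sin\frac{k\pi}{N+1}$ for $k\in\{-N,\dots,N\}$, and let $\lambda^0_{-N}(a)\le\dots\le\lambda^0_N(a)$ be the eigenvalues of the matrix $J_a^0$. Then for all $a\in[0,2]$ $$-\lambda^0_{-k}(a)=\lambda^0_k(a)=(a^2-2ac_k+1)^{1/2},\quad k\in\{1,\dots,N\},\qquad \lambda_0^0(a)=0.$$ Moreover, with $\sigma_k^0=\lambda_k^0([0,2])$, $$\sigma(\Delta)=\sigma_{ac}(\Delta)\cup\sigma_{pp}(\Delta)=\bigcup_{k=-N}^N\sigma_k^0,\qquad \sigma_{pp}(\Delta)=\sigma_0^0=\{0\},$$ $$\sigma_{ac}(\Delta)=[-\lambda_N^0(2),\lambda_N^0(2)]\setminus(-s_1,s_1),\qquad \lambda_N^0(2)=(5+4c_1)^{1/2},$$ and for all $k\in\{1,\dots,N\}$ $$\sigma_{-k}^0=-\sigma_k^0,\qquad \sigma_k^0=\begin{cases}[s_k,\lambda_k^0(2)], & \text{if } c_k>0,\\ [1,\lambda_k^0(2)], & \text{if } c_k\le 0.\end{cases}$$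
   Context: Notation: $\mathbb{N}_p=\{1,\dots,p\}$, $p=2N+1$. The Hilbert space $\ell^2(\Gamma)$ consists of $f=(f_{n,k})_{(n,k)\in\mathbb{Z}\times\mathbb{N}_p}$ with $\|f\|^2=\sum|f_{n,k}|^2<\infty$. With the convention $f_{n,0}=f_{n,p+1}=0$ for all $n\in\mathbb{Z}$, $$(\Delta f)_{n,2k+1}=f_{n,2k}+f_{n-1,2k+2}+f_{n,2k+2},\quad k=0,1,\dots,N,$$ $$(\Delta f)_{n,2k}=f_{n,2k-1}+f_{n+1,2k-1}+f_{n,2k+1},\quad k=1,\dots,N.$$ $J_a^0$ is the symmetric tridiagonal $p\times p$ matrix with zero diagonal and off-diagonal entries $(a,1,a,1,\dots,a,1)$ (the $(n,n+1)$ entry is $a$ for odd $n$ and $1$ for even $n$). $\sigma_{ac}$ and $\sigma_{pp}$ denote the absolutely continuous and pure point spectra. *)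

(* Defs.v *)
From HB Require Import structures.
From mathcomp Require Import all_boot all_order all_algebra.
From mathcomp Require Import all_classical all_reals all_analysis.
From mathcomp Require Import complex.

Set Implicit Arguments.
Unset Strict Implicit.
Unset Printing Implicit Defensive.

Import Order.TTheory GRing.Theory Num.Theory.
Import numFieldNormedType.Exports.

Local Open Scope classical_set_scope.
Local Open Scope ring_scope.
Local Open Scope complex_scope.

Section L2.
Context (R : realType) (I : choiceType).
Implicit Types (u : I -> R) (f g : I -> R[i]).

(* The sum of an absolutely summable real family (a junk value otherwise). *)
Definition rsum u : R :=
  fine (\esum_(i in [set: I]) (Num.max (u i) 0)%:E)
  - fine (\esum_(i in [set: I]) (Num.max (- u i) 0)%:E).

Definition csum f : R[i] :=
  (rsum (fun i => complex.Re (f i))) +i* (rsum (fun i => complex.Im (f i))).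

Definition l2sq f : \bar R :=
  \esum_(i in [set: I]) (ComplexField.Normc.normc (f i) ^+ 2)%:E.

Definition l2 : set (I -> R[i]) := [set f | (l2sq f < +oo)%E].

Definition l2norm f : R := Num.sqrt (fine (l2sq f)).

(* Linear in the first argument. *)
Definition inner f g : R[i] := csum (fun i => f i * (g i)^*%C).

End L2.

(* Operators are maps on all families; they are only ever applied to members
   of [l2], or of a subspace [H] of [l2] which they leave invariant. *)
Section Spectra.
Context (R : realType) (I : choiceType).
Variable A : (I -> R[i]) -> (I -> R[i]).

Definition shifted (z : R[i]) (f : I -> R[i]) : I -> R[i] :=
  fun i => A f i - z * f i.

Definition resolvent_set (H : set (I -> R[i])) : set R[i] :=
  [set z | set_bij H H (shifted z) /\
           exists M : R, forall f, H f -> l2norm f <= M * l2norm (shifted z f)].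

(* Spectrum of the restriction of [A] to the subspace [H]. *)
Definition spectrum_on (H : set (I -> R[i])) : set R[i] := ~` resolvent_set H.

Definition spectrum : set R[i] := spectrum_on (@l2 R I).

(* The set of eigenvalues (it is not closed up). *)
Definition pp_spectrum : set R[i] :=
  [set z | exists f, [/\ l2 f, f <> (fun=> 0) & A f = (fun i => z * f i)]].

Definition poly_op (p : {poly R}) (f : I -> R[i]) : I -> R[i] :=
  fun i => \sum_(j < size p) (p`_j)%:C * iter j A f i.

(* The spectral measure of [f], for a bounded self-adjoint [A]: the finite
   Borel measure carried by the spectrum that represents the functional
   g |-> <g(A) f, f> on continuous functions on the spectrum.  Since g(A) is
   the norm limit of p(A) for polynomials p tending to g uniformly on the
   (compact) spectrum, it is enough to write the identity for polynomials. *)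
Definition is_spectral_measure (f : I -> R[i])
    (mu : {finite_measure set (measurableTypeR R) -> \bar R}) : Prop :=
  mu.-negligible [set x : R | ~ spectrum x%:C] /\
  forall p : {poly R},
    inner (poly_op p f) f = (\int[mu]_(x in [set: R]) p.[x])%:C.

Definition ac_subspace : set (I -> R[i]) :=
  [set f | l2 f /\
     exists2 mu : {finite_measure set (measurableTypeR R) -> \bar R},
       is_spectral_measure f mu & mu `<< lebesgue_measure].

Definition ac_spectrum : set R[i] := spectrum_on ac_subspace.

End Spectra.

Section Nanoribbon.
Context (R : realType) (N : nat).

(* The second index k in {1, ..., 2N+1} is represented by k.-1 : 'I_(2N+1). *)
Definition Gamma : choiceType := (int * 'I_(N.*2.+1))%type.

(* [at_ f n k] is f_{n,k}, with the convention f_{n,0} = f_{n,p+1} = 0. *)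
Definition at_ (f : Gamma -> R[i]) (n : int) (k : nat) : R[i] :=
  if k is j.+1 then
    if insub j is Some j' then f (n, j') else 0
  else 0.

Definition Delta (f : Gamma -> R[i]) : Gamma -> R[i] := fun v =>
  let n := v.1 in let k := (v.2 : nat).+1 in
  if odd k then at_ f n k.-1 + at_ f (n - 1) k.+1 + at_ f n k.+1
  else at_ f n k.-1 + at_ f (n + 1) k.-1 + at_ f n k.+1.

(* With indices starting from 0, the (i, i+1) entry is a for even i. *)
Definition J0 (a : R) : 'M[R]_(N.*2.+1) :=
  \matrix_(i, j)
    let e k := if odd k then 1 else a in
    if (j == i.+1 :> nat) then e i else if (i == j.+1 :> nat) then e j else 0.

End Nanoribbon.

(* The eigenvalues, with multiplicity, in nondecreasing order: the unique
   sequence satisfying the predicate when the characteristic polynomial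
   splits over [R], in particular when [M] is symmetric. *)
Definition eigenvalues (R : realType) (n : nat) (M : 'M[R]_n) : seq R :=
  xget [::] [set s : seq R |
    sorted <=%R s /\ char_poly M = \prod_(x <- s) ('X - x%:P)].

(* lambda^0_k(a) for -N <= k <= N. *)
Definition lam0 (R : realType) (N : nat) (k : int) (a : R) : R :=
  (eigenvalues (J0 N a))`_(absz (k + N%:Z)).

Definition sigma0 (R : realType) (N : nat) (k : int) : set R :=
  [set lam0 N k a | a in `[0, 2]].

Definition ck (R : realType) (N : nat) (k : int) : R :=
  cos (k%:~R * pi / N.+1%:R).

Definition sk (R : realType) (N : nat) (k : int) : R :=
  sin (k%:~R * pi / N.+1%:R).

(* Sets of reals viewed as sets of complex numbers. *)
Definition toC (R : realType) (S : set R) : set R[i] := [set x%:C | x in S].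

(* Main.v *)
Require Import Defs.
From HB Require Import structures.
From mathcomp Require Import all_boot all_order all_algebra.
From mathcomp Require Import all_classical all_reals all_analysis.
From mathcomp Require Import measurable_realfun complex.
From mathcomp Require Import finmap ring lra zify.
Set Implicit Arguments.
Unset Strict Implicit.
Unset Printing Implicit Defensive.
Import Order.TTheory GRing.Theory Num.Theory.
Import numFieldNormedType.Exports.
Local Open Scope classical_set_scope.
Local Open Scope ring_scope.

Local Open Scope complex_scope.

(** Let [L^2 = 5 + 4 c_1] and write [f] as its even rows [v_1, ..., v_N] (second
    index even) and its odd rows.  [Delta] exchanges the two kinds of rows, so
    [Delta^2] maps even rows to even rows; there it is translation invariant
    in the first index and has the structure of a path of length [N] in the
    second.  Expanding in [cos x] along the ribbon and in [sin (m k pi/(N+1))]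
    across it turns [Delta^2] into multiplication by
    [symbol k x = 4 cos^2 x + 4 cos x c_k + 1] (lemma [wave_eigen]), that is, by
    [lambda_k(a)^2] at [a = - 2 cos x].  Inequalities
    on norms confine the spectrum, and the moments of a single vector show that
    it is not smaller; no unitary transform is constructed.

    Upper bounds for the spectrum are inequalities on norms.  On the even rows
    [s_1 |f| <= |Delta f| <= L |f|] ([Delta_even_le] and [Delta_even_ge], which
    reduce to inequalities on a path of [N] vertices), hence
    [s_1 |Delta f| <= |Delta^2 f|] and [|Delta f| <= L |f|] for all [f].  This
    bounds [Delta - x] from below when [0 < |x| < s_1] or [|x| > L], and a
    self-adjoint operator that is bounded below is invertible
    ([resolvent_of_lower_bound], a Neumann series for [|A - z|^-2]).

    The eigenvalue 0 has the eigenvector [flat_state], supported on finitely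
    many odd sites.  For a nonzero eigenvalue, eliminating all rows but [v_1]
    leaves a nontrivial difference equation with constant coefficients, and
    such an equation has no square-summable solution
    ([shift_polynomial_eq0]).

    Everything about the absolutely continuous part comes from the spectral
    measure [mu] of one basis vector, the delta function at the even site
    [(0, 2)].  Its moments are computed by applying [Delta^2] repeatedly to the
    expansion above ([ev_iter_Delta2]); they are those of the mixture, with
    weights [s_k^2 / (N+1)], of the images of the uniform law on [[0, pi]] under
    the maps [x |-> sqrt (symbol k x)] and [x |-> - sqrt (symbol k x)].  These
    maps are piecewise expanding up to null sets, so [mu] is absolutely
    continuous, and they sweep out the set [s_1 <= |x| <= L], which is therefore
    its support ([site_spectral_measure]).  A point of the support lies in
    the spectrum of any restriction of [Delta] to a subspace that contains the
    vectors [q(Delta) delta]: polynomials peaking at the point give approximate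
    eigenvectors ([spectrum_on_at_support]).  Applied to the whole space and to
    the absolutely continuous subspace, this gives the lower bounds for both
    spectra.  Conversely the spectral measures of vectors of the absolutely
    continuous subspace do not charge the eigenvalue 0, so that [Delta - z] is
    invertible on that subspace as soon as [z] is away from
    [s_1 <= |x| <= L] ([ac_resolvent]).

    The finite matrix [J_a^0] has explicit eigenvectors built from
    [sin (m k pi/(N+1))]; for [a > 0] this exhibits [2N+1] distinct eigenvalues,
    and the case [a = 0] follows by polynomial identity in [a]
    ([char_poly_bands]).  The images of the eigenvalue curves are intervals
    because [lambda_k(a)^2 = (a - c_k)^2 + s_k^2]. *)

(** * Absolutely summable families *)

Lemma posneg_partB (R : realDomainType) (x : R) :
  x = Num.max x 0 - Num.max (- x) 0.
Proof.
have [x0|x0] := leP 0 x.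
  by rewrite max_r ?subr0// oppr_le0.
by rewrite max_l ?sub0r ?opprK// oppr_ge0 ltW.
Qed.

Section Summation.
Context (R : realType) (I : choiceType).
Implicit Types (u v : I -> R) (s : seq I).

Definition abs_summable u : Prop :=
  (\esum_(i in [set: I]) `|u i|%:E < +oo)%E.

Lemma esum_ge_seq u s : uniq s -> (forall i, 0 <= u i) ->
  ((\sum_(i <- s) u i)%:E <= \esum_(i in [set: I]) (u i)%:E)%E.
Proof.
move=> us u0; apply: esum_ge; exists [set` s].
  by split => //; exact: finite_seq.
rewrite -fsbig_seq// -sumEFin; exact: lexx.
Qed.

Lemma esum_le_bound u (M : R) :
  (forall s, uniq s -> \sum_(i <- s) u i <= M) ->
  (\esum_(i in [set: I]) (u i)%:E <= M%:E)%E.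
Proof.
move=> uM; apply: ge_ereal_sup => _ [F [finF _] <-].
rewrite fsbig_finite//= sumEFin lee_fin; apply: uM.
exact: fset_uniq.
Qed.

Lemma esum_fin_num u : (forall i, 0 <= u i) -> abs_summable u ->
  \esum_(i in [set: I]) (u i)%:E \is a fin_num.
Proof.
move=> u0; rewrite /abs_summable => su; rewrite ge0_fin_numE.
  by rewrite (eq_esum (b := fun i => `|u i|%:E))// => i _; rewrite ger0_norm.
by apply: esum_ge0 => i _; rewrite lee_fin.
Qed.

Lemma esum_fin u : (forall i, 0 <= u i) -> abs_summable u ->
  \esum_(i in [set: I]) (u i)%:E = (fine (\esum_(i in [set: I]) (u i)%:E))%:E.
Proof. by move=> u0 su; rewrite fineK// esum_fin_num. Qed.

Lemma abs_summable_le u v : (forall i, `|u i| <= `|v i|) ->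
  abs_summable v -> abs_summable u.
Proof.
by move=> uv; apply: le_lt_trans; apply: le_esum => i _; rewrite lee_fin.
Qed.

Lemma abs_summableD u v :
  abs_summable u -> abs_summable v -> abs_summable (fun i => u i + v i).
Proof.
move=> su sv; apply: le_lt_trans (lte_add_pinfty su sv).
rewrite -esumD; do ?by move=> *; rewrite lee_fin.
by apply: le_esum => i _; rewrite -EFinD lee_fin ler_normD.
Qed.

Lemma esumZ_le u (c : R) : 0 <= c -> (forall i, 0 <= u i) -> abs_summable u ->
  (\esum_(i in [set: I]) (c * u i)%:E <=
   c%:E * \esum_(i in [set: I]) (u i)%:E)%E.
Proof.
move=> c0 u0 su; rewrite esum_fin// -EFinM; apply: esum_le_bound => s us.
by rewrite -mulr_sumr ler_wpM2l// -lee_fin -esum_fin// esum_ge_seq.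
Qed.

Lemma abs_summableZ u (c : R) : abs_summable u -> abs_summable (fun i => c * u i).
Proof.
move=> su; have su' : abs_summable (fun i => `|u i|).
  by apply: abs_summable_le su => i; rewrite normr_id.
rewrite /abs_summable (eq_esum (b := fun i => (`|c| * `|u i|)%:E)); last first.
  by move=> i _; rewrite normrM.
apply: le_lt_trans (esumZ_le _ _ su') _ => //.
by rewrite esum_fin// -EFinM ltry.
Qed.

Lemma abs_summableN u : abs_summable u -> abs_summable (fun i => - u i).
Proof. by apply: abs_summable_le => i; rewrite normrN. Qed.

Lemma rsum_eq u v : u =1 v -> rsum u = rsum v.
Proof. by move=> /funext ->. Qed.

(** The positive and negative parts in [rsum] can be replaced by any two
    summable nonnegative families with the right difference; additivity
    follows from this freedom. *)
Lemma rsumE u (a b : I -> R) : (forall i, 0 <= a i) -> (forall i, 0 <= b i) ->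
  abs_summable a -> abs_summable b -> (forall i, u i = a i - b i) ->
  rsum u = fine (\esum_(i in [set: I]) (a i)%:E)
           - fine (\esum_(i in [set: I]) (b i)%:E).
Proof.
move=> a0 b0 sa sb uE; rewrite /rsum.
have p0 i : 0 <= Num.max (u i) 0 by rewrite le_max lexx orbT.
have n0 i : 0 <= Num.max (- u i) 0 by rewrite le_max lexx orbT.
have pn i : u i = Num.max (u i) 0 - Num.max (- u i) 0.
  exact: posneg_partB.
have sp : abs_summable (fun i => Num.max (u i) 0).
  apply: abs_summable_le sa => i; rewrite !ger0_norm// uE ge_max a0 andbT.
  by rewrite gerBl.
have sn : abs_summable (fun i => Num.max (- u i) 0).
  apply: abs_summable_le sb => i; rewrite !ger0_norm// uE ge_max b0 andbT.
  by rewrite opprB gerBl.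
apply/eqP; rewrite subr_eq addrAC eq_sym subr_eq; apply/eqP.
apply: EFin_inj; rewrite !EFinD -!esum_fin//.
rewrite -!esumD; do ?by move=> *; rewrite lee_fin.
by apply: eq_esum => i _; rewrite -!EFinD; congr (_%:E); have := pn i; rewrite uE; lra.
Qed.

Lemma rsum_ge0E u : (forall i, 0 <= u i) -> abs_summable u ->
  (rsum u)%:E = \esum_(i in [set: I]) (u i)%:E.
Proof.
move=> u0 su; rewrite (@rsumE u u (fun=> 0))//.
- by rewrite [X in _ - fine X]esum1//= subr0 -esum_fin.
- by apply: abs_summable_le su => i; rewrite normr0.
- by move=> i; rewrite subr0.
Qed.

Lemma rsum_ge0 u : (forall i, 0 <= u i) -> abs_summable u -> 0 <= rsum u.
Proof.
move=> u0 su; rewrite -lee_fin rsum_ge0E//.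
by apply: esum_ge0 => i _; rewrite lee_fin.
Qed.

Let posp u i : R := Num.max (u i) 0.
Let negp u i : R := Num.max (- u i) 0.

Let posnegP u : abs_summable u ->
  [/\ forall i, 0 <= posp u i, forall i, 0 <= negp u i,
      abs_summable (posp u), abs_summable (negp u) &
      forall i, u i = posp u i - negp u i].
Proof.
move=> su.
have p0 i : 0 <= posp u i by rewrite le_max lexx orbT.
have n0 i : 0 <= negp u i by rewrite le_max lexx orbT.
split => //.
- apply: abs_summable_le su => i; rewrite ger0_norm// ge_max normr_ge0 andbT.
  exact: ler_norm.
- apply: abs_summable_le su => i; rewrite ger0_norm// ge_max normr_ge0 andbT.
  by rewrite -normrN; exact: ler_norm.
- by move=> i; exact: posneg_partB.
Qed.

Lemma rsumD u v : abs_summable u -> abs_summable v ->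
  rsum (fun i => u i + v i) = rsum u + rsum v.
Proof.
move=> su sv; have [pu nu spu snu uE] := posnegP su.
have [pv nv spv snv vE] := posnegP sv.
rewrite (@rsumE _ (fun i => posp u i + posp v i) (fun i => negp u i + negp v i)).
- rewrite (rsumE pu nu)// (rsumE pv nv)//.
  under eq_esum do rewrite EFinD.
  under [X in _ - fine X]eq_esum do rewrite EFinD.
  rewrite !esumD; do ?by move=> *; rewrite lee_fin.
  by rewrite !fineD ?esum_fin_num//; lra.
- by move=> i; rewrite addr_ge0.
- by move=> i; rewrite addr_ge0.
- exact: abs_summableD.
- exact: abs_summableD.
- by move=> i; rewrite uE vE; lra.
Qed.

Lemma rsumN u : rsum (fun i => - u i) = - rsum u.
Proof.
rewrite /rsum opprB; congr (_ - fine _).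
by apply: eq_esum => i _; rewrite opprK.
Qed.

Lemma rsumZ u c : abs_summable u -> rsum (fun i => c * u i) = c * rsum u.
Proof.
wlog c0 : c / 0 <= c => [hw|] su.
  have [/hw|/ltW c0] := leP 0 c; first exact.
  have := hw (- c); rewrite oppr_ge0 => /(_ c0 su).
  rewrite mulNr => /eqP; rewrite -eqr_oppLR => /eqP <-; rewrite -rsumN.
  by apply: rsum_eq => i; lra.
have nneg v : (forall i, 0 <= v i) -> abs_summable v ->
    rsum (fun i => c * v i) = c * rsum v.
  move=> v0 sv; apply: EFin_inj; rewrite EFinM.
  have cv0 i : 0 <= c * v i by rewrite mulr_ge0.
  have scv := abs_summableZ c sv.
  rewrite !rsum_ge0E//; apply/eqP; rewrite eq_le esumZ_le//=.
  have [->|cn0] := eqVneq c 0.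
    rewrite mul0e; apply: esum_ge0 => i _; rewrite lee_fin mul0r; exact: lexx.
  have cp : 0 < c by rewrite lt_def cn0.
  have := @esumZ_le (fun i => c * v i) c^-1; rewrite invr_ge0 => /(_ c0 cv0 scv).
  rewrite (eq_esum (b := fun i => (v i)%:E)); last first.
    by move=> i _; rewrite mulKf.
  rewrite (esum_fin v0 sv) (esum_fin cv0 scv) -!EFinM !lee_fin => h.
  by rewrite -(ler_pM2l (x := c^-1)) ?invr_gt0// mulKf.
have [pu nu spu snu uE] := posnegP su.
transitivity (rsum (fun i => c * posp u i + - (c * negp u i))).
  by apply: rsum_eq => i; rewrite {1}uE; lra.
rewrite (rsumD (abs_summableZ c spu) (abs_summableN (abs_summableZ c snu))).
rewrite (rsumN (fun i => c * negp u i)) nneg// nneg//.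
transitivity (c * rsum (fun i => posp u i + - negp u i)); last first.
  by congr (c * _); apply: rsum_eq => i; rewrite {1}uE.
by rewrite (rsumD spu (abs_summableN snu)) (rsumN (negp u)); ring.
Qed.

Lemma rsum_ge_seq u s : uniq s -> (forall i, 0 <= u i) -> abs_summable u ->
  \sum_(i <- s) u i <= rsum u.
Proof. by move=> us u0 su; rewrite -lee_fin rsum_ge0E// esum_ge_seq. Qed.

Lemma rsum_le_bound u (M : R) : (forall i, 0 <= u i) ->
  (forall s, uniq s -> \sum_(i <- s) u i <= M) ->
  abs_summable u /\ rsum u <= M.
Proof.
move=> u0 uM; have su : abs_summable u.
  rewrite /abs_summable (eq_esum (b := fun i => (u i)%:E)); last first.
    by move=> i _; rewrite ger0_norm.
  by apply: le_lt_trans (esum_le_bound uM) (ltry _).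
by split => //; rewrite -lee_fin rsum_ge0E// esum_le_bound.
Qed.

Lemma abs_summable_supp1 u i0 : (forall i, i != i0 -> u i = 0) -> abs_summable u.
Proof.
move=> u0; rewrite /abs_summable (esumID [set i0])//.
rewrite setTI esum_set1// [X in (_ + X)%E]esum1 ?adde0 ?ltry//.
by move=> i [_ /= /eqP ii0]; rewrite u0// normr0.
Qed.

Lemma rsum_supp1 u i0 : (forall i, i != i0 -> u i = 0) -> rsum u = u i0.
Proof.
move=> u0; have ss (f : R -> R) : f 0 = 0 -> (forall x, 0 <= f x) ->
    fine (\esum_(i in [set: I]) (f (u i))%:E) = f (u i0).
  move=> f0 fp; rewrite (esumID [set i0]); last by move=> *; rewrite lee_fin.
  rewrite setTI esum_set1 ?lee_fin// [X in (_ + X)%E]esum1 ?adde0//.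
  by move=> i [_ /= /eqP ii0]; rewrite u0// f0.
rewrite /rsum (ss (fun x => Num.max x 0)) ?maxxx//; last first.
  by move=> x; rewrite le_max lexx orbT.
rewrite (ss (fun x => Num.max (- x) 0)) ?oppr0 ?maxxx//; last first.
  by move=> x; rewrite le_max lexx orbT.
by rewrite -posneg_partB.
Qed.

End Summation.

Section Reindex.
Context (R : realType).

Lemma abs_summable_bij (I J : choiceType) (e : I -> J) (u : J -> R) :
  bijective e -> abs_summable u <-> abs_summable (fun i => u (e i)).
Proof.
move=> be; have eb : set_bij [set: I] [set: J] e by rewrite setTT_bijective.
by rewrite /abs_summable (reindex_esum [set: I] [set: J] e _ eb).
Qed.

Lemma rsum_bij (I J : choiceType) (e : I -> J) (u : J -> R) :
  bijective e -> rsum u = rsum (fun i => u (e i)).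
Proof.
move=> be; have eb : set_bij [set: I] [set: J] e by rewrite setTT_bijective.
by rewrite /rsum !(reindex_esum [set: I] [set: J] e _ eb).
Qed.

Lemma esum_pair (I : choiceType) (F : finType) (u : I * F -> \bar R) :
  (forall v, 0 <= u v)%E ->
  \esum_(v in [set: I * F]) u v =
  (\sum_(j : F) \esum_(i in [set: I]) u (i, j))%E.
Proof.
move=> u0; have -> : [set: I * F] = [set: I] `*`` (fun=> [set: F]).
  by apply/seteqP; split.
transitivity (\esum_(k in [set: I] `*`` (fun=> [set: F])) u (k.1, k.2)).
  by apply: eq_esum => -[].
rewrite -(@esum_esum R I F _ _ (fun i j => u (i, j)))//.
rewrite -(@esum_sum R I F setT _ _ (fun i j => u (i, j)))//; apply: eq_esum => i _.
rewrite esum_fset//; last exact: finite_finset.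
rewrite fsbig_finite/=; last exact: finite_finset.
rewrite -big_enum; apply: perm_big; apply: uniq_perm.
- exact: fset_uniq.
- exact: enum_uniq.
- by move=> j; rewrite mem_enum in_fset_set ?in_setT//; exact: finite_finset.
Qed.

Lemma abs_summable_pair (I : choiceType) (F : finType) (u : I * F -> R) :
  abs_summable u <-> forall j, abs_summable (fun i => u (i, j)).
Proof.
rewrite /abs_summable esum_pair//; split => [h j|h].
  apply: le_lt_trans h.
  rewrite (bigD1 j)//= leeDl// sume_ge0// => *; exact: esum_ge0.
by apply: lte_sum_pinfty => j _; exact: h.
Qed.

Lemma rsum_pair (I : choiceType) (F : finType) (u : I * F -> R) :
  abs_summable u -> rsum u = \sum_(j : F) rsum (fun i => u (i, j)).
Proof.
move=> su; rewrite /rsum.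
have mx (f : R -> R) : (forall x, 0 <= f x <= `|x|) ->
  fine (\esum_(i in [set: I * F]) (f (u i))%:E)
  = \sum_j fine (\esum_(i in [set: I]) (f (u (i, j)))%:E).
  move=> fx; rewrite esum_pair => [|v]; last by rewrite lee_fin; case/andP: (fx (u v)).
  rewrite sum_fine// => j _.
  rewrite ge0_fin_numE; last by apply: esum_ge0 => i _; rewrite lee_fin; case/andP: (fx (u (i,j))).
  apply: le_lt_trans (_ : (_ <= \esum_(i in [set: I]) (`|u (i, j)|)%:E)%E) _.
    by apply: le_esum => i _; rewrite lee_fin; case/andP: (fx (u (i,j))).
  by have /abs_summable_pair := su; exact.
rewrite (mx (fun x => Num.max x 0)); last first.
  by move=> x; rewrite le_max lexx orbT ge_max ler_norm normr_ge0.
rewrite (mx (fun x => Num.max (- x) 0)); last first.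
  by move=> x; rewrite le_max lexx orbT ge_max -normrN ler_norm normr_ge0.
by rewrite -sumrB.
Qed.

End Reindex.

(** * The space of square-summable families as a real inner product space *)

Section L2Theory.
Context (R : realType) (I : choiceType).
Implicit Types (f g h : I -> R[i]) (z : R[i]).

Lemma ReD (x y : R[i]) : complex.Re (x + y) = complex.Re x + complex.Re y.
Proof. by case: x y => a b [c d]. Qed.

Lemma ImD (x y : R[i]) : complex.Im (x + y) = complex.Im x + complex.Im y.
Proof. by case: x y => a b [c d]. Qed.

Lemma ReM (x y : R[i]) : complex.Re (x * y) =
  complex.Re x * complex.Re y - complex.Im x * complex.Im y.
Proof. by case: x y => a b [c d]. Qed.

Lemma ImM (x y : R[i]) : complex.Im (x * y) =
  complex.Re x * complex.Im y + complex.Im x * complex.Re y.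
Proof. by case: x y => a b [c d]. Qed.

Definition nsq z : R := complex.Re z ^+ 2 + complex.Im z ^+ 2.

Lemma nsq_ge0 z : 0 <= nsq z.
Proof. by rewrite addr_ge0// sqr_ge0. Qed.

Lemma nsqM z w : nsq (z * w) = nsq z * nsq w.
Proof. by rewrite /nsq ReM ImM; ring. Qed.

Lemma nsq_eq0 z : nsq z = 0 -> z = 0.
Proof.
case: z => a b /eqP; rewrite paddr_eq0 ?sqr_ge0// !sqrf_eq0 /=.
by case/andP => /eqP -> /eqP ->.
Qed.

(** All estimates are made with the real part of [inner], which is a real
    inner product; its imaginary part is the real part of the product with
    ['i g]. *)
Definition dot f g : R :=
  rsum (fun i => complex.Re (f i) * complex.Re (g i)
                 + complex.Im (f i) * complex.Im (g i)).

Lemma innerE f g : inner f g = dot f g +i* dot f ('i%C \*o g).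
Proof.
rewrite /inner /csum /dot; congr (_ +i* _); apply: rsum_eq => i /=;
  by case: (f i) (g i) => a b [c d] /=; ring.
Qed.

Lemma l2E f : l2 f <-> abs_summable (fun i => nsq (f i)).
Proof.
rewrite /l2 /l2sq /abs_summable /=.
suff -> : \esum_(i in [set: I]) (ComplexField.Normc.normc (f i) ^+ 2)%:E
    = \esum_(i in [set: I]) `|nsq (f i)|%:E by [].
apply: eq_esum => i _; congr (_%:E); rewrite ger0_norm ?nsq_ge0//.
by case: (f i) => a b /=; rewrite sqr_sqrtr// addr_ge0 ?sqr_ge0.
Qed.

Lemma dot_summable f g : l2 f -> l2 g ->
  abs_summable (fun i => complex.Re (f i) * complex.Re (g i)
                         + complex.Im (f i) * complex.Im (g i)).
Proof.
move=> /l2E sf /l2E sg; apply: abs_summable_le (abs_summableD sf sg) => i.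
rewrite [leRHS](ger0_norm (addr_ge0 (nsq_ge0 _) (nsq_ge0 _))) /nsq.
case: (f i) (g i) => a b [c d] /=; rewrite ler_norml.
have := sqr_ge0 (a - c); have := sqr_ge0 (b - d); have := sqr_ge0 (a + c).
have := sqr_ge0 (b + d); have := sqr_ge0 a; have := sqr_ge0 b.
by have := sqr_ge0 c; have := sqr_ge0 d => *; apply/andP; split; lra.
Qed.

Lemma dotC f g : dot f g = dot g f.
Proof. by apply: rsum_eq => i; ring. Qed.

Lemma l2_0 : l2 (0 : I -> R[i]).
Proof.
apply/l2E; rewrite /abs_summable esum1 ?ltry// => i _.
by rewrite /nsq /= expr0n addr0 normr0.
Qed.

Lemma l2D f g : l2 f -> l2 g -> l2 (f + g).
Proof.
move=> /l2E sf /l2E sg; apply/l2E.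
apply: abs_summable_le (abs_summableZ 2 (abs_summableD sf sg)) => i.
have ge := addr_ge0 (nsq_ge0 (f i)) (nsq_ge0 (g i)).
rewrite (ger0_norm (nsq_ge0 _)) ger0_norm ?(mulr_ge0 _ ge)//.
rewrite !fctE /nsq; case: (f i) (g i) => a b [c d] /=.
have := sqr_ge0 (a - c); have := sqr_ge0 (b - d) => *; lra.
Qed.

Lemma l2Z z f : l2 f -> l2 (z \*o f).
Proof.
move=> /l2E sf; apply/l2E.
apply: abs_summable_le (abs_summableZ (nsq z) sf) => i /=.
by rewrite nsqM.
Qed.

Lemma scaleN1f f : (-1) \*o f = - f.
Proof. by apply/funext => i /=; rewrite mulN1r. Qed.

Lemma l2N f : l2 f -> l2 (- f).
Proof. by rewrite -scaleN1f; exact: l2Z. Qed.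

Lemma l2B f g : l2 f -> l2 g -> l2 (f - g).
Proof. by move=> lf lg; apply: l2D => //; exact: l2N. Qed.

Lemma l2_sum (J : Type) (s : seq J) (F : J -> I -> R[i]) :
  (forall j, l2 (F j)) -> l2 (\sum_(j <- s) F j).
Proof. by move=> lF; elim/big_ind: _ => //; [exact: l2_0|exact: l2D]. Qed.

Lemma dotDl f g h : l2 f -> l2 g -> l2 h -> dot (f + g) h = dot f h + dot g h.
Proof.
move=> lf lg lh; rewrite /dot -rsumD; try exact: dot_summable.
by apply: rsum_eq => i; rewrite ReD ImD; ring.
Qed.

Lemma dotDr f g h : l2 f -> l2 g -> l2 h -> dot h (f + g) = dot h f + dot h g.
Proof. by move=> *; rewrite dotC dotDl// !(dotC h). Qed.

Lemma dotZl (c : R) f g : l2 f -> l2 g -> dot (c%:C \*o f) g = c * dot f g.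
Proof.
move=> lf lg; rewrite /dot -rsumZ; last exact: dot_summable.
by apply: rsum_eq => i; rewrite ReM ImM /=; ring.
Qed.

Lemma dotZr (c : R) f g : l2 f -> l2 g -> dot g (c%:C \*o f) = c * dot g f.
Proof. by move=> *; rewrite dotC dotZl// dotC. Qed.

Lemma dotNl f g : dot (- f) g = - dot f g.
Proof.
rewrite /dot -rsumN; apply: rsum_eq => i.
by rewrite !fctE; case: (f i) => a b /=; ring.
Qed.

Lemma dotNr f g : dot g (- f) = - dot g f.
Proof. by rewrite dotC dotNl dotC. Qed.

Lemma dotBl f g h : l2 f -> l2 g -> l2 h -> dot (f - g) h = dot f h - dot g h.
Proof. by move=> *; rewrite dotDl ?dotNl//; exact: l2N. Qed.

Lemma dotBr f g h : l2 f -> l2 g -> l2 h -> dot h (f - g) = dot h f - dot h g.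
Proof. by move=> *; rewrite dotDr ?dotNr//; exact: l2N. Qed.

Lemma dot_mulJ z f g : dot (z \*o f) g = dot f (z^*%C \*o g).
Proof.
apply: rsum_eq => i; rewrite /=.
by case: z (f i) (g i) => a b [c d] [e k] /=; ring.
Qed.

Lemma dot0l g : dot 0 g = 0.
Proof. by have := dotNl 0 g; rewrite oppr0 => h; lra. Qed.

Lemma dot_sumr (J : Type) (s : seq J) (F : J -> I -> R[i]) g :
  (forall j, l2 (F j)) -> l2 g ->
  dot g (\sum_(j <- s) F j) = \sum_(j <- s) dot g (F j).
Proof.
move=> lF lg; elim: s => [|a s ih].
  by rewrite !big_nil dotC dot0l.
by rewrite !big_cons dotDr ?ih//; exact: l2_sum.
Qed.

Lemma dot_ge0 f : l2 f -> 0 <= dot f f.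
Proof.
by move=> lf; apply: rsum_ge0 => [i|]; [rewrite -!expr2 nsq_ge0|exact: dot_summable].
Qed.

Lemma l2norm_ge0 f : 0 <= l2norm f.
Proof. exact: sqrtr_ge0. Qed.

Lemma sqr_l2norm f : l2 f -> l2norm f ^+ 2 = dot f f.
Proof.
move=> lf; have E : l2sq f = (dot f f)%:E.
  rewrite rsum_ge0E; last exact: dot_summable.
    apply: eq_esum => i _; congr (_%:E).
    by case: (f i) => a b /=; rewrite sqr_sqrtr ?addr_ge0 ?sqr_ge0.
  by move=> i; rewrite -!expr2 nsq_ge0.
by rewrite /l2norm E /= sqr_sqrtr// dot_ge0.
Qed.

Lemma l2norm_dot f : l2 f -> l2norm f = Num.sqrt (dot f f).
Proof. by move=> lf; rewrite -sqr_l2norm// sqrtr_sqr ger0_norm// l2norm_ge0. Qed.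

Lemma l2norm0 : l2norm (0 : I -> R[i]) = 0.
Proof.
by rewrite l2norm_dot ?dot0l ?sqrtr0//; exact: l2_0.
Qed.

Lemma nsq_le_dot f i : l2 f -> nsq (f i) <= dot f f.
Proof.
move=> lf; have := @rsum_ge_seq _ _ (fun i => nsq (f i)) [:: i] isT.
rewrite big_seq1 => h; apply: h; first by move=> j; exact: nsq_ge0.
exact: (l2E f).1.
Qed.

Lemma l2norm_eq0 f : l2 f -> l2norm f = 0 -> f = 0.
Proof.
move=> lf f0; apply/funext => i; apply/nsq_eq0/eqP.
by rewrite eq_le nsq_ge0 andbT (le_trans (nsq_le_dot i lf))// -sqr_l2norm// f0 expr0n.
Qed.

Lemma dotZZ z f : l2 f -> dot (z \*o f) (z \*o f) = nsq z * dot f f.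
Proof.
move=> lf; rewrite /dot -rsumZ; last exact: dot_summable.
by apply: rsum_eq => i; rewrite ReM ImM /nsq; ring.
Qed.

Lemma l2normZ z f : l2 f -> l2norm (z \*o f) = Num.sqrt (nsq z) * l2norm f.
Proof.
move=> lf; rewrite !l2norm_dot//; last exact: l2Z.
by rewrite dotZZ// sqrtrM// nsq_ge0.
Qed.

Lemma l2normZr (c : R) f : l2 f -> l2norm (c%:C \*o f) = `|c| * l2norm f.
Proof. by move=> lf; rewrite l2normZ// /nsq /= expr0n addr0 sqrtr_sqr. Qed.

Lemma l2normN f : l2 f -> l2norm (- f) = l2norm f.
Proof. by move=> lf; rewrite !l2norm_dot ?dotNl ?dotNr ?opprK//; exact: l2N. Qed.

Lemma dot_sqrD f g : l2 f -> l2 g ->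
  dot (f + g) (f + g) = dot f f + 2 * dot f g + dot g g.
Proof.
move=> lf lg; rewrite dotDl// ?dotDr// ?(dotC g f); first by ring.
exact: l2D.
Qed.

(** Stated for the real part of the inner product, which is all that the
    estimates on norms involve. *)
Lemma cauchy_schwarz f g : l2 f -> l2 g -> `|dot f g| <= l2norm f * l2norm g.
Proof.
move=> lf lg.
have key : dot f g ^+ 2 <= dot f f * dot g g.
  have [g0|g0] := eqVneq (dot g g) 0.
    have -> : g = 0.
      by apply: l2norm_eq0 => //; rewrite l2norm_dot// g0 sqrtr0.
    by rewrite dotC !dot0l expr0n mulr0.
  have gp : 0 < dot g g by rewrite lt_def g0 dot_ge0.
  pose c := - (dot f g / dot g g).
  have := dot_ge0 (l2D lf (l2Z c%:C lg)).
  have lcg := l2Z c%:C lg.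
  rewrite dot_sqrD// (dotZr c lg lf) (dotZr c lg lcg) (dotZl c lg lg) /c => h.
  rewrite -subr_ge0; have := mulr_ge0 (ltW gp) h.
  suff -> : dot g g * (dot f f + 2 * (- (dot f g / dot g g) * dot f g)
     + - (dot f g / dot g g) * (- (dot f g / dot g g) * dot g g))
     = dot f f * dot g g - dot f g ^+ 2 by [].
  by field.
rewrite -(ler_pXn2r (n := 2)) ?nnegrE ?mulr_ge0 ?l2norm_ge0//.
by rewrite real_normK ?num_real// exprMn !sqr_l2norm.
Qed.

Lemma dot_le f g : l2 f -> l2 g -> dot f g <= l2norm f * l2norm g.
Proof. by move=> lf lg; apply: le_trans (ler_norm _) (cauchy_schwarz lf lg). Qed.

Lemma l2norm_triangle f g : l2 f -> l2 g -> l2norm (f + g) <= l2norm f + l2norm g.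
Proof.
move=> lf lg; rewrite -(ler_pXn2r (n := 2)) ?nnegrE ?addr_ge0 ?l2norm_ge0//.
rewrite sqr_l2norm; last exact: l2D.
rewrite dot_sqrD// sqrrD !sqr_l2norm// lerD2r lerD2l mulr2n.
by have := dot_le lf lg; lra.
Qed.

Lemma l2norm_triangleB f g : l2 f -> l2 g -> l2norm f <= l2norm (f - g) + l2norm g.
Proof.
by move=> lf lg; rewrite -{1}(subrK g f); apply: l2norm_triangle => //; exact: l2B.
Qed.

Lemma l2norm_sum (J : Type) (s : seq J) (F : J -> I -> R[i]) :
  (forall j, l2 (F j)) -> l2norm (\sum_(j <- s) F j) <= \sum_(j <- s) l2norm (F j).
Proof.
move=> lF; elim: s => [|a s ih]; first by rewrite !big_nil l2norm0.
rewrite !big_cons; apply: le_trans (l2norm_triangle _ _) _ => //.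
  exact: l2_sum.
by rewrite lerD2l.
Qed.

Definition delta i0 : I -> R[i] := fun i => (i == i0)%:R.

Lemma l2_delta i0 : l2 (delta i0).
Proof.
apply/l2E/(abs_summable_supp1 (i0 := i0)) => i ii0.
by rewrite /delta (negbTE ii0) /nsq /= expr0n addr0.
Qed.

Lemma inner_delta f i0 : inner f (delta i0) = f i0.
Proof.
rewrite innerE /dot !(rsum_supp1 (i0 := i0)) /delta /= ?eqxx.
- by case: (f i0) => a b /=; congr (_ +i* _); ring.
- by move=> i /negbTE ->; case: (f i) => a b /=; ring.
- by move=> i /negbTE ->; case: (f i) => a b /=; ring.
Qed.

End L2Theory.

(** ** Geometric estimates *)

Section Geometric.
Context (R : realType).

Lemma geometric_small (C rho e : R) : 0 <= rho < 1 -> 0 < e ->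
  exists n, C * rho ^+ n < e.
Proof.
move=> /andP[r0 r1] e0.
have [C0|C0] := leP C 0.
  by exists 0%N; apply: le_lt_trans e0; rewrite expr0 mulr1.
have [->|rn0] := eqVneq rho 0.
  by exists 1%N; rewrite expr1 mulr0.
have rp : 0 < rho by rewrite lt_def rn0.
pose h := rho^-1 - 1.
have hp : 0 < h by rewrite subr_gt0 invf_gt1.
have [n hn] : exists n : nat, C / e / h < n%:R.
  exists (Num.bound (C / e / h)); apply: archi_boundP.
  by rewrite !divr_ge0// ltW.
exists n; have rn : 1 + n%:R * h <= (rho ^+ n)^-1.
  rewrite -exprVn (_ : rho^-1 = 1 + h); last by rewrite /h; ring.
  elim: n {hn} => [|n ih]; first by rewrite expr0 mul0r addr0.
  rewrite exprS; apply: le_trans (_ : (1 + h) * (1 + n%:R * h) <= _).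
    rewrite -[n.+1]addn1 natrD -subr_ge0.
    rewrite (_ : _ - _ = n%:R * h ^+ 2); last by ring.
    by rewrite mulr_ge0// sqr_ge0.
  by rewrite ler_pM2l// addr_gt0.
have Cl : C / e < (rho ^+ n)^-1.
  apply: lt_le_trans rn; rewrite ltr_wpDl//.
  by rewrite -ltr_pdivrMr.
rewrite -ltr_pdivlMr ?exprn_gt0// -(ltr_pM2l (x := e^-1)) ?invr_gt0//.
by rewrite mulrA mulVf ?gt_eqF// mul1r mulrC.
Qed.

Lemma geometric_eq0 (x C rho : R) : 0 <= rho < 1 ->
  (forall n, `|x| <= C * rho ^+ n) -> x = 0.
Proof.
move=> rr xC; apply/eqP; rewrite -normr_eq0; apply/negPn/negP => x0.
have xp : 0 < `|x| by rewrite lt_def x0 /=.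
have [n] := geometric_small C rr xp.
by rewrite ltNge xC.
Qed.

Lemma geometric_sum_le (rho : R) n m : 0 <= rho < 1 -> (n <= m)%N ->
  \sum_(n <= j < m) rho ^+ j <= rho ^+ n / (1 - rho).
Proof.
move=> /andP[r0 r1] nm; have rp : 0 < 1 - rho by rewrite subr_gt0.
rewrite ler_pdivlMr// mulrBr mulr1 big_distrl /= -sumrB.
under eq_bigr do rewrite -exprSr -opprB.
by rewrite sumrN telescope_sumr// opprB gerBl exprn_ge0.
Qed.

Lemma geometric_cauchy (x : nat -> R) (C rho : R) : 0 <= rho < 1 ->
  (forall n m, (n <= m)%N -> `|x m - x n| <= C * rho ^+ n) ->
  exists l, forall n, `|l - x n| <= C * rho ^+ n.
Proof.
move=> rr xC.
have ub : ubound (range (fun n => x n - C * rho ^+ n)) (x 0%N + C).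
  move=> _ [n _ <-]; have := xC 0%N n (leq0n _).
  rewrite expr0 mulr1 ler_norml => /andP[_ h].
  have C0 : 0 <= C * rho ^+ n by apply: le_trans (xC n n _); rewrite ?normr_ge0.
  by lra.
have ubn n : ubound (range (fun n => x n - C * rho ^+ n)) (x n + C * rho ^+ n).
  move=> _ [m _ <-].
  have C0 k : 0 <= C * rho ^+ k by apply: le_trans (xC k k _); rewrite ?normr_ge0.
  have := C0 n; have := C0 m.
  have [nm|/ltnW mn] := leqP n m.
    by have := xC _ _ nm; rewrite ler_norml => /andP[]; lra.
  by have := xC _ _ mn; rewrite ler_norml => /andP[]; lra.
have hs : has_sup (range (fun n => x n - C * rho ^+ n)).
  by split; [exists (x 0%N - C * rho ^+ 0); exists 0%N|exists (x 0%N + C)].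
exists (sup (range (fun n => x n - C * rho ^+ n))) => n.
rewrite ler_distl; apply/andP; split.
  by apply: sup_upper_bound => //; exists n.
by apply: ge_sup => //; case: hs.
Qed.

End Geometric.

Section Completeness.
Context (R : realType) (I : choiceType).

(** The limit is taken pointwise, and the norm estimate passes to it because
    it can be checked on finite sets of indices. *)
Lemma l2_geometric_series (y : nat -> I -> R[i]) (C rho : R) : 0 <= rho < 1 ->
  (forall j, l2 (y j)) -> (forall j, l2norm (y j) <= C * rho ^+ j) ->
  exists2 h, l2 h &
    forall n, l2norm (h - \sum_(j < n) y j) <= 2 * (C / (1 - rho)) * rho ^+ n.
Proof.
move=> rr ly yC; have [r0 r1] := andP rr.
pose S n : I -> R[i] := \sum_(j < n) y j.
pose D := C / (1 - rho).
have lS n : l2 (S n) by apply: l2_sum.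
have C0 : 0 <= C by have := yC 0%N; rewrite expr0 mulr1; apply: le_trans (l2norm_ge0 _).
have D0 : 0 <= D by rewrite divr_ge0// subr_ge0 ltW.
have Dr n : 0 <= D * rho ^+ n by exact: mulr_ge0 D0 (exprn_ge0 n r0).
have SC n m : (n <= m)%N -> l2norm (S m - S n) <= D * rho ^+ n.
  move=> nm; have -> : S m - S n = \sum_(n <= j < m) y j.
    rewrite /S -!(big_mkord xpredT) (big_cat_nat _ nm)//=.
    by rewrite addrAC subrr add0r.
  apply: le_trans (l2norm_sum _ ly) _.
  apply: le_trans (ler_sum _ (fun j _ => yC j)) _.
  rewrite -mulr_sumr /D -mulrA ler_wpM2l// mulrC.
  exact: geometric_sum_le.
have Sp n m i : (n <= m)%N -> nsq (S m i - S n i) <= (D * rho ^+ n) ^+ 2.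
  move=> nm; apply: le_trans (nsq_le_dot (f := S m - S n) i _) _.
    exact: l2B.
  rewrite -sqr_l2norm; last exact: l2B.
  by rewrite ler_pXn2r ?nnegrE ?l2norm_ge0 ?Dr// SC.
have cvRe i : exists l, forall n,
    `|l - complex.Re (S n i)| <= D * rho ^+ n.
  apply: geometric_cauchy => // n m nm.
  rewrite -(ler_pXn2r (n := 2)) ?nnegrE ?Dr//.
  rewrite real_normK ?num_real//; apply: le_trans (Sp n m i nm); rewrite /nsq.
  by case: (S m i) (S n i) => a b [c d] /=; rewrite lerDl sqr_ge0.
have cvIm i : exists l, forall n,
    `|l - complex.Im (S n i)| <= D * rho ^+ n.
  apply: geometric_cauchy => // n m nm.
  rewrite -(ler_pXn2r (n := 2)) ?nnegrE ?Dr//.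
  rewrite real_normK ?num_real//; apply: le_trans (Sp n m i nm); rewrite /nsq.
  by case: (S m i) (S n i) => a b [c d] /=; rewrite lerDr sqr_ge0.
have [hr hrP] := choice cvRe; have [hi hiP] := choice cvIm.
pose h i := hr i +i* hi i.
have hP i k : nsq (h i - S k i) <= 2 * (D * rho ^+ k) ^+ 2.
  have := hrP i k; have := hiP i k; rewrite /nsq /h.
  have := Dr k; move: (D * rho ^+ k) => d d0.
  case: (S k i) => a b /=; rewrite !ler_norml => /andP[? ?] /andP[? ?].
  by rewrite mulr2n mulrDl mul1r lerD//; nra.
have bound n s : uniq s ->
    \sum_(i <- s) nsq ((h - S n) i) <= (2 * D * rho ^+ n) ^+ 2.
  move=> us; have Dn0 := Dr n.
  apply: (@le_trans _ _ (2 * (D * rho ^+ n) ^+ 2)); last first.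
    rewrite (_ : (2 * D * rho ^+ n) ^+ 2 = 4 * (D * rho ^+ n) ^+ 2); last by ring.
    by have := sqr_ge0 (D * rho ^+ n) => ?; lra.
  rewrite -subr_le0 leNgt; apply/negP => ep.
  set e := (X in 0 < X) in ep.
  pose K := 4 * D ^+ 2 * (size s)%:R.
  have K0 : 0 <= K by rewrite /K mulr_ge0// mulr_ge0// exprn_ge0.
  have [m mP] := geometric_small K rr ep.
  pose k := maxn n m.
  have nk : (n <= k)%N by rewrite leq_maxl.
  have rk : rho ^+ k <= rho ^+ m.
    by rewrite ler_wiXn2l// ?leq_maxr// ltW.
  have Dk : \sum_(i <- s) nsq ((S k - S n) i) <= (D * rho ^+ n) ^+ 2.
    apply: le_trans (_ : dot (S k - S n) (S k - S n) <= _).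
      apply: (@rsum_ge_seq _ _ (fun i => nsq ((S k - S n) i))) => // [i|].
        exact: nsq_ge0.
      by apply: (l2E _).1; exact: l2B.
    rewrite -sqr_l2norm; last exact: l2B.
    by rewrite ler_pXn2r ?nnegrE ?l2norm_ge0 ?Dr// SC.
  have hk : \sum_(i <- s) nsq (h i - S k i) <= 2 * (D * rho ^+ k) ^+ 2 * (size s)%:R.
    rewrite mulr_natr -iter_addr_0 -(count_predT s) -big_const_seq; apply: ler_sum => i _; exact: hP.
  have : e <= K * rho ^+ k.
    rewrite /e lerBlDr.
    apply: (@le_trans _ _ (\sum_(i <- s) (2 * nsq (h i - S k i)
        + 2 * nsq ((S k - S n) i)))).
      apply: ler_sum => i _; rewrite /nsq !fctE.
      case: (h i) (S k i) (S n i) => a b [c d] [u v] /=.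
      have := sqr_ge0 (a - c - (c - u)); have := sqr_ge0 (b - d - (d - v)) => *; lra.
    rewrite big_split /= -!mulr_sumr lerD ?ler_pM2l//.
    apply: le_trans (ler_wpM2l _ hk) _ => //.
    have KE (x : R) : 2 * (2 * (D * x) ^+ 2 * (size s)%:R) = K * x * x.
      by rewrite /K; ring.
    rewrite KE ler_piMr ?(mulr_ge0 K0) ?exprn_ge0//.
    by rewrite exprn_ile1// ltW.
  have KK : K * rho ^+ k <= K * rho ^+ m by rewrite ler_wpM2l.
  by move=> eK; have := le_lt_trans (le_trans eK KK) mP; rewrite ltxx.
have lh n : l2 (h - S n) /\ l2norm (h - S n) <= 2 * D * rho ^+ n.
  have [|sm le] := rsum_le_bound _ (bound n); first by move=> i; exact: nsq_ge0.
  have l : l2 (h - S n) by exact: (l2E _).2.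
  split=> //; rewrite -(ler_pXn2r (n := 2)) ?nnegrE ?l2norm_ge0//.
    by rewrite sqr_l2norm.
  by rewrite -mulrA mulr_ge0.
exists h; last by move=> n; case: (lh n).
by rewrite -(subrK (S 0%N) h); apply: l2D => //; case: (lh 0%N).
Qed.

End Completeness.

(** * Polynomials of a bounded self-adjoint operator *)

Section PolynomialCalculus.
Context (R : realType) (I : choiceType).
Variable A : (I -> R[i]) -> (I -> R[i]).
Hypothesis AD : forall f g, A (f + g) = A f + A g.
Hypothesis AZ : forall z f, A (z \*o f) = z \*o A f.
Implicit Types (f g h : I -> R[i]) (P Q : {poly R[i]}) (p q : {poly R}).

(** Polynomials with complex coefficients are needed for the translation
    operator on sequences, which is not self-adjoint; [poly_op] is the case of
    real coefficients. *)
Definition cpoly_op P f : I -> R[i] := \sum_(j < size P) P`_j \*o iter j A f.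

Lemma scalefD z f g : z \*o (f + g) = z \*o f + z \*o g.
Proof. by apply/funext => i; rewrite /= !fctE mulrDr. Qed.

Lemma scalefA z w f : z \*o (w \*o f) = (z * w) \*o f.
Proof. by apply/funext => i; rewrite /= mulrA. Qed.

Lemma scale1f f : 1 \*o f = f.
Proof. by apply/funext => i; rewrite /= mul1r. Qed.

Lemma scale0f f : 0 \*o f = 0.
Proof. by apply/funext => i; rewrite /= mul0r. Qed.

Lemma scalef0 z : z \*o (0 : I -> R[i]) = 0.
Proof. by apply/funext => i; rewrite /= mulr0. Qed.

Lemma scaleDf z w f : (z + w) \*o f = z \*o f + w \*o f.
Proof. by apply/funext => i; rewrite /= mulrDl. Qed.

Lemma scalef_sum z (J : Type) (s : seq J) (F : J -> I -> R[i]) :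
  z \*o (\sum_(j <- s) F j) = \sum_(j <- s) z \*o F j.
Proof.
by elim: s => [|a s ih]; [rewrite !big_nil scalef0|rewrite !big_cons scalefD ih].
Qed.

Lemma A0 : A 0 = 0.
Proof. by rewrite -[X in A X](scale0f 0) AZ scale0f. Qed.

Lemma A_sum (J : Type) (s : seq J) (F : J -> I -> R[i]) :
  A (\sum_(j <- s) F j) = \sum_(j <- s) A (F j).
Proof. by elim: s => [|a s ih]; [rewrite !big_nil A0|rewrite !big_cons AD ih]. Qed.

Lemma cpoly_op_wide P n f : (size P <= n)%N ->
  cpoly_op P f = \sum_(j < n) P`_j \*o iter j A f.
Proof.
move=> sn; rewrite /cpoly_op -!(big_mkord xpredT (fun j => P`_j \*o iter j A f)).
rewrite (big_cat_nat (leq0n _) sn)/= [X in _ + X]big1_seq ?addr0// => j.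
by rewrite mem_index_iota => /andP[_ /andP[h _]]; rewrite nth_default// scale0f.
Qed.

Lemma cpoly_op0 f : cpoly_op 0 f = 0.
Proof. by rewrite /cpoly_op size_poly0 big_ord0. Qed.

Lemma cpoly_opD P Q f : cpoly_op (P + Q) f = cpoly_op P f + cpoly_op Q f.
Proof.
rewrite (@cpoly_op_wide _ (maxn (size P) (size Q))) ?size_polyD//.
rewrite (@cpoly_op_wide P (maxn (size P) (size Q))) ?leq_maxl//.
rewrite (@cpoly_op_wide Q (maxn (size P) (size Q))) ?leq_maxr// -big_split/=.
by apply: eq_bigr => j _; rewrite coefD scaleDf.
Qed.

Lemma cpoly_opC c f : cpoly_op c%:P f = c \*o f.
Proof.
by rewrite (@cpoly_op_wide _ 1) ?size_polyC_leq1// big_ord1 coefC.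
Qed.

Lemma cpoly_opMX P f : cpoly_op (P * 'X) f = A (cpoly_op P f).
Proof.
rewrite (@cpoly_op_wide _ (size P).+1); last first.
  by apply: leq_trans (size_polyMleq _ _) _; rewrite size_polyX addn2.
rewrite big_ord_recl coefMX/= scale0f add0r A_sum.
by apply: eq_bigr => j _; rewrite AZ coefMX.
Qed.

Lemma cpoly_op_linD P f g : cpoly_op P (f + g) = cpoly_op P f + cpoly_op P g.
Proof.
elim/poly_ind: P => [|P c ih]; first by rewrite !cpoly_op0 addr0.
by rewrite !cpoly_opD !cpoly_opMX ih AD !cpoly_opC scalefD addrACA.
Qed.

Lemma cpoly_op_linZ P z f : cpoly_op P (z \*o f) = z \*o cpoly_op P f.
Proof.
elim/poly_ind: P => [|P c ih]; first by rewrite !cpoly_op0 scalef0.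
by rewrite !cpoly_opD !cpoly_opMX ih AZ !cpoly_opC scalefD !scalefA mulrC.
Qed.

Lemma cpoly_opZ c P f : cpoly_op (c *: P) f = c \*o cpoly_op P f.
Proof.
rewrite (@cpoly_op_wide _ (size P)) ?size_scale_leq// /cpoly_op scalef_sum.
by apply: eq_bigr => j _; rewrite coefZ scalefA.
Qed.

Lemma cpoly_opM P Q f : cpoly_op (P * Q) f = cpoly_op P (cpoly_op Q f).
Proof.
elim/poly_ind: P => [|P c ih]; first by rewrite mul0r !cpoly_op0.
rewrite mulrDl mulrAC !cpoly_opD !cpoly_opMX ih; congr (_ + _).
by rewrite mul_polyC cpoly_opZ cpoly_opC.
Qed.

Lemma l2_cpoly_op P f : (forall f, l2 f -> l2 (A f)) -> l2 f -> l2 (cpoly_op P f).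
Proof.
move=> Al lf; elim/poly_ind: P => [|P c ih]; first by rewrite cpoly_op0; exact: l2_0.
by rewrite cpoly_opD cpoly_opMX cpoly_opC; apply: l2D; [exact: Al|exact: l2Z].
Qed.

Local Notation emb := (map_poly (real_complex R)).

Lemma poly_opE p f : poly_op A p f = cpoly_op (emb p) f.
Proof.
apply/funext => i; rewrite /poly_op /cpoly_op size_map_poly fct_sumE.
by apply: eq_bigr => j _; rewrite coef_map.
Qed.

Lemma poly_opD p q f : poly_op A (p + q) f = poly_op A p f + poly_op A q f.
Proof. by rewrite !poly_opE rmorphD/= cpoly_opD. Qed.

Lemma poly_opM p q f : poly_op A (p * q) f = poly_op A p (poly_op A q f).
Proof. by rewrite !poly_opE rmorphM/= cpoly_opM. Qed.

Lemma poly_opC c f : poly_op A c%:P f = c%:C \*o f.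
Proof. by rewrite !poly_opE map_polyC/= cpoly_opC. Qed.

Lemma poly_op1 f : poly_op A 1 f = f.
Proof. by rewrite poly_opC scale1f. Qed.

Lemma poly_opX f : poly_op A 'X f = A f.
Proof. by rewrite poly_opE map_polyX -['X]mul1r cpoly_opMX cpoly_opC scale1f. Qed.

Lemma poly_opZ c p f : poly_op A (c *: p) f = c%:C \*o poly_op A p f.
Proof. by rewrite !poly_opE map_polyZ/= cpoly_opZ. Qed.

Lemma poly_opN p f : poly_op A (- p) f = - poly_op A p f.
Proof. by rewrite -scaleN1r poly_opZ rmorphN1 scaleN1f. Qed.

Lemma poly_opB p q f : poly_op A (p - q) f = poly_op A p f - poly_op A q f.
Proof. by rewrite poly_opD poly_opN. Qed.

Lemma poly_op0 f : poly_op A 0 f = 0.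
Proof. by rewrite poly_opE rmorph0 cpoly_op0. Qed.

Lemma poly_op_sum (J : Type) (s : seq J) (F : J -> {poly R}) f :
  poly_op A (\sum_(j <- s) F j) f = \sum_(j <- s) poly_op A (F j) f.
Proof.
by elim: s => [|a s ih]; [rewrite !big_nil poly_op0|rewrite !big_cons poly_opD ih].
Qed.

Lemma poly_op_linD p f g : poly_op A p (f + g) = poly_op A p f + poly_op A p g.
Proof. by rewrite !poly_opE cpoly_op_linD. Qed.

Lemma poly_op_linZ p z f : poly_op A p (z \*o f) = z \*o poly_op A p f.
Proof. by rewrite !poly_opE cpoly_op_linZ. Qed.

Lemma poly_op_linN p f : poly_op A p (- f) = - poly_op A p f.
Proof. by rewrite -!scaleN1f poly_op_linZ. Qed.

Lemma poly_op_linB p f g : poly_op A p (f - g) = poly_op A p f - poly_op A p g.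
Proof. by rewrite poly_op_linD poly_op_linN. Qed.

Lemma poly_op_comm p q f : poly_op A p (poly_op A q f) = poly_op A q (poly_op A p f).
Proof. by rewrite -!poly_opM mulrC. Qed.

Lemma poly_op_A p f : poly_op A p (A f) = A (poly_op A p f).
Proof. by rewrite -!poly_opX poly_op_comm. Qed.

End PolynomialCalculus.

(** Everything is required on square-summable families only, except linearity,
    which local operators have on all families. *)
Record bounded_selfadjoint (R : realType) (I : choiceType)
    (A : (I -> R[i]) -> (I -> R[i])) (L : R) : Prop := BoundedSelfadjoint {
  bsaD : forall f g, A (f + g) = A f + A g ;
  bsaZ : forall z f, A (z \*o f) = z \*o A f ;
  bsa_l2 : forall f, l2 f -> l2 (A f) ;
  bsa_sym : forall f g, l2 f -> l2 g -> dot (A f) g = dot f (A g) ;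
  bsa_norm_ge0 : 0 <= L ;
  bsa_norm : forall f, l2 f -> l2norm (A f) <= L * l2norm f }.

Section SelfAdjoint.
Context (R : realType) (I : choiceType) (A : (I -> R[i]) -> (I -> R[i])) (L : R).
Hypothesis bsaA : bounded_selfadjoint A L.
Implicit Types (f g h : I -> R[i]) (p q : {poly R}) (z : R[i]).
Let AD := bsaD bsaA.
Let AZ := bsaZ bsaA.
Let Al2 := bsa_l2 bsaA.
Let Asym := bsa_sym bsaA.
Local Notation op := (poly_op A).

Lemma l2_poly_op p f : l2 f -> l2 (op p f).
Proof. by move=> lf; rewrite poly_opE; exact: l2_cpoly_op. Qed.

Lemma poly_op_sym p f g : l2 f -> l2 g -> dot (op p f) g = dot f (op p g).
Proof.
move=> lf lg; have lit j k : l2 k -> l2 (iter j A k).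
  by move=> lk; elim: j => //= j; exact: Al2.
have itsym j : forall f g, l2 f -> l2 g -> dot (iter j A f) g = dot f (iter j A g).
  elim: j => // j ih u v lu lv.
  by rewrite iterSr ih// ?Asym//; [exact: lit|exact: Al2].
rewrite !poly_opE /cpoly_op dotC !dot_sumr//; try by move=> j; exact/l2Z/lit.
apply: eq_bigr => j _; rewrite !coef_map/= !dotZr//; try exact: lit.
by rewrite dotC itsym.
Qed.

End SelfAdjoint.

(** * Resolvents by Neumann series *)

Section Resolvent.
Context (R : realType) (I : choiceType) (A : (I -> R[i]) -> (I -> R[i])) (L : R).
Hypothesis bsaA : bounded_selfadjoint A L.
Implicit Types (f g h : I -> R[i]) (p q r : {poly R}) (z : R[i]).
Let AD := bsaD bsaA.
Let AZ := bsaZ bsaA.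
Let Al2 := bsa_l2 bsaA.
Let Asym := bsa_sym bsaA.
Let L0 := bsa_norm_ge0 bsaA.
Let AL := bsa_norm bsaA.
Local Notation op := (poly_op A).

Lemma poly_op_bounded p :
  exists2 K, 0 <= K & forall f, l2 f -> l2norm (op p f) <= K * l2norm f.
Proof.
elim/poly_ind: p => [|p c [K K0 hK]].
  by exists 0 => // f lf; rewrite (poly_op0 A) l2norm0 mul0r.
exists (L * K + `|c|); first by rewrite addr_ge0// mulr_ge0.
move=> f lf; have lpf := l2_poly_op bsaA p lf.
rewrite (poly_opD A) (poly_opC A) mulrC (poly_opM AD AZ) (poly_opX AD AZ).
apply: le_trans (l2norm_triangle _ _) _; [exact: Al2|exact: l2Z|].
rewrite l2normZr// mulrDl lerD2r -mulrA; apply: le_trans (AL lpf) _.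
by rewrite ler_wpM2l// hK.
Qed.

Lemma l2_shifted z f : l2 f -> l2 (shifted A z f).
Proof. by move=> lf; apply: l2B; [exact: Al2|exact: l2Z]. Qed.

Lemma shiftedE z f : shifted A z f = A f - z \*o f.
Proof. by []. Qed.

Lemma shiftedD z f g : shifted A z (f + g) = shifted A z f + shifted A z g.
Proof. by rewrite !shiftedE AD scalefD opprD addrACA. Qed.

Lemma shiftedN z f : shifted A z (- f) = - shifted A z f.
Proof.
by rewrite -scaleN1f !shiftedE AZ; apply/funext => i; rewrite !fctE /=; ring.
Qed.

Lemma shiftedB z f g : shifted A z (f - g) = shifted A z f - shifted A z g.
Proof. by rewrite shiftedD shiftedN. Qed.

(** The polynomial [|x - z|^2], so that [quad z] evaluated at [A] is
    [(A - z)^* (A - z)]. *)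
Definition quad z : {poly R} :=
  ('X - (complex.Re z)%:P) ^+ 2 + (complex.Im z ^+ 2)%:P.

Lemma quadE z x : (quad z).[x] = (x - complex.Re z) ^+ 2 + complex.Im z ^+ 2.
Proof. by rewrite /quad !hornerE. Qed.

Lemma shifted_conj z f : shifted A z^*%C (shifted A z f) = op (quad z) f.
Proof.
rewrite /quad expr2 (poly_opD A) (poly_opM AD AZ) !(poly_opB A) !(poly_opX AD AZ).
rewrite !(poly_opC A) !shiftedE -!scaleN1f !AD !AZ.
apply/funext => i; rewrite !fctE /=.
set a := A (A f) i; set b := A f i; set c := f i.
have zE : z = (complex.Re z)%:C + 'i%C * (complex.Im z)%:C by rewrite -complexE.
rewrite [in LHS]zE; move: (complex.Re z) (complex.Im z) => x y.
by case: a b c => a1 a2 [b1 b2] [c1 c2]; apply/eqP; rewrite eq_complex /=;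
  apply/andP; split; apply/eqP; ring.
Qed.

Lemma shifted_op z p f : shifted A z (op p f) = op p (shifted A z f).
Proof.
by rewrite !shiftedE (poly_op_linB AD AZ) (poly_op_A AD AZ) (poly_op_linZ AD AZ).
Qed.

Lemma shifted_comm z w f : shifted A z (shifted A w f) = shifted A w (shifted A z f).
Proof.
rewrite !shiftedE -!scaleN1f !AD !AZ; apply/funext => i; rewrite !fctE /=.
by ring.
Qed.

Lemma dot_shifted z f g : l2 f -> l2 g ->
  dot (shifted A z f) g = dot f (shifted A z^*%C g).
Proof.
move=> lf lg; have lAf := Al2 lf; have lAg := Al2 lg.
rewrite !shiftedE dotBl ?dotBr//; try exact: l2Z.
by rewrite Asym// dot_mulJ.
Qed.

Lemma sqr_l2norm_shifted z f : l2 f ->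
  l2norm (shifted A z f) ^+ 2 = dot (op (quad z) f) f.
Proof.
move=> lf; rewrite sqr_l2norm; last exact: l2_shifted.
rewrite dot_shifted//; last exact: l2_shifted.
by rewrite shifted_conj dotC.
Qed.

Lemma l2norm_shifted_le z f : l2 f ->
  l2norm (shifted A z f) <= (L + Num.sqrt (nsq z)) * l2norm f.
Proof.
move=> lf; rewrite shiftedE.
apply: le_trans (l2norm_triangle (Al2 lf) (l2N (l2Z z lf))) _.
rewrite l2normN; last exact: l2Z.
by rewrite l2normZ// mulrDl lerD2r AL.
Qed.

Definition neumann_poly r (M : R) n : {poly R} :=
  M^-1 *: \sum_(j < n) (1 - M^-1 *: r) ^+ j.

Lemma mul_neumann_poly r M n :
  r * neumann_poly r M n = 1 - (1 - M^-1 *: r) ^+ n.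
Proof.
rewrite /neumann_poly -scalerAr scalerAl -[RHS]opprB subrX1 -mulNr.
by congr (_ * _); rewrite opprB subKr.
Qed.

(** Partial sums of the Neumann series for [r(A)^-1 g] converge as soon as the
    iterates of [1 - r(A)/M] decay geometrically on the single vector [g]; the
    lemma thus also serves where [r(A)] is invertible on a subspace only. *)
Lemma neumann_solution r (M C rho : R) g : 0 <= rho < 1 -> l2 g ->
  (forall n, l2norm (op ((1 - M^-1 *: r) ^+ n) g) <= C * rho ^+ n) ->
  exists h D, [/\ l2 h, op r h = g &
    forall n, l2norm (h - op (neumann_poly r M n) g) <= D * rho ^+ n].
Proof.
move=> rr lg gC; have [r0 r1] := andP rr.
pose e := 1 - M^-1 *: r.
have le n : l2 (op (M^-1 *: e ^+ n) g) by apply: (l2_poly_op bsaA).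
have [n|h lh hh] := l2_geometric_series (y := fun n => op (M^-1 *: e ^+ n) g)
   (C := `|M^-1| * C) rr le.
  rewrite (poly_opZ A) l2normZr; last exact: (l2_poly_op bsaA).
  by rewrite -mulrA ler_wpM2l// gC.
have sumE n : \sum_(j < n) op (M^-1 *: e ^+ j) g = op (neumann_poly r M n) g.
  by rewrite /neumann_poly scaler_sumr (poly_op_sum A).
exists h, (2 * (`|M^-1| * C / (1 - rho))); split => // [|n]; last by rewrite -sumE.
have [K K0 hK] := poly_op_bounded r.
apply/eqP; rewrite -subr_eq0; apply/eqP; apply: l2norm_eq0.
  by apply: l2B => //; exact: (l2_poly_op bsaA).
apply: (@geometric_eq0 _ _ (K * (2 * (`|M^-1| * C / (1 - rho))) + C) rho) => // n.
rewrite ger0_norm ?l2norm_ge0//.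
have lq := l2_poly_op bsaA (neumann_poly r M n) lg.
have len := l2_poly_op bsaA (e ^+ n) lg.
have -> : op r h - g = op r (h - op (neumann_poly r M n) g) - op (e ^+ n) g.
  rewrite (poly_op_linB AD AZ) -(poly_opM AD AZ) mul_neumann_poly.
  by rewrite (poly_opB A) (poly_op1 A) -[RHS]addrA opprB addrAC subrr add0r.
apply: le_trans (l2norm_triangle _ (l2N len)) _.
  by apply: (l2_poly_op bsaA); exact: l2B.
rewrite (l2normN len) mulrDl; apply: lerD; last exact: gC.
apply: le_trans (hK _ (l2B lh lq)) _; by rewrite -[leRHS]mulrA; apply: ler_wpM2l => //; rewrite -sumE.
Qed.

(** Expanding the square of [f - |A - z|^2 f / M] gives
    [|f|^2 - (2/M) |(A - z) f|^2 + |(A - z)^* (A - z) f|^2 / M^2], and the bound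
    on [(A - z)^*] makes the last term at most half of the middle one. *)
Lemma l2norm_contraction z (M : R) f : 0 < M -> l2 f ->
  (forall f, l2 f -> l2norm (shifted A z^*%C f) ^+ 2 <= M * l2norm f ^+ 2) ->
  l2norm (op (1 - M^-1 *: quad z) f) ^+ 2 <=
  l2norm f ^+ 2 - M^-1 * l2norm (shifted A z f) ^+ 2.
Proof.
move=> M0 lf bzc; have lqf := l2_poly_op bsaA (quad z) lf.
rewrite (poly_opB A) (poly_op1 A) (poly_opZ A).
have lmq := l2Z (M^-1)%:C lqf.
rewrite sqr_l2norm; last exact: l2B.
rewrite dot_sqrD//; last exact: l2N.
rewrite !dotNr dotNl opprK dotZr// [in X in _ + X <= _]dotZr//.
rewrite dotZl// (dotC f) -sqr_l2norm_shifted// -!sqr_l2norm//.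
have h : M^-1 * l2norm (op (quad z) f) ^+ 2 <= l2norm (shifted A z f) ^+ 2.
  by rewrite ler_pdivrMl// -shifted_conj; apply: bzc; exact: l2_shifted.
have : M^-1 * (M^-1 * l2norm (op (quad z) f) ^+ 2) <=
       M^-1 * l2norm (shifted A z f) ^+ 2 by rewrite ler_pM2l ?invr_gt0.
by lra.
Qed.

(** By [l2norm_contraction] the lower bound makes [1 - |A - z|^2 / M] a strict
    contraction, so the Neumann series solves [(A - z)(A - z)^* h = g]. *)
Lemma resolvent_of_lower_bound z (d : R) : 0 < d ->
  (forall f, l2 f -> d * l2norm f <= l2norm (shifted A z f)) ->
  resolvent_set A (@l2 R I) z.
Proof.
move=> d0 lower.
have inj : set_inj (@l2 R I) (shifted A z).
  move=> f g /set_mem lf /set_mem lg fg.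
  have lfg := l2B lf lg.
  apply/eqP; rewrite -subr_eq0; apply/eqP/l2norm_eq0 => //.
  apply/eqP; rewrite eq_le l2norm_ge0 andbT -(ler_pM2l d0) mulr0.
  by apply: le_trans (lower _ lfg) _; rewrite shiftedB fg subrr l2norm0.
split; last first.
  by exists d^-1 => f lf; rewrite -(ler_pM2l d0) mulrA mulfV ?gt_eqF// mul1r lower.
split => //; first by move=> f; exact: l2_shifted.
move=> g lg.
pose K := L + Num.sqrt (nsq z).
have K0 : 0 <= K by rewrite addr_ge0// sqrtr_ge0.
(* The term [d^2 + 1] keeps the contraction factor [rho] away from 0 and 1. *)
pose M := K ^+ 2 + d ^+ 2 + 1.
have M0 : 0 < M by rewrite ltr_wpDl// addr_ge0// sqr_ge0.
have bd w : nsq w = nsq z -> forall f, l2 f ->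
    l2norm (shifted A w f) ^+ 2 <= M * l2norm f ^+ 2.
  move=> wz f lf; apply: (@le_trans _ _ (K ^+ 2 * l2norm f ^+ 2)).
    rewrite -exprMn ler_pXn2r ?nnegrE ?l2norm_ge0 ?mulr_ge0 ?l2norm_ge0//.
    by have := l2norm_shifted_le w lf; rewrite wz.
  by rewrite ler_wpM2r ?sqr_ge0// /M -addrA lerDl addr_ge0// sqr_ge0.
have zc : nsq z^*%C = nsq z by case: (z) => a b; rewrite /nsq /= sqrrN.
pose rho := Num.sqrt (1 - M^-1 * d ^+ 2).
have Md : 0 < M^-1 * d ^+ 2 < 1.
  rewrite mulr_gt0 ?invr_gt0 ?exprn_gt0//= mulrC ltr_pdivrMr// mul1r /M.
  by have := sqr_ge0 K => ?; lra.
have rr : 0 <= rho < 1.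
  rewrite sqrtr_ge0/= -[ltRHS]sqrtr1 ltr_sqrt//.
  by case/andP: Md => ? ?; lra.
pose e := 1 - M^-1 *: quad z.
have contr f : l2 f -> l2norm (op e f) <= rho * l2norm f.
  move=> lf; rewrite -(ler_pXn2r (n := 2)) ?nnegrE ?l2norm_ge0//; last first.
    by rewrite mulr_ge0 ?l2norm_ge0// sqrtr_ge0.
  apply: le_trans (l2norm_contraction M0 lf (bd _ zc)) _.
  rewrite exprMn [rho ^+ 2]sqr_sqrtr; last by rewrite subr_ge0 ltW//; case/andP: Md.
  rewrite mulrBl mul1r lerD2l lerN2 -mulrA ler_pM2l ?invr_gt0// -exprMn.
  rewrite ler_pXn2r ?nnegrE ?l2norm_ge0 ?lower//.
  by rewrite mulr_ge0 ?l2norm_ge0// ltW.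
have [n|h [D [lh rh _]]] := @neumann_solution (quad z) M (l2norm g) rho g
    rr lg.
  elim: n => [|n ih]; first by rewrite !expr0 (poly_op1 A) mulr1.
  rewrite exprS (poly_opM AD AZ); apply: le_trans (contr _ _) _.
    exact: (l2_poly_op bsaA).
  rewrite exprS mulrCA; case/andP: rr => r0 _; exact: ler_wpM2l.
exists (shifted A z^*%C h); first exact: l2_shifted.
by rewrite shifted_comm shifted_conj.
Qed.

(** [|A - z|^2] is the sum of [(A - Re z)^2], which is nonnegative, and of
    [(Im z)^2]. *)
Lemma resolvent_nonreal z : complex.Im z != 0 -> resolvent_set A (@l2 R I) z.
Proof.
move=> z0; apply: (@resolvent_of_lower_bound _ `|complex.Im z|).
  by rewrite normr_gt0.
move=> f lf; rewrite -(ler_pXn2r (n := 2)) ?nnegrE ?l2norm_ge0//; last first.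
  by rewrite mulr_ge0 ?l2norm_ge0.
rewrite exprMn real_normK ?num_real// (sqr_l2norm_shifted z lf) (sqr_l2norm lf).
rewrite /quad (poly_opD A) (poly_opC A) dotDl//; last exact: l2Z.
  rewrite dotZl// lerDr expr2 (poly_opM AD AZ) (poly_op_sym bsaA)//.
    by apply: dot_ge0; exact: (l2_poly_op bsaA).
  exact: (l2_poly_op bsaA).
exact: (l2_poly_op bsaA).
Qed.

End Resolvent.

(** * Measures with a density *)

Section DensityMeasure.
Context d (T : measurableType d) (R : realType).
Variables (mu : {finite_measure set T -> \bar R}) (g : T -> \bar R).
Hypothesis g0 : forall x, (0 <= g x)%E.
Hypothesis intg : mu.-integrable setT g.
Local Open Scope ereal_scope.

(** The two hypotheses are arguments so that the instances below depend on
    nothing but the term itself. *)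
Definition density_measure of (forall x, (0 <= g x)%E) & mu.-integrable setT g :=
  fun E : set T => \int[mu]_(x in E) g x.

Local Notation nu := (density_measure g0 intg).

Let nu0 : nu set0 = 0. Proof. by rewrite /nu integral_set0. Qed.

Let nu_ge0 E : 0 <= nu E. Proof. by apply: integral_ge0. Qed.

Let nu_sigma_additive : semi_sigma_additive nu.
Proof.
by apply: semi_sigma_additive_nng_induced => //; exact: measurable_int intg.
Qed.

HB.instance Definition _ := isMeasure.Build _ _ _ nu nu0 nu_ge0 nu_sigma_additive.

Let nu_fin : fin_num_fun nu.
Proof.
by move=> E mE; apply: integrable_fin_num => //; exact: integrableS intg.
Qed.

HB.instance Definition _ := @Measure_isFinite.Build _ _ _ nu nu_fin.

Definition density_fmeasure : {finite_measure set T -> \bar R} := nu.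

Lemma density_null E : measurable E -> mu E = 0 -> density_fmeasure E = 0.
Proof.
move=> mE muE; apply: null_set_integral => //.
by apply: (measurable_funS measurableT) => //; exact: measurable_int intg.
Qed.

(** The change of variables formula for the Radon-Nikodym derivative, once that
    derivative is identified with [g] almost everywhere. *)
Lemma integral_density h : density_fmeasure.-integrable setT h ->
  \int[density_fmeasure]_x h x = \int[mu]_x (h x * g x).
Proof.
move=> inth.
have dom : density_fmeasure `<< mu.
  by apply/null_content_dominatesP => E; exact: density_null.
rewrite -(Radon_Nikodym_change_of_variables dom measurableT inth).
have mh := measurable_int _ inth; have mg := measurable_int _ intg.
have dom' : charge_of_finite_measure density_fmeasure `<< mu by [].
have iRN := Radon_Nikodym_integrable dom'.
have mRN := measurable_int _ iRN.
apply: ae_eq_integral => //; try exact: emeasurable_funM.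
apply: ae_eqe_mul2l; apply: integral_ae_eq => // E _ mE.
by rewrite -Radon_Nikodym_integral.
Qed.

End DensityMeasure.

Section ConcentratedMeasure.
Context (R : realType).
Implicit Types (mu : {finite_measure set (measurableTypeR R) -> \bar R}).
Implicit Types (S : set (measurableTypeR R)) (h g : measurableTypeR R -> R).

Lemma bounded_integrable mu S h (C : R) : measurable S -> measurable_fun S h ->
  (forall x, S x -> `|h x| <= C) -> mu.-integrable S (EFin \o h).
Proof.
move=> mS mh hC; apply: measurable_bounded_integrable => //.
  by rewrite ltey_eq fin_num_measure.
exists C; split; first exact: num_real.
by move=> y Cy x Sx; apply: le_trans (hC _ Sx) (ltW Cy).
Qed.

(** Polynomials are unbounded on the line; this is what makes them integrable
    against a measure carried by a bounded set. *)
Lemma Rintegral_concentrated mu S h (C : R) : measurable S -> mu (~` S) = 0%E ->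
  measurable_fun setT h -> (forall x, S x -> `|h x| <= C) ->
  mu.-integrable setT (EFin \o h) /\
  \int[mu]_(x in [set: R]) h x = \int[mu]_(x in S) h x.
Proof.
move=> mS muS mh hC.
have mSC : measurable (~` S) by exact: measurableC.
have mhE : measurable_fun setT (EFin \o h) by exact/measurable_EFinP.
have SE : setT `\` ~` S = S by rewrite setTD setCK.
have mhS : measurable_fun S h by exact: measurable_funTS.
have iS : mu.-integrable S (EFin \o h) by exact: (bounded_integrable mu mS mhS hC).
have ih : mu.-integrable setT (EFin \o h).
  by apply/(negligible_integrable mSC measurableT mhE muS); rewrite SE.
split => //; rewrite /Rintegral; congr fine.
by rewrite (negligible_integral mSC _ ih)// SE.
Qed.

Lemma horner_bounded (p : {poly R}) (B : R) :
  exists2 C : R, 0 <= C & forall x : R, `|x| <= B -> `|p.[x]| <= C.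
Proof.
elim/poly_ind: p => [|p c [C C0 hC]].
  by exists 0 => // x _; rewrite horner0 normr0.
exists (C * `|B| + `|c|); first by rewrite addr_ge0// mulr_ge0.
move=> x xB; rewrite hornerMXaddC; apply: le_trans (ler_normD _ _) _.
rewrite lerD2r normrM; apply: ler_pM => //; first exact: hC.
exact: le_trans xB (ler_norm _).
Qed.

Lemma measurable_horner (p : {poly R}) S :
  measurable_fun S (horner p : measurableTypeR R -> R).
Proof.
apply: measurable_funTS; apply: continuous_measurable_fun.
exact: continuous_horner.
Qed.

(** Multiplying the functional of [mu] by a bounded weight gives the functional
    of another measure, absolutely continuous with respect to [mu]. *)
Lemma exists_density mu S g (B C : R) : measurable S -> mu (~` S) = 0%E ->
  (forall x, S x -> `|x| <= B) -> measurable_fun S g ->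
  (forall x, S x -> 0 <= g x <= C) ->
  exists nu : {finite_measure set (measurableTypeR R) -> \bar R},
    (forall E, measurable E -> mu E = 0%E -> nu E = 0%E) /\
    forall p : {poly R},
      \int[nu]_(x in [set: R]) p.[x] = \int[mu]_(x in S) (p.[x] * g x).
Proof.
move=> mS muS SB mg gC.
pose G := EFin \o (g \_ S).
have G0 x : (0 <= G x)%E.
  rewrite /G /= lee_fin patchE; case: ifPn => // /set_mem Sx.
  by case/andP: (gC _ Sx).
have mgS : measurable_fun setT (g \_ S).
  by apply/(measurable_restrictT _ mS).
have gSC x : S x -> `|(g \_ S) x| <= C.
  move=> Sx; rewrite patchE mem_set//.
  by case/andP: (gC _ Sx) => g0 gc; rewrite ger0_norm.
have [iG _] := Rintegral_concentrated mS muS mgS gSC.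
exists (density_fmeasure G0 iG); split; first by move=> E; exact: density_null.
move=> p; have [K K0 hK] := horner_bounded p B.
have pK (x : R) : S x -> `|p.[x]| <= K by move=> Sx; apply: hK; exact: SB.
have mp : measurable_fun [set: measurableTypeR R] (horner p : measurableTypeR R -> R).
  exact: measurable_horner.
have nuS : density_fmeasure G0 iG (~` S) = 0%E.
  by apply: density_null => //; exact: measurableC.
have [ip _] := Rintegral_concentrated mS nuS mp pK.
rewrite {1}/Rintegral integral_density// /Rintegral; congr fine.
rewrite [RHS]integral_mkcond; apply: eq_integral => x _.
rewrite /G /= !patchE; case: ifPn => _ //=.
by rewrite mule0.
Qed.

End ConcentratedMeasure.

(** * Null sets and expanding maps *)

Section ExpandingMaps.
Context (R : realType).
Local Notation leb := (@lebesgue_measure R).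

(** A set on which [F] does not contract distances by more than a factor is
    covered by intervals proportional to those that cover its image. *)
Lemma negligible_preimage_expanding (F : R -> R) (D N : set R) (k : R) :
  0 < k -> (forall x y, D x -> D y -> k * `|x - y| <= `|F x - F y|) ->
  leb.-negligible N -> leb.-negligible (D `&` F @^-1` N).
Proof.
move=> k0 Fk /negligible_outer_measure N0; apply/negligible_outer_measure.
apply/eqP; rewrite eq_le outer_measure_ge0 andbT.
apply/lee_addgt0Pr => e e0; rewrite add0e.
pose e' := e * k / 2.
have e'0 : 0 < e' by rewrite !divr_gt0// mulr_gt0.
move: N0; rewrite outer_measure_open_itv_cover => N0.
have : ereal_inf [set (\sum_(0 <= k <oo) wlength idfun (J k))%E | J in open_itv_cover N]
    \is a fin_num by rewrite N0.
move=> /lb_ereal_inf_adherent-/(_ _ e'0)[_/= [J]] [Jo NJ] <-.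
rewrite N0 add0e => /ltW Je.
have itv n : {ab : R * R | J n = `]ab.1, ab.2[%classic}.
  by apply: cid; have [[a b] ->] := Jo n; exists (a, b).
pose a n := (sval (itv n)).1; pose b n := (sval (itv n)).2.
have JE n : J n = `]a n, b n[%classic by rewrite /a /b; case: (itv n).
pose len n := if a n < b n then b n - a n else 0.
have lenE n : wlength idfun (J n) = (len n)%:E.
  by rewrite JE wlength_itv /len /= lte_fin; case: ifP => // _; rewrite EFinB.
have len0 n : 0 <= len n by rewrite /len; case: ifPn => // ?; rewrite subr_ge0 ltW.
(* A point of [D] sent into [J n]; if there is none, [J n] misses the image of
   [D], and [K n] may be placed anywhere. *)
pose x n : R := xget 0 (D `&` F @^-1` J n).
pose K n := `]x n - len n / k, x n + len n / k[%classic.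
have cover : D `&` F @^-1` N `<=` \bigcup_n K n.
  move=> y [Dy Ny]; have [n _ Jy] := NJ _ Ny; exists n => //.
  have [Dx Jx] : (D `&` F @^-1` J n) (x n).
    by apply: (xgetPex 0); exists y.
  have := Fk _ _ Dy Dx; rewrite -ler_pdivlMl// => yx.
  have ab : a n < b n by move: Jy; rewrite JE /= in_itv/= => /andP[]; exact: lt_trans.
  have : `|F y - F (x n)| < len n.
    move: Jx Jy; rewrite /preimage /= !JE /= !in_itv/= => /andP[? ?] /andP[? ?].
    by rewrite /len ab ltr_norml; apply/andP; split; lra.
  rewrite -(ltr_pM2l (x := k^-1)) ?invr_gt0// => h.
  have := le_lt_trans yx h; rewrite ltr_distl mulrC => /andP[? ?].
  by rewrite /K /= in_itv/=; apply/andP.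
apply: (@le_trans _ _ ((wlength idfun)^* (\bigcup_n K n))%mu).
  exact: le_outer_measure.
apply: le_trans (outer_measure_sigma_subadditive _ _) _.
have -> : (\sum_(0 <= n <oo) (wlength idfun)^* (K n))%mu%E
   = (\sum_(0 <= n <oo) (2 / k)%:E * wlength idfun (J n))%E.
  apply: eq_eseriesr => n _.
  have -> : ((wlength idfun)^* (K n))%mu = leb (K n) by [].
  rewrite /K lebesgue_measure_itv /= lenE lte_fin -EFinM.
  case: ifPn => [_|]; first by rewrite -EFinB; congr (_%:E); field; lra.
  rewrite -leNgt => h; have : len n / k <= 0 by lra.
  by rewrite pmulr_lle0 ?invr_gt0// => l0; rewrite (_ : len n = 0) ?mulr0//; apply/eqP; rewrite eq_le l0 len0.
rewrite nneseriesZl; last by move=> n _; rewrite lenE lee_fin.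
apply: (@le_trans _ _ ((2 / k)%:E * e'%:E)%E).
  by rewrite lee_pmul2l// lte_fin divr_gt0.
by rewrite -EFinM lee_fin /e'; rewrite le_eqVlt; apply/orP; left; apply/eqP; field; lra.
Qed.

End ExpandingMaps.

(** * Spectral measures and the absolutely continuous subspace *)

Section SupportInSpectrum.
Context (R : realType) (I : choiceType) (A : (I -> R[i]) -> (I -> R[i])) (L : R).
Hypothesis bsaA : bounded_selfadjoint A L.
Let AD := bsaD bsaA.
Let AZ := bsaZ bsaA.
Local Notation op := (poly_op A).

(** The moment half of [is_spectral_measure], with integration restricted to
    [S]: it can be established before the spectrum is known. *)
Definition represents (S : set (measurableTypeR R)) (f : I -> R[i])
    (mu : {finite_measure set (measurableTypeR R) -> \bar R}) : Prop :=
  forall p : {poly R}, dot (op p f) f = \int[mu]_(x in S) p.[x].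

Context (S : set (measurableTypeR R)) (B : R).
Hypothesis mS : measurable S.
Hypothesis SB : forall x : R, S x -> `|x| <= B.

Lemma horner_integrable (mu : {finite_measure set (measurableTypeR R) -> \bar R})
  (p : {poly R}) : mu.-integrable S (EFin \o (horner p)).
Proof.
have [C C0 hC] := horner_bounded p B.
apply: (@bounded_integrable _ mu S (horner p) C) => //.
  exact: measurable_horner.
by move=> x Sx; apply: hC; exact: SB.
Qed.

Lemma Rintegral_horner_le (mu : {finite_measure set (measurableTypeR R) -> \bar R})
  (p q : {poly R}) : (forall x : R, S x -> p.[x] <= q.[x]) ->
  \int[mu]_(x in S) p.[x] <= \int[mu]_(x in S) q.[x].
Proof.
by move=> pq; apply: le_Rintegral => //; exact: horner_integrable.
Qed.

Lemma represents_sqr f mu q : l2 f -> represents S f mu ->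
  l2norm (op q f) ^+ 2 = \int[mu]_(x in S) (q ^+ 2).[x].
Proof.
move=> lf rep; have lq := l2_poly_op bsaA q lf.
by rewrite sqr_l2norm// -rep expr2 (poly_opM AD AZ) (poly_op_sym bsaA q lq lf).
Qed.

Lemma represents_shifted f mu q z : l2 f -> represents S f mu ->
  l2norm (shifted A z (op q f)) ^+ 2 = \int[mu]_(x in S) (quad z * q ^+ 2).[x].
Proof.
move=> lf rep; have lq := l2_poly_op bsaA q lf.
have lzq := l2_poly_op bsaA (quad z) lq.
rewrite (sqr_l2norm_shifted bsaA z lq) -rep mulrC expr2 -mulrA [q * quad z]mulrC.
by rewrite !(poly_opM AD AZ) (poly_op_sym bsaA q lzq lf).
Qed.

(** Polynomials that peak at a point [x0] of the support of [mu] turn [f] into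
    approximate eigenvectors for [x0].  The peaks are powers of
    [e = 1 - (x - x0)^2 / K1]: near [x0] they dominate, as [h2^n] against
    [h1^n], their values away from [x0]. *)
Lemma not_bounded_below_at_support f mu (x0 : R) (M : R) :
  l2 f -> represents S f mu ->
  (forall D : R, 0 < D -> (0 < mu (S `&` [set x : R | ((x - x0) ^+ 2 <= D)%R]))%E) ->
  ~ (forall q, l2norm (op q f) <= M * l2norm (shifted A x0%:C (op q f))).
Proof.
move=> lf rep supp hM.
pose w : {poly R} := quad x0%:C.
have wE x : w.[x] = (x - x0) ^+ 2 by rewrite /w quadE /= expr0n addr0.
have w0 x : 0 <= w.[x] by rewrite wE sqr_ge0.
have [K K0 hK] := horner_bounded w B.
pose K1 := K + 1.
have K1p : 0 < K1 by rewrite ltr_wpDl.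
have wK (x : R) : S x -> w.[x] <= K1.
  by move=> /SB/hK; rewrite ger0_norm// /K1 => ?; lra.
(* With [M^2 D <= 1/2], the contribution of the points close to [x0] to the
   upper bound can be absorbed in the left-hand side. *)
pose D := Num.min (K1 / 2) (2 * (M ^+ 2 + 1))^-1.
have Mp : 0 < 2 * (M ^+ 2 + 1) by rewrite mulr_gt0// ltr_wpDl// sqr_ge0.
have D0 : 0 < D by rewrite lt_min divr_gt0//= invr_gt0.
have DK : D <= K1 / 2 by rewrite ge_min lexx.
have DM : M ^+ 2 * D <= 1 / 2.
  have : D <= (2 * (M ^+ 2 + 1))^-1 by rewrite ge_min lexx orbT.
  move=> h; apply: le_trans (ler_wpM2l (sqr_ge0 M) h) _.
  rewrite ler_pdivrMr//; have := sqr_ge0 M; lra.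
pose e : {poly R} := 1 - K1^-1 *: w.
have eE x : e.[x] = 1 - w.[x] / K1.
  by rewrite /e !hornerE mulrC.
pose h1 := 1 - D / K1; pose h2 := 1 - (D / 4) / K1.
have h1p : 1 / 2 <= h1.
  have : D / K1 <= 1 / 2 by rewrite ler_pdivrMr//; lra.
  by rewrite /h1 => ?; lra.
have h12 : h1 < h2.
  by rewrite /h1 /h2 ltrD2l ltrN2 ltr_pM2r ?invr_gt0//; lra.
have e0 x : S x -> 0 <= e.[x] <= 1.
  move=> Sx; rewrite eE subr_ge0 ler_pdivrMr// mul1r wK//=.
  by rewrite gerBl divr_ge0// ltW.
pose m := fine (mu (S `&` [set x : R | (x - x0) ^+ 2 <= D / 4])).
have mset : measurable [set x : measurableTypeR R | ((x - x0) ^+ 2 <= D / 4)%R].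
  rewrite (_ : mkset _ = setT `&` (horner w) @^-1` `]-oo, D / 4]%classic).
    by apply: (measurable_horner w measurableT); exact: measurable_itv.
  by apply/seteqP; split => x /=; rewrite in_itv/= wE; [move=> ?; split|case].
have mp : 0 < m.
  rewrite fine_gt0// supp ?divr_gt0//=.
  by rewrite ltey_eq fin_num_measure//; exact: measurableI.
pose T := fine (mu S).
have key n : m * (h2 ^+ n) ^+ 2 <= 2 * M ^+ 2 * K1 * T * (h1 ^+ n) ^+ 2.
  have low : m * (h2 ^+ n) ^+ 2 <= l2norm (op (e ^+ n) f) ^+ 2.
    rewrite (represents_sqr _ lf rep).
    apply: (@le_trans _ _ (\int[mu]_(x in S `&` [set x : R | (x - x0) ^+ 2 <= D / 4])
       ((h2 ^+ n) ^+ 2)%:P.[x])).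
      under eq_Rintegral do rewrite hornerC.
      by rewrite Rintegral_cst//; [rewrite mulrC|exact: measurableI].
    rewrite Rintegral_mkcondr; apply: le_Rintegral => //.
    - apply: (@bounded_integrable _ mu S _ ((h2 ^+ n) ^+ 2)) => //.
        apply: measurable_funTS; apply/(measurable_restrictT _ mset).
        exact: measurable_horner.
      move=> x _; rewrite patchE hornerC.
      by case: ifPn => _; rewrite ?normr0 ?sqr_ge0// ger0_norm// sqr_ge0.
    - exact: horner_integrable.
    - move=> x Sx; rewrite patchE; case: ifPn => [/set_mem /= xD|_].
        rewrite hornerC !horner_exp.
        have eh : h2 <= e.[x].
          by rewrite eE /h2 lerD2l lerN2 ler_pM2r ?invr_gt0// wE.
        have h20 : 0 <= h2 by lra.
        by rewrite ler_pXn2r ?nnegrE ?exprn_ge0//; [rewrite lerXn2r ?nnegrE//; lra|lra].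
      by rewrite !horner_exp sqr_ge0.
  have up : l2norm (shifted A x0%:C (op (e ^+ n) f)) ^+ 2 <=
      D * l2norm (op (e ^+ n) f) ^+ 2 + K1 * T * (h1 ^+ n) ^+ 2.
    rewrite (represents_shifted _ _ lf rep) (represents_sqr _ lf rep).
    have -> : D * \int[mu]_(x in S) ((e ^+ n) ^+ 2).[x] + K1 * T * (h1 ^+ n) ^+ 2
      = \int[mu]_(x in S) (D *: (e ^+ n) ^+ 2 + (K1 * (h1 ^+ n) ^+ 2)%:P).[x].
      under [RHS]eq_Rintegral do rewrite hornerD hornerZ hornerC.
      rewrite RintegralD//; last 2 first.
      - have := horner_integrable mu (D *: (e ^+ n) ^+ 2).
        by apply: eq_integrable => // x _; rewrite /= hornerZ.
      - have := horner_integrable mu (K1 * (h1 ^+ n) ^+ 2)%:P.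
        by apply: eq_integrable => // x _; rewrite /= hornerC.
      rewrite Rintegral_cst// RintegralZl//; first by rewrite -/T [in RHS]mulrAC.
      exact: (horner_integrable mu ((e ^+ n) ^+ 2)).
    apply: Rintegral_horner_le => x Sx.
    rewrite hornerM [in leRHS]hornerD hornerZ hornerC !horner_exp -/w.
    have [e0x e1x] := andP (e0 _ Sx).
    have en0 : 0 <= (e.[x] ^+ n) ^+ 2 by rewrite sqr_ge0.
    have [wD|Dw] := leP w.[x] D.
      apply: ler_wpDr; last by rewrite ler_wpM2r.
      by rewrite mulr_ge0 ?sqr_ge0// ltW.
    apply: ler_wpDl; first by rewrite mulr_ge0// ltW.
    apply: ler_pM => //; first exact: wK.
    have eh : e.[x] <= h1.
      by rewrite eE /h1 lerD2l lerN2 ler_pM2r ?invr_gt0// ltW.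
    have h10 : 0 <= h1 by lra.
    by rewrite ler_pXn2r ?nnegrE ?exprn_ge0// lerXn2r ?nnegrE.
  have sq : l2norm (op (e ^+ n) f) ^+ 2
      <= M ^+ 2 * l2norm (shifted A x0%:C (op (e ^+ n) f)) ^+ 2.
    rewrite -exprMn.
    have := hM (e ^+ n); move: (l2norm_ge0 (op (e ^+ n) f)).
    set a := l2norm _; set b := M * _ => a0 ab.
    by rewrite lerXn2r ?nnegrE// (le_trans a0 ab).
  have := ler_wpM2l (sqr_ge0 M) up; move: sq low (sqr_ge0 (l2norm (op (e ^+ n) f))).
  set a := l2norm (op (e ^+ n) f) ^+ 2; set b := l2norm _ ^+ 2.
  set c := (h1 ^+ n) ^+ 2 => sq low a0 up2.
  have : M ^+ 2 * (D * a) <= a / 2.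
    by rewrite mulrA; apply: le_trans (ler_wpM2r a0 DM) _; lra.
  by move=> ?; rewrite -!mulrA; lra.
have h2p : 0 < h2 by lra.
pose rho := (h1 / h2) ^+ 2.
have rr : 0 <= rho < 1.
  rewrite sqr_ge0/= exprn_ilt1//; first by rewrite divr_ge0//; lra.
  by rewrite ltr_pdivrMr// mul1r.
have [n hn] := geometric_small (2 * M ^+ 2 * K1 * T) rr mp.
have := key n; rewrite leNgt => /negP; apply.
have hp : 0 < (h2 ^+ n) ^+ 2 by rewrite !exprn_gt0.
rewrite -ltr_pdivrMr//; apply: le_lt_trans hn.
have -> : rho ^+ n = (h1 ^+ n) ^+ 2 / (h2 ^+ n) ^+ 2.
  by rewrite /rho -exprM mulnC exprM !expr_div_n.
by rewrite [leRHS]mulrA.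
Qed.

Lemma spectrum_on_at_support f mu (x0 : R) (H : set (I -> R[i])) :
  l2 f -> represents S f mu -> (forall q, H (op q f)) ->
  (forall D : R, 0 < D -> (0 < mu (S `&` [set x : R | ((x - x0) ^+ 2 <= D)%R]))%E) ->
  spectrum_on A H x0%:C.
Proof.
move=> lf rep Hq supp [_ [M hM]].
by apply: (not_bounded_below_at_support (M := M) lf rep supp) => q; exact: hM.
Qed.

End SupportInSpectrum.

Section AbsolutelyContinuousSubspace.
Context (R : realType) (I : choiceType) (A : (I -> R[i]) -> (I -> R[i])) (L : R).
Hypothesis bsaA : bounded_selfadjoint A L.
Let AD := bsaD bsaA.
Let AZ := bsaZ bsaA.
Local Notation op := (poly_op A).
Local Notation leb := (@lebesgue_measure R).
Context (S : set (measurableTypeR R)) (B : R).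
Hypothesis mS : measurable S.
Hypothesis SB : forall x : R, S x -> `|x| <= B.
Hypothesis S_spectrum : forall x : R, S x -> spectrum A x%:C.
Hypothesis spectrum_S : forall x : R, spectrum A x%:C -> S x \/ x = 0.
Implicit Types (f g h : I -> R[i]) (p q : {poly R}) (z : R[i]).
Implicit Types mu : {finite_measure set (measurableTypeR R) -> \bar R}.

(** The inner product of [p(A) f] and [f] is real. *)
Lemma dot_poly_op_imag p f : l2 f -> dot (op p f) ('i%C \*o f) = 0.
Proof.
move=> lf; have lif := l2Z 'i%C lf.
have h : dot (op p f) ('i%C \*o f) = - dot (op p f) ('i%C \*o f).
  rewrite {1}(poly_op_sym bsaA p lf lif) (poly_op_linZ AD AZ).
  have -> : 'i%C \*o op p f = - (('i%C)^*%C \*o op p f).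
    by apply/funext => i; rewrite !fctE /=; case: (op p f i) => a b;
       apply/eqP; rewrite eq_complex /=; apply/andP; split; apply/eqP; ring.
  by rewrite dotNr -dot_mulJ dotC.
by move: h => ?; lra.
Qed.

Lemma ac_subspaceI f mu : l2 f -> represents A S f mu ->
  (forall E, measurable E -> leb E = 0%E -> mu E = 0%E) -> mu (~` S) = 0%E ->
  ac_subspace A f.
Proof.
move=> lf rep ac muS; split => //; exists mu; last first.
  by apply/null_content_dominatesP.
split.
  exists (~` S); split => //; first exact: measurableC.
  by move=> x; apply: contra_not; exact: S_spectrum.
move=> p; rewrite innerE dot_poly_op_imag// rep.
have [C C0 hC] := horner_bounded p B.
have hCS (x : R) : S x -> `|p.[x]| <= C by move=> Sx; apply: hC; exact: SB.
by have [_ ->] := Rintegral_concentrated mS muS (@measurable_horner R p setT) hCS.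
Qed.

(** The spectrum is contained in [S] together with 0, and an absolutely
    continuous measure does not charge the point 0. *)
Lemma ac_subspaceE f : ac_subspace A f -> l2 f /\
  exists mu, [/\ represents A S f mu,
    forall E, measurable E -> leb E = 0%E -> mu E = 0%E & mu (~` S) = 0%E].
Proof.
move=> [lf [mu [neg mom] /null_content_dominatesP ac]]; split => //; exists mu.
have muS : mu (~` S) = 0%E.
  apply: measure_negligible; first exact: measurableC.
  have negT : mu.-negligible ([set x : measurableTypeR R | ~ spectrum A (x : R)%:C]
      `|` [set (0 : R)]).
    apply: negligibleU => //; exists [set (0 : R)]; split => //.
    by apply: ac => //; exact: lebesgue_measure_set1.
  apply: (negligibleS _ negT) => x /= nSx.
  have [sx|] := pselect (spectrum A (x : R)%:C); last by left.
  by right; case: (spectrum_S sx).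
split => // p; have := mom p; rewrite innerE => -[-> _].
have [C C0 hC] := horner_bounded p B.
have hCS (x : R) : S x -> `|p.[x]| <= C by move=> Sx; apply: hC; exact: SB.
by have [_ ->] := Rintegral_concentrated mS muS (@measurable_horner R p setT) hCS.
Qed.

(** The absolutely continuous subspace is invariant under every operation that
    multiplies spectral measures by a bounded weight; the following lemmas are
    instances. *)
Lemma ac_subspace_density mu (w : measurableTypeR R -> R) (C : R) h : l2 h ->
  (forall E, measurable E -> leb E = 0%E -> mu E = 0%E) -> mu (~` S) = 0%E ->
  measurable_fun S w -> (forall x, S x -> 0 <= w x <= C) ->
  (forall p, dot (op p h) h = \int[mu]_(x in S) (p.[x] * w x)) ->
  ac_subspace A h.
Proof.
move=> lh ac muS mw wC rep.
have [nu [numu nuE]] := exists_density mS muS SB mw wC.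
have nuS : nu (~` S) = 0%E by apply: numu => //; exact: measurableC.
apply: (@ac_subspaceI _ nu) => //; last by move=> E mE lE; apply: numu => //; exact: ac.
move=> p; rewrite rep -nuE.
have [K K0 hK] := horner_bounded p B.
have hKS (x : R) : S x -> `|p.[x]| <= K by move=> Sx; apply: hK; exact: SB.
by have [_ ->] := Rintegral_concentrated mS nuS (@measurable_horner R p setT) hKS.
Qed.

Lemma ac_poly_op q f : ac_subspace A f -> ac_subspace A (op q f).
Proof.
move=> /ac_subspaceE[lf [mu [rep ac muS]]].
have lq := l2_poly_op bsaA q lf.
have [C C0 hC] := horner_bounded (q ^+ 2) B.
apply: (@ac_subspace_density mu (horner (q ^+ 2)) C) => //.
- exact: measurable_horner.
- move=> x Sx; rewrite horner_exp sqr_ge0/= -horner_exp.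
  exact: le_trans (ler_norm _) (hC _ (SB Sx)).
- move=> p; have lpq := l2_poly_op bsaA p lq.
  rewrite -(poly_op_sym bsaA q lpq lf) -!(poly_opM AD AZ) rep.
  by apply: eq_Rintegral => x _; rewrite !(hornerM, horner_exp); ring.
Qed.

Lemma ac_shifted z f : ac_subspace A f -> ac_subspace A (shifted A z f).
Proof.
move=> /ac_subspaceE[lf [mu [rep ac muS]]].
have lz := l2_shifted bsaA z lf.
have [C C0 hC] := horner_bounded (quad z) B.
have q0 x : 0 <= (quad z).[x] by rewrite quadE addr_ge0 ?sqr_ge0.
apply: (@ac_subspace_density mu (horner (quad z)) C) => //.
- exact: measurable_horner.
- move=> x Sx; rewrite q0/=.
  exact: le_trans (ler_norm _) (hC _ (SB Sx)).
- move=> p; have lpz := l2_poly_op bsaA p lz.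
  rewrite dotC (dot_shifted bsaA z lf lpz) (shifted_op bsaA) (shifted_conj bsaA).
  rewrite dotC -(poly_opM AD AZ) rep.
  by apply: eq_Rintegral => x _; rewrite hornerM.
Qed.

Lemma measurable_invsqr q : (forall x : R, S x -> q.[x] != 0) ->
  measurable_fun S (fun x : measurableTypeR R => (q.[x : R] ^+ 2)^-1).
Proof.
move=> q0; apply: (@subspace_continuous_measurable_fun R S) => //.
apply: (@continuous_in_subspaceT R R S) => x /set_mem Sx.
rewrite (_ : (fun x : R => _) = fun x : R => ((q ^+ 2).[x])^-1); last first.
  by apply/funext => y; rewrite horner_exp.
apply: cvgV; first by rewrite horner_exp expf_neq0// q0.
exact: continuous_horner.
Qed.

Section OffSupport.
Variables (z : R[i]) (d : R).
Hypothesis d0 : 0 < d.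
Hypothesis far : forall x : R, S x -> d <= (quad z).[x].

Lemma ac_lower_bound f : ac_subspace A f ->
  d * l2norm f ^+ 2 <= l2norm (shifted A z f) ^+ 2.
Proof.
move=> /ac_subspaceE[lf [mu [rep _ _]]].
rewrite (sqr_l2norm_shifted bsaA z lf) sqr_l2norm// rep.
rewrite -[f in dot f _](poly_op1 A) rep.
have -> : d * \int[mu]_(x in S) (1 : {poly R}).[x] = \int[mu]_(x in S) d%:P.[x].
  rewrite -RintegralZl//; last exact: (horner_integrable mS SB mu 1).
  by apply: eq_Rintegral => x _; rewrite !hornerC mulr1.
by apply: (Rintegral_horner_le mS SB) => x Sx; rewrite hornerC; exact: far.
Qed.

(** The Neumann series for [|A - z|^-2] converges on vectors of the absolutely
    continuous subspace, because their spectral measures do not charge the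
    part of the spectrum near [z]; in particular [z] may be an eigenvalue.  The
    limit has the spectral measure of [g] multiplied by [|x - z|^-4]: the
    moments of the partial sums converge to those of this measure. *)
Lemma ac_quad_surjective g : ac_subspace A g ->
  exists2 h, ac_subspace A h & op (quad z) h = g.
Proof.
move=> /ac_subspaceE[lg [mu [rep ac muS]]].
set r := quad z.
have [K K0 hK] := horner_bounded r B.
pose M := K + d.
have M0 : 0 < M by rewrite ltr_wpDl.
pose rho := 1 - d / M.
have dM : 0 < d / M <= 1.
  by rewrite divr_gt0//= ler_pdivrMr// mul1r /M lerDr.
have rr : 0 <= rho < 1 by rewrite /rho; case/andP: dM => *; apply/andP; split; lra.
have [r0 r1] := andP rr.
pose e : {poly R} := 1 - M^-1 *: r.
have eE (x : R) : S x -> 0 <= e.[x] <= rho.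
  move=> Sx; rewrite /e hornerD hornerN hornerZ hornerC mulrC subr_ge0.
  rewrite ler_pdivrMr// mul1r.
  have := hK _ (SB Sx); have rd := far Sx; rewrite -/r in rd.
  have r0x : 0 <= r.[x] by apply: le_trans rd; exact: ltW.
  rewrite (ger0_norm r0x) => rK.
  apply/andP; split; first by apply: le_trans rK _; rewrite lerDl ltW.
  by rewrite /rho lerD2l lerN2 ler_pM2r ?invr_gt0.
have gS : dot g g = fine (mu S).
  rewrite -{1}[g](poly_op1 A) rep; under eq_Rintegral do rewrite hornerC.
  by rewrite Rintegral_cst// mul1r.
have dec n : l2norm (op (e ^+ n) g) <= l2norm g * rho ^+ n.
  rewrite -(ler_pXn2r (n := 2)) ?nnegrE ?l2norm_ge0//; last first.
    by rewrite mulr_ge0 ?l2norm_ge0 ?exprn_ge0.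
  rewrite (represents_sqr bsaA _ lg rep) exprMn sqr_l2norm// gS mulrC.
  rewrite -Rintegral_cst//;
  apply: (@le_trans _ _ (\int[mu]_(x in S) ((rho ^+ n) ^+ 2)%:P.[x])).
    apply: (Rintegral_horner_le mS SB) => x Sx; rewrite hornerC !horner_exp.
    have [e0 er] := andP (eE _ Sx).
    by rewrite ler_pXn2r ?nnegrE ?exprn_ge0// lerXn2r ?nnegrE.
  by rewrite le_eqVlt; apply/orP; left; apply/eqP/eq_Rintegral => x _; rewrite !hornerC.
have [h [D [lh rh hD]]] := neumann_solution bsaA rr lg dec.
exists h => //.
pose w := fun x : measurableTypeR R => (r.[x : R] ^+ 2)^-1.
have rp (x : R) : S x -> 0 < r.[x] by move=> Sx; apply: lt_le_trans (far Sx).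
have mw : measurable_fun S w.
  by apply: measurable_invsqr => x Sx; rewrite gt_eqF// rp.
have wC (x : R) : S x -> 0 <= w x <= (d ^+ 2)^-1.
  move=> Sx; rewrite /w invr_ge0 sqr_ge0/= lef_pV2 ?posrE ?exprn_gt0 ?rp//.
  by rewrite lerXn2r ?nnegrE ?(ltW d0) ?(ltW (rp _ Sx))//; exact: far.
apply: (ac_subspace_density lh ac muS mw wC) => p.
have D0 : 0 <= D by have := hD 0%N; rewrite expr0 mulr1; apply: le_trans (l2norm_ge0 _).
have [Kp Kp0 hKp] := poly_op_bounded bsaA p.
have [Cp Cp0 hCp] := horner_bounded p B.
have pw_le (x : R) : S x -> `|p.[x] * w x| <= Cp * (d ^+ 2)^-1.
  move=> Sx; rewrite normrM; apply: ler_pM => //; first exact: hCp (SB Sx).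
  by have /andP[w0 wd] := wC _ Sx; rewrite ger0_norm.
have mpw : measurable_fun S (fun x : measurableTypeR R => p.[x : R] * w x).
  by apply: measurable_funM => //; exact: measurable_horner.
have ipw := bounded_integrable mu mS mpw pw_le.
(* [C1] and [C2] bound the errors made on the left and on the right when [h] is
   replaced by the [n]-th partial sum [hn], up to the factor [rho ^+ n]. *)
pose C1 := Kp * D * (l2norm h + (l2norm h + D)).
pose C2 := 3 * Cp * (d ^+ 2)^-1 * fine (mu S).
apply/eqP; rewrite -subr_eq0; apply/eqP.
apply: (@geometric_eq0 _ _ (C1 + C2) rho) => // n.
pose q := neumann_poly r M n; pose hn := op q g.
have lhn : l2 hn by exact: (l2_poly_op bsaA).
have lhh := l2B lh lhn.
have lphn := l2_poly_op bsaA p lhn; have lph := l2_poly_op bsaA p lh.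
have lphh := l2_poly_op bsaA p lhh.
have rn1 : rho ^+ n <= 1 by rewrite exprn_ile1// ltW.
have rn0 : 0 <= rho ^+ n by rewrite exprn_ge0.
have nhn : l2norm hn <= l2norm h + D.
  rewrite -[hn](subrK h); apply: le_trans (l2norm_triangle (l2B lhn lh) lh) _.
  rewrite addrC lerD2l -opprB l2normN//; apply: le_trans (hD n) _.
  by rewrite ler_piMr.
have E1 : `|dot (op p h) h - dot (op p hn) hn| <= C1 * rho ^+ n.
  have -> : dot (op p h) h - dot (op p hn) hn
     = dot (op p (h - hn)) h + dot (op p hn) (h - hn).
    by rewrite (poly_op_linB AD AZ) dotBl// dotBr//; ring.
  apply: le_trans (ler_normD _ _) _.
  rewrite /C1 mulrDr mulrDl; apply: lerD.
    apply: le_trans (cauchy_schwarz lphh lh) _.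
    rewrite mulrAC; apply: ler_wpM2r; first exact: l2norm_ge0.
    apply: le_trans (hKp _ lhh) _; rewrite -[leRHS]mulrA.
    by apply: ler_wpM2l => //; exact: hD.
  apply: le_trans (cauchy_schwarz lphn lhh) _.
  rewrite (_ : Kp * D * (l2norm h + D) * rho ^+ n
     = (Kp * (l2norm h + D)) * (D * rho ^+ n)); last first.
    by move: (rho ^+ n) => ?; ring.
  apply: ler_pM; rewrite ?l2norm_ge0//.
    by apply: le_trans (hKp _ lhn) _; apply: ler_wpM2l.
  exact: hD.
have E2 : `|dot (op p hn) hn - \int[mu]_(x in S) (p.[x] * w x)| <= C2 * rho ^+ n.
  have -> : dot (op p hn) hn = \int[mu]_(x in S) (p * q ^+ 2).[x].
    rewrite -rep [in LHS]/hn -(poly_op_sym bsaA q lphn lg) -!(poly_opM AD AZ).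
    by congr (dot (op _ g) g); ring.
  have ipq := horner_integrable mS SB mu (p * q ^+ 2).
  rewrite -RintegralB//.
  have iB := integrableB mS ipq ipw.
  apply: le_trans (le_normr_Rintegral mS _) _; first exact: eq_integrable iB.
  rewrite /C2 (_ : _ * rho ^+ n = 3 * Cp * (d ^+ 2)^-1 * rho ^+ n * fine (mu S)); last first.
    by rewrite mulrAC.
  rewrite -Rintegral_cst//; apply: le_Rintegral => //.
  - exact: eq_integrable (integrable_abse iB).
  - set c := 3 * Cp * (d ^+ 2)^-1 * rho ^+ n.
    have mc : measurable_fun S (cst c : measurableTypeR R -> R).
      exact: measurable_cst.
    exact: (bounded_integrable mu mS mc (fun x _ => lexx `|c|)).
  - move=> x Sx; have rx := rp _ Sx.
    have rq : r.[x] * q.[x] = 1 - e.[x] ^+ n.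
      by rewrite -hornerM (mul_neumann_poly r M n) hornerD hornerN hornerC horner_exp.
    have [e0 er] := andP (eE _ Sx).
    have en : e.[x] ^+ n <= rho ^+ n by rewrite lerXn2r ?nnegrE.
    have en0 : 0 <= e.[x] ^+ n by rewrite exprn_ge0.
    have -> : (p * q ^+ 2).[x] - p.[x] * w x
       = p.[x] * (((1 - e.[x] ^+ n) ^+ 2 - 1) * w x).
      rewrite -rq hornerM horner_exp /w; field.
      by rewrite gt_eqF.
    rewrite normrM (_ : 3 * Cp * (d ^+ 2)^-1 * rho ^+ n
       = Cp * ((3 * rho ^+ n) * (d ^+ 2)^-1)); last first.
      by move: (rho ^+ n) => ?; ring.
    apply: ler_pM => //; first exact: hCp (SB Sx).
    rewrite normrM; apply: ler_pM => //; last first.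
      by have /andP[w0 wd] := wC _ Sx; rewrite ger0_norm.
    move: en0 en rn0 rn1; move: (e.[x] ^+ n) (rho ^+ n) => a b a0 ab b0 b1.
    by rewrite ler_norml; apply/andP; split; nra.
rewrite mulrDl; apply: le_trans (lerD E1 E2).
by apply: le_trans (ler_normD _ _); rewrite addrA subrK.
Qed.

End OffSupport.

(** Injectivity: if two vectors of the subspace have the same image under
    [A - z], their difference lies in the kernel of [A - z] and, by
    [ac_quad_surjective], in the range of its adjoint; hence it vanishes. *)
Lemma ac_resolvent z (d : R) : 0 < d ->
  (forall x : R, S x -> d <= (quad z).[x]) ->
  resolvent_set A (ac_subspace A) z.
Proof.
move=> d0 far.
split; last first.
  exists (Num.sqrt d)^-1 => f Hf.
  have sd : 0 < Num.sqrt d by rewrite sqrtr_gt0.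
  rewrite -(ler_pM2l sd) mulrA mulfV ?gt_eqF// mul1r.
  rewrite -(ler_pXn2r (n := 2)) ?nnegrE ?mulr_ge0 ?l2norm_ge0 ?sqrtr_ge0//.
  rewrite exprMn (sqr_sqrtr (ltW d0)). exact: (ac_lower_bound far).
split; first by move=> f; exact: ac_shifted.
- move=> f g /set_mem Hf /set_mem Hg fg.
  have [u Hu uf] := ac_quad_surjective d0 far Hf.
  have [v Hv vg] := ac_quad_surjective d0 far Hg.
  have [lu _] := ac_subspaceE Hu; have [lv _] := ac_subspaceE Hv.
  have [lf _] := ac_subspaceE Hf; have [lg _] := ac_subspaceE Hg.
  have luv := l2B lu lv; have lfg := l2B lf lg.
  have fgE : f - g = shifted A z^*%C (shifted A z (u - v)).
    by rewrite (shifted_conj bsaA) (poly_op_linB AD AZ) uf vg.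
  have luv' := l2_shifted bsaA z luv.
  apply/eqP; rewrite -subr_eq0; apply/eqP/l2norm_eq0 => //.
  apply/eqP; rewrite -sqrf_eq0 sqr_l2norm//; apply/eqP.
  rewrite {1}fgE (dot_shifted bsaA z^*%C luv' lfg).
  have -> : (z^*)^*%C = z by case: (z) => a b /=; rewrite opprK.
  by rewrite (shiftedB bsaA z f g) fg subrr dotC dot0l.
- move=> g Hg; have [h Hh hg] := ac_quad_surjective d0 far Hg.
  exists (shifted A z^*%C h); first exact: ac_shifted.
  by rewrite (shifted_comm bsaA) (shifted_conj bsaA).
Qed.

End AbsolutelyContinuousSubspace.

(** * Trigonometry of the path with N vertices *)

Section PathTrigonometry.
Context (R : realType) (N : nat).
Implicit Types (k m : nat) (a t : R).

Definition step : R := pi / N.+1%:R.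

Lemma step_gt0 : 0 < step.
Proof. by rewrite divr_gt0// ?pi_gt0// ltr0n. Qed.

Lemma natM_step : N.+1%:R * step = pi.
Proof. by rewrite /step mulrCA mulfV ?mulr1// pnatr_eq0. Qed.

Lemma step_range k : (0 < k <= N)%N -> 0 < k%:R * step < pi.
Proof.
move=> /andP[k0 kN]; rewrite mulr_gt0 ?step_gt0 ?ltr0n//=.
by rewrite -natM_step ltr_pM2r ?step_gt0// ltr_nat.
Qed.

Lemma sin_step_gt0 k : (0 < k <= N)%N -> 0 < sin (k%:R * step).
Proof. by move=> kN; apply: sin_gt0_pi; exact: step_range. Qed.

Lemma ckE k : ck R N k%:Z = cos (k%:R * step).
Proof. by rewrite /ck /step mulrA. Qed.

Lemma skE k : sk R N k%:Z = sin (k%:R * step).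
Proof. by rewrite /sk /step mulrA. Qed.

Lemma sin_three_term t m :
  sin (m%:R * t) + sin (m.+2%:R * t) = 2 * cos t * sin (m.+1%:R * t).
Proof.
have -> : m%:R * t = m.+1%:R * t - t by rewrite -[m.+1]addn1 natrD; ring.
have -> : m.+2%:R * t = m.+1%:R * t + t by rewrite -[m.+2]addn1 natrD; ring.
by rewrite sinB sinD; ring.
Qed.

Lemma sin_step0 : sin (0%:R * step) = 0.
Proof. by rewrite mul0r sin0. Qed.

Lemma sin_stepS : sin (N.+1%:R * step) = 0.
Proof. by rewrite natM_step sinpi. Qed.

Lemma sin_nat_pi r : sin (r%:R * pi) = 0 :> R.
Proof.
elim: r => [|r ih]; first by rewrite mul0r sin0.
by rewrite -[r.+1]addn1 natrD mulrDl mul1r sinD ih sinpi mul0r mulr0 addr0.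
Qed.

Lemma cos_step_lt k m : (k < m <= N.+1)%N -> cos (m%:R * step) < cos (k%:R * step).
Proof.
move=> /andP[km mN]; have kN := leq_trans (ltnW km) mN.
have ran j : (j <= N.+1)%N -> j%:R * step \in `[0, pi].
  move=> jN; rewrite in_itv/= mulr_ge0 ?(ltW step_gt0)//=.
  by rewrite -natM_step ler_pM2r ?step_gt0// ler_nat.
by rewrite ltr_cos ?ran// ltr_pM2r ?step_gt0// ltr_nat.
Qed.

Lemma sqr_cos_step_lt1 k : (0 < k <= N)%N -> cos (k%:R * step) ^+ 2 < 1.
Proof.
move=> kN; rewrite -[ltRHS](cos2Dsin2 (k%:R * step)) ltrDl exprn_gt0//.
exact: sin_step_gt0.
Qed.

Lemma cos_step_opp k : cos (N.+1%:R * step - k%:R * step) = - cos (k%:R * step).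
Proof. by rewrite natM_step cosB cospi sinpi mul0r addr0 mulN1r. Qed.

(** ** The norm of the path *)

Lemma sum_shift_ends (G : nat -> R) : G 0%N = 0 -> G N = 0 ->
  \sum_(k < N) G k.+1 = \sum_(k < N) G k.
Proof.
move=> G0 GN.
have : \sum_(k < N.+1) G k = \sum_(k < N.+1) G k by [].
by rewrite {1}big_ord_recl big_ord_recr /= GN G0 addr0 add0r.
Qed.

Local Notation phi := (fun k : nat => sin (k%:R * step)).

Let phi_gt0 k : (k < N)%N -> 0 < phi k.+1.
Proof. by move=> kN; apply: sin_step_gt0. Qed.

(** The positive eigenvector [phi] of the path serves as a weight in the
    inequality [2 u v <= u^2 (y/x) + v^2 (x/y)]; the recurrence for [phi]
    then collects the right-hand side. *)
Lemma path_form_le (a : nat -> R) : a 0%N = 0 -> a N.+1 = 0 ->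
  \sum_(k < N.+1) 2 * (a k * a k.+1) <= 2 * cos step * \sum_(k < N) a k.+1 ^+ 2.
Proof.
move=> a0 aN.
pose G k := a k ^+ 2 * (phi k.+1 / phi k).
pose H k := a k.+1 ^+ 2 * (phi k / phi k.+1).
have GH k : (k <= N)%N -> 2 * (a k * a k.+1) <= G k + H k.
  move=> kN; rewrite /G /H.
  case: k kN => [|k] kN; first by rewrite a0 sin_step0 !(mul0r, mulr0, expr0n)//= addr0.
  move: kN; rewrite leq_eqVlt => /orP[/eqP kN|kN].
    rewrite kN aN sin_stepS !(mul0r, mulr0, expr0n)//= addr0; exact: lexx.
  have p1 : 0 < phi k.+1 by apply: phi_gt0; exact: ltnW.
  have p2 : 0 < phi k.+2 by exact: phi_gt0.
  rewrite /= in p1 p2; move: p1 p2.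
  move: (sin (k.+1%:R * step)) (sin (k.+2%:R * step)) => x y x0 y0.
  move: (a k.+1) (a k.+2) => u v.
  rewrite -subr_ge0.
  have -> : u ^+ 2 * (y / x) + v ^+ 2 * (x / y) - 2 * (u * v)
     = (u * y - v * x) ^+ 2 / (x * y).
    by field; rewrite !gt_eqF.
  by rewrite divr_ge0 ?sqr_ge0// mulr_ge0// ltW.
apply: le_trans (_ : \sum_(k < N.+1) (G k + H k) <= _).
  by apply: ler_sum => k _; apply: GH; rewrite -ltnS.
rewrite big_split /= big_ord_recl [X in _ + X]big_ord_recr /=.
rewrite {1}/G a0 expr0n mul0r add0r {2}/H aN expr0n mul0r addr0.
rewrite -big_split mulr_sumr /= le_eqVlt; apply/orP; left; apply/eqP.
apply: eq_bigr => k _; rewrite /G /H /bump /= add1n.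
have := sin_three_term step k; have := phi_gt0 (ltn_ord k); rewrite /=.
move: (sin (k%:R * step)) (sin (k.+1%:R * step)) (sin (k.+2%:R * step)) => x y z y0 xz.
have -> : a k.+1 ^+ 2 * (z / y) + a k.+1 ^+ 2 * (x / y) = a k.+1 ^+ 2 * ((x + z) / y).
  by ring.
by rewrite xz mulfK ?gt_eqF// mulrC.
Qed.

(** Cauchy-Schwarz with the same weight [phi], in the form
    [(v + u)^2 <= (x + y) (v^2/y + u^2/x)].  At both ends of the path one of the
    weights vanishes together with the corresponding entry of [a]. *)
Lemma path_norm_le (a : nat -> R) : a 0%N = 0 -> a N.+1 = 0 ->
  \sum_(k < N) (a k.+2 + a k) ^+ 2 <= 4 * cos step ^+ 2 * \sum_(k < N) a k.+1 ^+ 2.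
Proof.
move=> a0 aN.
pose G k := phi k * (a k.+1 ^+ 2 / phi k.+1).
pose H k := phi k.+1 * (a k ^+ 2 / phi k).
have GH k : (k < N)%N ->
    (a k.+2 + a k) ^+ 2 <= 2 * cos step * (G k.+1 + H k).
  move=> kN; rewrite /G /H.
  have pk : 0 < phi k.+1 by exact: phi_gt0.
  have -> : 2 * cos step * (phi k.+1 * (a k.+2 ^+ 2 / phi k.+2)
      + phi k.+1 * (a k ^+ 2 / phi k))
    = (phi k + phi k.+2) * (a k.+2 ^+ 2 / phi k.+2 + a k ^+ 2 / phi k).
    by rewrite sin_three_term; ring.
  have wl x : 0 <= x -> 0 <= x^-1 * x by move=> x0; rewrite mulr_ge0// invr_ge0.
  have [k0|kn0] := eqVneq k 0%N.
    rewrite k0 a0 sin_step0 add0r addr0 expr0n mul0r addr0.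
    have [N1|N1] := eqVneq N 1%N; first by rewrite -N1 aN expr0n mul0r mulr0.
    have p2 : phi 2%N != 0.
      by rewrite gt_eqF// phi_gt0// ltn_neqAle eq_sym N1 -k0.
    by rewrite mulrCA mulfV ?mulr1.
  have pk0 : 0 < phi k by case: k kn0 kN {pk} => // k _ kN; apply: phi_gt0; exact: ltnW.
  have [kN1|kN1] := eqVneq k.+1 N.
    by rewrite kN1 aN sin_stepS add0r addr0 expr0n mul0r add0r mulrCA mulfV ?mulr1 ?gt_eqF.
  have pk2 : 0 < phi k.+2 by apply: phi_gt0; rewrite ltn_neqAle kN1.
  rewrite /= in pk0 pk2; move: pk0 pk2.
  move: (sin (k%:R * step)) (sin (k.+2%:R * step)) (a k) (a k.+2) => x y u v x0 y0.
  rewrite -subr_ge0.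
  have -> : (x + y) * (v ^+ 2 / y + u ^+ 2 / x) - (v + u) ^+ 2
    = (u * y - v * x) ^+ 2 / (x * y) by field; rewrite !gt_eqF.
  by rewrite divr_ge0 ?sqr_ge0// mulr_ge0// ltW.
apply: le_trans (_ : \sum_(k < N) 2 * cos step * (G k.+1 + H k) <= _).
  by apply: ler_sum => k _; exact: GH.
rewrite -mulr_sumr big_split /= (sum_shift_ends (G := G)); last 2 first.
- by rewrite /G sin_step0 mul0r.
- by rewrite /G aN expr0n mul0r mulr0.
rewrite -(sum_shift_ends (G := H)); last 2 first.
- by rewrite /H a0 expr0n mul0r mulr0.
- by rewrite /H sin_stepS mul0r.
rewrite -big_split /= le_eqVlt; apply/orP; left; apply/eqP.
set Sa := \sum_(k < N) a k.+1 ^+ 2.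
have -> : 4 * cos step ^+ 2 * Sa = 2 * cos step * (2 * cos step * Sa) by ring.
congr (_ * _); rewrite /Sa mulr_sumr; apply: eq_bigr => k _; rewrite /G /H.
have := sin_three_term step k; have := phi_gt0 (ltn_ord k); rewrite /=.
move: (sin (k%:R * step)) (sin (k.+1%:R * step)) (sin (k.+2%:R * step)) => x y z y0 xz.
have -> : x * (a k.+1 ^+ 2 / y) + z * (a k.+1 ^+ 2 / y) = a k.+1 ^+ 2 * ((x + z) / y).
  by ring.
by rewrite xz mulfK ?gt_eqF//; ring.
Qed.

End PathTrigonometry.

(** * Eigenvalues of the tridiagonal matrix *)

Section TridiagonalSpectrum.
Context (R : realType) (N : nat).
Hypothesis N1 : (1 <= N)%N.
Implicit Types (k m : nat) (a x : R).
Local Notation step := (step R N).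
Local Notation c k := (cos (k%:R * step)).

Definition band k a : R := if k == 0%N then 0 else Num.sqrt (a ^+ 2 - 2 * a * c k + 1).

Lemma band_sqr_gt0 k a : (0 < k <= N)%N -> 0 < a ^+ 2 - 2 * a * c k + 1.
Proof.
move=> kN; have := sqr_cos_step_lt1 R kN; have := sqr_ge0 (a - c k).
by move: (c k) => y; rewrite !expr2 => ? ?; lra.
Qed.

Lemma sqr_band k a : (0 < k <= N)%N -> band k a ^+ 2 = a ^+ 2 - 2 * a * c k + 1.
Proof.
move=> kN; rewrite /band; case: k kN => // k kN /=.
by rewrite sqr_sqrtr// ltW// band_sqr_gt0.
Qed.

Lemma band_gt0 k a : (0 < k <= N)%N -> 0 < band k a.
Proof.
move=> kN; rewrite /band; case: k kN => // k kN /=.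
by rewrite sqrtr_gt0 band_sqr_gt0.
Qed.

Lemma band_lt k m a : 0 < a -> (k < m <= N)%N -> band k a < band m a.
Proof.
move=> a0 /andP[km mN]; case: k km => [|k] km.
  by rewrite {1}/band /= band_gt0// mN andbT.
rewrite /band; case: m km mN => // m km mN /=.
rewrite ltr_sqrt ?band_sqr_gt0//.
have := @cos_step_lt R N k.+1 m.+1; rewrite km (leq_trans mN)// => /(_ isT).
by rewrite -(ltr_pM2l a0) => ?; lra.
Qed.

Lemma band_le k m a : 0 <= a -> (k <= m <= N)%N -> band k a <= band m a.
Proof.
move=> a0 /andP[km mN]; case: k km => [|k] km.
  rewrite {1}/band /=; case: m mN {km} => // m mN.
  by rewrite ltW// band_gt0.
rewrite /band; case: m km mN => // m km mN /=.
rewrite ler_sqrt ?(ltW (band_sqr_gt0 _ _))//.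
move: km; rewrite leq_eqVlt => /orP[/eqP ->//|km].
have := @cos_step_lt R N k.+1 m.+1; rewrite km (leq_trans mN)// => /(_ isT)/ltW.
by move=> h; have := ler_wpM2l a0 h => ?; lra.
Qed.

(** In increasing order, since [lam0] indexes the sorted sequence. *)
Definition bands a : seq R :=
  mkseq (fun i => if (i < N)%N then - band (N - i) a else band (i - N) a) N.*2.+1.

Lemma nth_bands i a : (i < N.*2.+1)%N ->
  (bands a)`_i = if (i < N)%N then - band (N - i) a else band (i - N) a.
Proof. by move=> iN; rewrite nth_mkseq. Qed.

Lemma sorted_lt_bands a : 0 < a -> sorted <%R (bands a).
Proof.
move=> a0; apply/(sortedP 0); rewrite size_mkseq => i iN.
rewrite !nth_bands//; last exact: ltnW.
have NN := addnn N.
case: ltnP => [iN1|Ni]; last first.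
  have -> : (i.+1 < N)%N = false by lia.
  by apply: band_lt => //; lia.
case: ltnP => iN2; first by rewrite ltrN2; apply: band_lt => //; lia.
have -> : (i.+1 - N = 0)%N by lia.
by rewrite {2}/band /= oppr_lt0; apply: band_gt0; lia.
Qed.

Lemma sorted_bands a : 0 <= a -> sorted <=%R (bands a).
Proof.
move=> a0; apply/(sortedP 0); rewrite size_mkseq => i iN.
rewrite !nth_bands//; last exact: ltnW.
have NN := addnn N.
case: ltnP => [iN1|Ni]; last first.
  have -> : (i.+1 < N)%N = false by lia.
  by apply: band_le => //; lia.
case: ltnP => iN2; first by rewrite lerN2; apply: band_le => //; lia.
have -> : (i.+1 - N = 0)%N by lia.
by rewrite {2}/band /= oppr_le0 ltW//; apply: band_gt0; lia.
Qed.

Lemma prod_bands a x : \prod_(e <- bands a) (x - e) =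
  x * \prod_(k < N) (x ^+ 2 - (a ^+ 2 - 2 * a * c k.+1 + 1)).
Proof.
have NN := addnn N.
have -> : \prod_(e <- bands a) (x - e) = \prod_(0 <= i < N.*2.+1)
    (x - (if (i < N)%N then - band (N - i) a else band (i - N) a)).
  by rewrite /bands /mkseq big_map /index_iota subn0.
rewrite (@big_cat_nat _ _ _ N)/=; [|by []|by lia].
rewrite [X in _ * X]big_ltn; last by lia.
rewrite ltnn subnn {2}/band /= subr0 mulrCA; congr (_ * _).
rewrite big_nat_rev /= add0n -[N.+1]add0n big_addn.
have -> : (N.*2.+1 - N.+1 = N)%N by lia.
rewrite -big_split /= big_mkord; apply: eq_bigr => k _.
have kN := ltn_ord k.
have -> : (N - k.+1 < N)%N by lia.
have -> : (k + N.+1 < N)%N = false by lia.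
have -> : (N - (N - k.+1) = k.+1)%N by lia.
have -> : (k + N.+1 - N = k.+1)%N by lia.
rewrite -sqr_band ?kN// opprK; ring.
Qed.

(** ** Eigenvectors *)

Let e a k : R := if odd k then 1 else a.

Lemma tridiagonal_action a (w : nat -> R) (j : 'I_N.*2.+1) :
  w N.*2.+1 = 0 ->
  ((\row_i w i) *m J0 N a) 0 j
  = (if (0 < j)%N then w j.-1 * e a j.-1 else 0) + w j.+1 * e a j.
Proof.
move=> wN; rewrite mxE.
transitivity (\sum_(i < N.*2.+1)
   ((if j == i.+1 :> nat then w i * e a i else 0)
    + (if i == j.+1 :> nat then w i * e a j else 0))).
  apply: eq_bigr => i _; rewrite !mxE /=.
  have [ji|ji] := eqVneq (j : nat) i.+1.
    have -> : (i == j.+1 :> nat) = false by apply/negbTE; lia.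
    by rewrite addr0.
  by case: eqP => _; rewrite ?mulr0 add0r.
rewrite big_split /=; congr (_ + _).
  case: ltnP => j0.
    have jN : (j.-1 < N.*2.+1)%N by have := ltn_ord j; lia.
    rewrite (bigD1 (Ordinal jN))//= prednK// eqxx big1 ?addr0// => i ij.
    case: eqP => // ji; move/eqP: ij; case; apply: val_inj => /=; lia.
  by rewrite big1// => i _; case: eqP => // ji; lia.
have [jN|jN] := ltnP j.+1 N.*2.+1.
  rewrite (bigD1 (Ordinal jN))//= eqxx big1 ?addr0// => i ij.
  case: eqP => // ji; move/eqP: ij; case; exact: val_inj.
rewrite big1 => [|i _]; last by case: eqP => // ij; have := ltn_ord i; lia.
have -> : j.+1 = N.*2.+1 by have := ltn_ord j; lia.
by rewrite wN mul0r.
Qed.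

(** The components of the eigenvector at odd places are
    [sin ((m + 1) t)] with [t = pi - k pi/(N+1)], and the other ones are forced by
    the eigenvalue equation. *)
Lemma eigenvalue_band a k x : (0 < k <= N)%N -> x ^+ 2 = band k a ^+ 2 ->
  eigenvalue (J0 N a) x.
Proof.
move=> kN xx; have x0 : x != 0.
  by rewrite -sqrf_eq0 xx gt_eqF// exprn_gt0// band_gt0.
pose t := N.+1%:R * step - k%:R * step.
have ct : cos t = - c k by exact: cos_step_opp.
pose w i := if odd i then sin ((i./2).+1%:R * t)
  else (sin (i./2%:R * t) + a * sin ((i./2).+1%:R * t)) / x.
have wo m : w m.*2.+1 = sin (m.+1%:R * t).
  by rewrite /w /= odd_double /= uphalf_double.
have we m : w m.*2 = (sin (m%:R * t) + a * sin (m.+1%:R * t)) / x.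
  by rewrite /w odd_double doubleK.
have sN : sin (N.+1%:R * t) = 0.
  rewrite /t natM_step.
  have -> : N.+1%:R * (pi - k%:R * step) = N.+1%:R * pi - k%:R * pi.
    by rewrite mulrBr mulrCA natM_step.
  by rewrite sinB !sin_nat_pi mul0r mulr0 subr0.
have st : sin t != 0.
  rewrite /t natM_step sinB sinpi cospi mul0r mulN1r sub0r opprK gt_eqF//.
  exact: sin_step_gt0.
apply/eigenvalueP; exists (\row_i w i); last first.
  apply/eqP => /rowP/(_ (inord 1)); rewrite !mxE inordK; last lia.
  by rewrite (wo 0%N) mul1r => /eqP; apply/negP.
apply/rowP => j; rewrite tridiagonal_action; last by rewrite wo.
rewrite !mxE /e; case: (boolP (odd j)) => jo.
  have [m jm] : exists m, j = m.*2.+1 :> nat.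
    by exists (j./2); rewrite -[LHS]odd_double_half jo add1n.
  rewrite jm /= odd_double /= -doubleS !we wo mulr1.
  have := sin_three_term t m; rewrite ct.
  move: (sin (m%:R * t)) (sin (m.+1%:R * t)) (sin (m.+2%:R * t)) => s0 s1 s2 h.
  apply: (mulfI x0); rewrite mulrA -expr2 xx sqr_band//.
  have -> : x * ((s0 + a * s1) / x * a + (s1 + a * s2) / x)
    = (s0 + a * s1) * a + (s1 + a * s2) by field.
  have -> : s2 = 2 * - c k * s1 - s0 by rewrite -h; ring.
  ring.
have [m jm] : exists m, j = m.*2 :> nat.
  by exists (j./2); rewrite -[LHS]odd_double_half (negbTE jo).
rewrite jm we wo /=.
case: m {jm} => [|m] /=.
  by rewrite mul0r sin0 !add0r; field.
by rewrite odd_double /= wo; field.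
Qed.

(** The kernel: the recurrence at odd places links the even ones by the factor
    [- a]. *)
Lemma eigenvalue_flat a : eigenvalue (J0 N a) 0.
Proof.
pose w i : R := if odd i then 0 else (- a) ^+ (i./2).
have wo m : w m.*2.+1 = 0 by rewrite /w /= odd_double.
have we m : w m.*2 = (- a) ^+ m by rewrite /w odd_double doubleK.
apply/eigenvalueP; exists (\row_i w i); last first.
  apply/eqP => /rowP/(_ ord0); rewrite !mxE (we 0%N) expr0 => /eqP.
  by rewrite oner_eq0.
apply/rowP => j; rewrite tridiagonal_action; last by rewrite wo.
rewrite !mxE /e mul0r; case: (boolP (odd j)) => jo.
  have [m jm] : exists m, j = m.*2.+1 :> nat.
    by exists (j./2); rewrite -[LHS]odd_double_half jo add1n.
  by rewrite jm /= odd_double /= -doubleS !we exprS; ring.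
have [m jm] : exists m, j = m.*2 :> nat.
  by exists (j./2); rewrite -[LHS]odd_double_half (negbTE jo).
rewrite jm wo /=.
case: m {jm} => [|m] /=; first by rewrite mul0r addr0.
by rewrite odd_double /= wo !mul0r addr0.
Qed.

(** For [a > 0] the [2N+1] exhibited eigenvalues are distinct. *)
Lemma char_poly_bands_pos a : 0 < a ->
  char_poly (J0 N a) = \prod_(e <- bands a) ('X - e%:P).
Proof.
move=> a0.
rewrite {1}[char_poly _](@all_roots_prod_XsubC _ _ (bands a)).
- by rewrite (monicP (char_poly_monic _)) scale1r.
- by rewrite size_char_poly size_mkseq.
- rewrite /bands /mkseq all_map; apply/allP => i; rewrite mem_iota add0n => iN /=.
  rewrite -eigenvalue_root_char.
  case: ifP => iN1.
    apply: (@eigenvalue_band a (N - i)); first by lia.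
    by rewrite sqrrN.
  have [iN0|iN0] := eqVneq (i - N)%N 0%N.
    by rewrite iN0 /band /=; exact: eigenvalue_flat.
  by apply: (@eigenvalue_band a (i - N)) => //; have := addnn N; lia.
- by rewrite uniq_rootsE; apply: lt_sorted_uniq; exact: sorted_lt_bands.
Qed.

Lemma poly_zero_of_interval (p : {poly R}) :
  (forall a, 0 < a <= 1 -> p.[a] = 0) -> p = 0.
Proof.
move=> p0; apply/eqP/negPn/negP => pn0.
pose rs := mkseq (fun i => i.+1%:R^-1 : R) (size p).
suff : (size rs < size p)%N by rewrite size_mkseq ltnn.
apply: max_poly_roots => //.
  rewrite /rs /mkseq all_map; apply/allP => i _ /=; apply/eqP/p0.
  by rewrite invr_gt0 ltr0n/= invf_le1 ?ltr0n// ler1n.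
rewrite /rs /mkseq map_inj_in_uniq ?iota_uniq// => i j _ _ /invr_inj/eqP.
by rewrite eqr_nat => /eqP[].
Qed.

(** At [a = 0] the eigenvalues collide; the factorization is obtained by
    viewing both sides as polynomials in [a], which agree for [a > 0]. *)
Lemma char_poly_bands a : 0 <= a ->
  char_poly (J0 N a) = \prod_(e <- bands a) ('X - e%:P).
Proof.
rewrite le_eqVlt => /orP[/eqP <-|]; last exact: char_poly_bands_pos.
pose JX : 'M[{poly R}]_(N.*2.+1) := \matrix_(i, j)
    let e k := if odd k then 1 else 'X in
    if (j == i.+1 :> nat) then e i else if (i == j.+1 :> nat) then e j else 0.
have detE x b : (\det (x%:P%:M - JX)).[b] = (char_poly (J0 N b)).[x].
  rewrite /char_poly -!horner_evalE -!det_map_mx; congr (\det _).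
  apply/matrixP => i j; rewrite !mxE /= !rmorphB /= !rmorphMn /=.
  rewrite !horner_evalE !hornerE; congr (_ - _).
  by case: ifP => _; [|case: ifP => _]; rewrite ?hornerE//; case: odd; rewrite !hornerE.
have prodE x b : (\prod_(e <- bands b) ('X - e%:P)).[x]
   = (x%:P * \prod_(k < N) ((x ^+ 2)%:P - ('X ^+ 2 - 2 *: 'X * (c k.+1)%:P + 1))).[b].
  rewrite horner_prod hornerM hornerC horner_prod.
  under eq_bigr do rewrite hornerXsubC.
  rewrite prod_bands; congr (_ * _); apply: eq_bigr => k _.
  by rewrite !hornerE; ring.
have eqx x : (char_poly (J0 N 0)).[x] = (\prod_(e <- bands 0) ('X - e%:P)).[x].
  rewrite -detE prodE; apply/eqP; rewrite -subr_eq0 -hornerN -hornerD; apply/eqP.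
  rewrite [X in X.[0]]poly_zero_of_interval ?horner0// => b /andP[b0 _].
  by rewrite hornerD hornerN detE -prodE char_poly_bands_pos// subrr.
apply/eqP; rewrite -subr_eq0; apply/eqP/poly_zero_of_interval => x _.
by rewrite hornerD hornerN eqx subrr.
Qed.

Lemma eigenvaluesE a : 0 <= a -> eigenvalues (J0 N a) = bands a.
Proof.
move=> a0; rewrite /eigenvalues.
set P := [set s | _]; have Pb : P (bands a).
  by split; [exact: sorted_bands|exact: char_poly_bands].
have [sx px] : P (xget [::] P) by exact: (xgetPex [::] (ex_intro _ _ Pb)).
apply: (le_sorted_eq sx (sorted_bands a0)).
by apply: prod_XsubC_eq; rewrite -px char_poly_bands.
Qed.

Lemma lam0_pos k a : 0 <= a -> (k <= N)%N -> lam0 N k%:Z a = band k a.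
Proof.
move=> a0 kN; rewrite /lam0 eigenvaluesE// -PoszD /= nth_bands; last first.
  by have := addnn N; lia.
by rewrite ltnNge leq_addl /= addnK.
Qed.

Lemma lam0_neg k a : 0 <= a -> (k <= N)%N -> lam0 N (- k%:Z) a = - band k a.
Proof.
move=> a0; case: k => [|k] kN.
  by rewrite oppr0 (@lam0_pos 0)// /band /= oppr0.
rewrite /lam0 eigenvaluesE//.
have -> : absz (- k.+1%:Z + N%:Z) = (N - k.+1)%N by lia.
rewrite nth_bands; last by have := addnn N; lia.
have -> : (N - k.+1 < N)%N by lia.
by rewrite subKn.
Qed.

End TridiagonalSpectrum.

(** ** The spectral bands *)

Section Bands.
Context (R : realType) (N : nat).
Hypothesis N1 : (1 <= N)%N.
Implicit Types (k m : nat) (a x y : R).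
Local Notation step := (step R N).
Local Notation c k := (cos (k%:R * step)).
Local Notation s k := (sin (k%:R * step)).
Local Notation band := (band N).

Let N11 : (0 < 1 <= N)%N. Proof. by rewrite N1. Qed.
Let NN : (0 < N <= N)%N. Proof. by rewrite N1 leqnn. Qed.

Lemma sqr_sinE k : s k ^+ 2 = 1 - c k ^+ 2.
Proof. by rewrite -[X in X - _](cos2Dsin2 (k%:R * step)); ring. Qed.

(** The completed square shows that [band k] decreases up to [a = c k] and
    increases afterwards; this gives the endpoints of the bands. *)
Lemma sqr_bandE k a : (0 < k <= N)%N -> band k a ^+ 2 = (a - c k) ^+ 2 + s k ^+ 2.
Proof. by move=> kN; rewrite sqr_band// sqr_sinE; ring. Qed.

Lemma cos_stepN : c N = - c 1%N.
Proof.
rewrite -cos_step_opp; congr cos.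
by rewrite -mulrBl -natrB// subSS subn0.
Qed.

Lemma cos_step1_ge0 : 0 <= c 1%N.
Proof.
have : c N <= c 1%N.
  case: (ltnP 1 N) => h; first by apply/ltW/cos_step_lt; rewrite h leqnSn.
  by have -> : N = 1%N by lia.
by rewrite cos_stepN => ?; lra.
Qed.

Lemma abs_cos_step_le k : (0 < k <= N)%N -> - c 1%N <= c k <= c 1%N.
Proof.
move=> /andP[k0 kN]; rewrite -cos_stepN; apply/andP; split.
  move: kN; rewrite leq_eqVlt => /orP[/eqP->//|kN].
  by apply/ltW/cos_step_lt; rewrite kN leqnSn.
move: k0; rewrite leq_eqVlt => /orP[/eqP <-//|k1].
by apply/ltW/cos_step_lt; rewrite k1 (leq_trans kN).
Qed.

Lemma sqr_sin_step_ge k : (0 < k <= N)%N -> s 1%N ^+ 2 <= s k ^+ 2.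
Proof.
move=> /abs_cos_step_le /andP[l r]; rewrite !sqr_sinE lerD2l lerN2.
by have := cos_step1_ge0; move: (c 1%N) (c k) l r => u v *; nra.
Qed.

Lemma sqr_band_le k a : (0 < k <= N)%N -> 0 <= a <= 2 ->
  band k a ^+ 2 <= 5 + 4 * c 1%N.
Proof.
move=> kN /andP[a0 a2]; rewrite sqr_band//.
have /andP[l _] := abs_cos_step_le kN; have := cos_step1_ge0.
by move: (c 1%N) (c k) l => u v *; nra.
Qed.

Lemma band_ge_sin k a : (0 < k <= N)%N -> s k <= band k a.
Proof.
move=> kN; rewrite -(ler_pXn2r (n := 2))// ?nnegrE ?(ltW (sin_step_gt0 _ kN)) ?(ltW (band_gt0 _ kN))//.
by rewrite sqr_bandE// lerDr sqr_ge0.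
Qed.

Lemma bandN2 : band N 2 = Num.sqrt (5 + 4 * c 1%N).
Proof.
rewrite /band eqn0Ngt N1 /=; congr Num.sqrt.
by rewrite cos_stepN; ring.
Qed.

(** The larger solution [a = c k + sqrt (y^2 - s k^2)] of [band k a = y] lies in
    [[0, 2]] if it is nonnegative and [y <= band k 2]. *)
Lemma band_image k (lo : R) : (0 < k <= N)%N -> 0 < lo ->
  (forall a, 0 <= a -> lo <= band k a) ->
  (forall y, lo <= y -> 0 <= c k + Num.sqrt (y ^+ 2 - s k ^+ 2)) ->
  s k <= lo ->
  [set band k a | a in [set` `[(0 : R), 2]]] = [set` `[lo, band k 2]].
Proof.
move=> kN lo0 lob root0 sklo; apply/seteqP; split => [_ [a /= a02 <-]|y /= ylo].
  move: a02; rewrite !in_itv/= => /andP[a0 a2]; rewrite lob//=.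
  rewrite -(ler_pXn2r (n := 2))// ?nnegrE ?(ltW (band_gt0 _ kN))//.
  rewrite !sqr_bandE// lerD2r; have := cos_le1 (k%:R * step).
  by move: (c k) => u ?; nra.
move: ylo; rewrite in_itv/= => /andP[ylo yb].
have y0 : 0 < y by exact: lt_le_trans ylo.
have sy : s k ^+ 2 <= y ^+ 2.
  rewrite ler_pXn2r ?nnegrE ?(ltW y0) ?(ltW (sin_step_gt0 _ kN))//.
  exact: le_trans ylo.
exists (c k + Num.sqrt (y ^+ 2 - s k ^+ 2)).
  rewrite in_itv/= root0//=.
  have c2 : 0 <= 2 - c k by have := cos_le1 (k%:R * step) => ?; lra.
  rewrite -lerBrDl -(ler_pXn2r (n := 2)) ?nnegrE ?sqrtr_ge0//.
  rewrite sqr_sqrtr ?subr_ge0// lerBlDr -sqr_bandE//.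
  by rewrite ler_pXn2r ?nnegrE ?(ltW y0) ?(ltW (band_gt0 _ kN)).
apply/eqP; rewrite -(eqrXn2 (n := 2))// ?(ltW y0) ?(ltW (band_gt0 _ kN))//.
by rewrite sqr_bandE// addrAC subrr add0r sqr_sqrtr ?subr_ge0// subrK.
Qed.

Lemma band_image_pos k : (0 < k <= N)%N -> 0 < c k ->
  [set band k a | a in [set` `[(0 : R), 2]]] = [set` `[s k, band k 2]].
Proof.
move=> kN ck; apply: (band_image kN (sin_step_gt0 R kN)) => // [a _|y _].
  exact: band_ge_sin.
by rewrite addr_ge0 ?sqrtr_ge0// ltW.
Qed.

Lemma band_image_neg k : (0 < k <= N)%N -> c k <= 0 ->
  [set band k a | a in [set` `[(0 : R), 2]]] = [set` `[1, band k 2]].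
Proof.
move=> kN ck; apply: band_image => //.
- move=> a a0; rewrite -(ler_pXn2r (n := 2))// ?nnegrE ?(ltW (band_gt0 _ kN))//.
  by rewrite sqr_band// expr1n; move: (c k) ck => u ?; nra.
- move=> y y1; rewrite -lerBlDl sub0r.
  rewrite -(ler_pXn2r (n := 2))// ?nnegrE ?sqrtr_ge0 ?oppr_ge0//.
  rewrite sqr_sqrtr; first by rewrite sqr_sinE sqrrN; nra.
  by rewrite sqr_sinE; have := sqr_ge0 (c k) => ?; nra.
Qed.

(** The first band starts at [s 1] and reaches beyond 1, where the last band
    starts.  When [N = 1] there is a single band and [s 1 = 1]. *)
Lemma band_cover y : s 1%N <= y <= band N 2 ->
  exists k a, [/\ (0 < k <= N)%N, 0 <= a <= 2 & y = band k a].
Proof.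
move=> /andP[ys yN]; have [y1|y1] := leP 1 y.
  have cN : c N <= 0 by rewrite cos_stepN oppr_le0 cos_step1_ge0.
  have : [set` `[1, band N 2]] y by rewrite /= in_itv/= y1.
  rewrite -(band_image_neg NN cN) => -[a /=]; rewrite in_itv/= => a02 <-.
  by exists N, a.
have c1 : 0 < c 1%N.
  rewrite lt_def cos_step1_ge0 andbT; apply/eqP => c10.
  have s1 := sin_step_gt0 R N11; have := sqr_sinE 1; rewrite c10 expr0n subr0.
  by move=> /eqP; rewrite sqrf_eq1 => /orP[] /eqP sE; move: ys y1 s1; rewrite sE; lra.
have : [set` `[s 1%N, band 1 2]] y.
  rewrite /= in_itv/= ys/=; apply: le_trans (ltW y1) _.
  rewrite -(ler_pXn2r (n := 2))// ?nnegrE ?(ltW (band_gt0 _ N11))//.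
  by rewrite sqr_band// expr1n; have := cos_le1 (1%:R * step) => ?; lra.
rewrite -(band_image_pos N11 c1) => -[a /=]; rewrite in_itv/= => a02 <-.
by exists 1%N, a.
Qed.

Lemma band_range k a : (0 < k <= N)%N -> 0 <= a <= 2 ->
  s 1%N <= band k a <= band N 2.
Proof.
move=> kN a02; apply/andP; split.
  apply: le_trans (band_ge_sin a kN).
  rewrite -(ler_pXn2r (n := 2))// ?nnegrE ?(ltW (sin_step_gt0 R _))//.
  exact: sqr_sin_step_ge.
rewrite -(ler_pXn2r (n := 2))// ?nnegrE ?(ltW (band_gt0 _ _))//.
rewrite bandN2 [leRHS]sqr_sqrtr; first exact: sqr_band_le.
by have := cos_step1_ge0 => ?; lra.
Qed.

End Bands.

(** * The nanoribbon operator in terms of its rows *)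

Section Shift.
Context (R : realType).
Implicit Types (f g : int -> R[i]).

Definition shiftz (d : int) f : int -> R[i] := fun n => f (n + d).

Lemma shiftz_bij (d : int) : bijective (fun n : int => n + d).
Proof. by exists (fun n => n - d) => n; rewrite ?addrK ?subrK. Qed.

Lemma l2_shiftz d f : l2 f -> l2 (shiftz d f).
Proof.
move=> lf; apply: (l2E _).2; have := (l2E _).1 lf.
by rewrite (abs_summable_bij _ (shiftz_bij d)).
Qed.

Lemma dot_shiftz d f g : dot (shiftz d f) (shiftz d g) = dot f g.
Proof. by rewrite [RHS](rsum_bij _ (shiftz_bij d)). Qed.

Lemma shiftzK d f : shiftz d (shiftz (- d) f) = f.
Proof. by apply/funext => n; rewrite /shiftz addrK. Qed.

Lemma dot_shiftzl d f g : dot (shiftz d f) g = dot f (shiftz (- d) g).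
Proof. by rewrite -{1}(shiftzK d g) dot_shiftz. Qed.

Lemma l2norm_shiftz d f : l2 f -> l2norm (shiftz d f) = l2norm f.
Proof. by move=> lf; rewrite !l2norm_dot// ?dot_shiftz//; exact: l2_shiftz. Qed.

(** The coupling of an even row to the odd row before it; [hop_adj] is the
    coupling in the opposite direction. *)
Definition hop f : int -> R[i] := f + shiftz (- 1) f.
Definition hop_adj f : int -> R[i] := f + shiftz 1 f.

Lemma l2_hop f : l2 f -> l2 (hop f).
Proof. by move=> lf; apply: l2D => //; exact: l2_shiftz. Qed.

Lemma l2_hop_adj f : l2 f -> l2 (hop_adj f).
Proof. by move=> lf; apply: l2D => //; exact: l2_shiftz. Qed.

Lemma dot_hop f g : l2 f -> l2 g -> dot (hop f) g = dot f (hop_adj g).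
Proof.
move=> lf lg; have lf1 := l2_shiftz (- 1) lf; have lg1 := l2_shiftz 1 lg.
by rewrite /hop /hop_adj dotDl// dotDr// dot_shiftzl opprK.
Qed.

Lemma l2norm_hop f : l2 f -> l2norm (hop f) <= 2 * l2norm f.
Proof.
move=> lf; apply: le_trans (l2norm_triangle lf (l2_shiftz _ lf)) _.
by rewrite l2norm_shiftz// mulr2n mulrDl !mul1r.
Qed.

Lemma shiftz1_hop f : shiftz 1 (hop f) = hop_adj f.
Proof.
by apply/funext => n; rewrite /shiftz /hop /hop_adj !fctE /shiftz addrK addrC.
Qed.

End Shift.

Section Rows.
Context (R : realType) (N : nat).
Implicit Types (f g : Gamma N -> R[i]) (j k : nat) (n : int).

Definition row f j : int -> R[i] := fun n => at_ f n j.
Local Notation ev f k := (row f k.*2).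
Local Notation od f k := (row f k.*2.+1).

Lemma row_ord f (j : 'I_N.*2.+1) : row f j.+1 = fun n => f (n, j).
Proof.
apply/funext => n; rewrite /row /at_ (insubT (fun j => (j < N.*2.+1)%N) (ltn_ord j)).
by congr (f (n, _)); apply: val_inj.
Qed.

Lemma ev0 f : ev f 0 = 0.
Proof. by []. Qed.

Lemma row_out f j : (N.*2.+1 < j)%N -> row f j = 0.
Proof.
case: j => // j jN; apply/funext => n; rewrite /row /at_.
by rewrite insubF// ltnNge -ltnS jN.
Qed.

Lemma evS f : ev f N.+1 = 0.
Proof. by apply: row_out; rewrite doubleS. Qed.

Lemma rows_eq f g : (forall j, row f j = row g j) -> f = g.
Proof.
move=> fg; apply/funext => -[n j].
by have := fg j.+1; rewrite !row_ord => /(congr1 (fun h => h n)).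
Qed.

Lemma rowD f g j : row (f + g) j = row f j + row g j.
Proof.
apply/funext => n; rewrite /row fctE /at_; case: j => [|j]; first by rewrite addr0.
by case: insub => [i|]; rewrite ?addr0.
Qed.

Lemma rowZ z f j : row (z \*o f) j = z \*o row f j.
Proof.
apply/funext => n; rewrite /row /= /at_; case: j => [|j]; first by rewrite mulr0.
by case: insub => [i|]; rewrite ?mulr0.
Qed.

Lemma row0 j : row 0 j = 0.
Proof.
apply/funext => n; rewrite /row /at_; case: j => [//|j].
by case: insub.
Qed.

Lemma row_Delta f j : (j <= N.*2)%N -> row (Delta f) j.+1 =
  if odd j.+1 then row f j + hop (row f j.+2)
  else hop_adj (row f j) + row f j.+2.
Proof.
move=> jN; have jN1 : (j < N.*2.+1)%N by [].
rewrite (row_ord _ (Ordinal jN1)); apply/funext => n.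
rewrite /Delta /=; case: ifP => _; rewrite /hop /hop_adj /shiftz /row !fctE.
  by rewrite -addrA; congr (_ + _); rewrite addrC.
by [].
Qed.

Lemma od_Delta f k : (k <= N)%N -> od (Delta f) k = ev f k + hop (ev f k.+1).
Proof. by move=> kN; rewrite row_Delta ?leq_double// /= odd_double. Qed.

Lemma ev_Delta f k : (k < N)%N ->
  ev (Delta f) k.+1 = hop_adj (od f k) + od f k.+1.
Proof.
move=> kN; have kN2 : (k.*2 < N.*2)%N by rewrite ltn_double.
by rewrite doubleS row_Delta//= odd_double.
Qed.

Lemma sum_parity (V : nmodType) (F : nat -> V) :
  \sum_(j < N.*2.+1) F j = \sum_(k < N.+1) F k.*2 + \sum_(k < N) F k.*2.+1.
Proof.
elim: N => [|M ih]; first by rewrite !big_ord1 big_ord0 addr0.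
rewrite doubleS big_ord_recr [X in X + _ = _]big_ord_recr /= ih.
rewrite [X in _ = X + _]big_ord_recr /= [X in _ = _ + X]big_ord_recr /=.
by rewrite -[LHS]addrA [F M.*2.+1 + _]addrC addrACA doubleS.
Qed.

Lemma l2_rows f : l2 f <-> forall j, l2 (row f j).
Proof.
split => [lf [|j]|lf].
- exact: l2_0.
- have [jN|Nj] := ltnP j N.*2.+1; last by rewrite row_out//; exact: l2_0.
  rewrite (row_ord f (Ordinal jN)); apply: (l2E _).2.
  by have /abs_summable_pair := (l2E _).1 lf; apply.
- apply: (l2E _).2; apply/abs_summable_pair => j.
  by have := (l2E _).1 (lf j.+1); rewrite row_ord.
Qed.

Lemma dot_rows f g : l2 f -> l2 g -> dot f g =
  \sum_(k < N.+1) dot (od f k) (od g k) + \sum_(k < N) dot (ev f k.+1) (ev g k.+1).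
Proof.
move=> lf lg; rewrite {1}/dot (rsum_pair (dot_summable lf lg)).
rewrite -(sum_parity (fun j => dot (row f j.+1) (row g j.+1))).
by apply: eq_bigr => j _; rewrite !row_ord.
Qed.

Lemma DeltaD f g : Delta (f + g) = Delta f + Delta g.
Proof.
apply: rows_eq => j; rewrite rowD; case: j => [|j]; first by rewrite !ev0 addr0.
have [jN|jN] := leqP j N.*2; last by rewrite !row_out ?addr0.
rewrite !row_Delta// !rowD; case: ifP => _; apply/funext => n;
  rewrite /hop /hop_adj /shiftz !fctE; ring.
Qed.

Lemma DeltaZ z f : Delta (z \*o f) = z \*o Delta f.
Proof.
apply: rows_eq => j; rewrite rowZ; case: j => [|j]; first by rewrite !ev0 scalef0.
have [jN|jN] := leqP j N.*2; last by rewrite !row_out ?scalef0.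
rewrite !row_Delta// !rowZ; case: ifP => _; apply/funext => n;
  rewrite /hop /hop_adj /shiftz !fctE /=; ring.
Qed.

Lemma l2_Delta f : l2 f -> l2 (Delta f).
Proof.
move=> /l2_rows lf; apply/l2_rows => -[|j]; first exact: l2_0.
have [jN|jN] := leqP j N.*2; last by rewrite row_out//; exact: l2_0.
rewrite row_Delta//; case: ifP => _; apply: l2D => //; first exact: l2_hop.
exact: l2_hop_adj.
Qed.

Lemma dot_Delta f g : l2 f -> l2 g -> dot (Delta f) g = dot f (Delta g).
Proof.
move=> lf lg; have lDf := l2_Delta lf; have lDg := l2_Delta lg.
have /l2_rows rf := lf; have /l2_rows rg := lg.
have half f' g' : l2 f' -> l2 g' ->
    \sum_(k < N.+1) dot (od (Delta f') k) (od g' k)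
    = \sum_(k < N) dot (ev f' k.+1) (ev (Delta g') k.+1).
  move=> /l2_rows rf' /l2_rows rg'.
  transitivity (\sum_(k < N.+1) (dot (ev f' k) (od g' k)
      + dot (ev f' k.+1) (hop_adj (od g' k)))).
    apply: eq_bigr => k _; rewrite od_Delta; last by rewrite -ltnS.
    by rewrite dotDl// ?dot_hop//; exact: l2_hop.
  rewrite big_split /= big_ord_recl [X in _ + X]big_ord_recr /=.
  rewrite ev0 evS !dot0l add0r addr0 -big_split /=; apply: eq_bigr => k _.
  rewrite /bump /= add1n ev_Delta//.
  by rewrite (dotDr (l2_hop_adj (rg' _)) (rg' _) (rf' _)) addrC.
rewrite !dot_rows// half// [RHS]addrC; congr (_ + _).
transitivity (\sum_(k < N) dot (ev g k.+1) (ev (Delta f) k.+1)).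
  by apply: eq_bigr => k _; rewrite dotC.
by rewrite -half//; apply: eq_bigr => k _; rewrite dotC.
Qed.

(** ** Norm bounds on the even sublattice *)

(** [Delta] exchanges the two sublattices, and all spectral information can be
    read on the even one, which has [N] rows. *)
Definition even_supported f := forall k, od f k = 0.
Definition odd_supported f := forall k, ev f k = 0.

Let evnorm f k : R := l2norm (ev f k).

Lemma dot_even f : l2 f -> even_supported f ->
  dot f f = \sum_(k < N) evnorm f k.+1 ^+ 2.
Proof.
move=> lf ef; have /l2_rows rf := lf; rewrite dot_rows// big1 ?add0r.
  by apply: eq_bigr => k _; rewrite /evnorm sqr_l2norm.
by move=> k _; rewrite ef dot0l.
Qed.

Lemma Delta_even f : even_supported f -> odd_supported (Delta f).
Proof.
move=> ef [|k]; first exact: ev0.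
have [kN|Nk] := ltnP k N; last by apply: row_out; rewrite doubleS !ltnS leq_double.
rewrite ev_Delta// !ef; apply/funext => n.
by rewrite /hop_adj /shiftz !fctE !addr0.
Qed.

Lemma Delta_odd f : odd_supported f -> even_supported (Delta f).
Proof.
move=> ef k; have [kN|Nk] := leqP k N; last by apply: row_out; rewrite ltnS ltn_double.
rewrite od_Delta// !ef; apply/funext => n.
by rewrite /hop /shiftz !fctE !addr0.
Qed.

Lemma dot_Delta_even f : l2 f -> even_supported f -> dot (Delta f) (Delta f) =
  \sum_(k < N.+1) dot (ev f k + hop (ev f k.+1)) (ev f k + hop (ev f k.+1)).
Proof.
move=> lf ef; have lD := l2_Delta lf; rewrite dot_rows// [X in _ + X]big1 ?addr0.
  by apply: eq_bigr => k _; rewrite od_Delta// -ltnS.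
by move=> k _; rewrite Delta_even// dot0l.
Qed.

Lemma evnorm0 f : evnorm f 0 = 0.
Proof. by rewrite /evnorm ev0 l2norm0. Qed.

Lemma evnormS f : evnorm f N.+1 = 0.
Proof. by rewrite /evnorm evS l2norm0. Qed.

Local Notation c1 := (cos (step R N)).

(** The triangle inequality on each row leaves the quadratic form of the path
    in the norms of the rows. *)
Lemma Delta_even_le f : l2 f -> even_supported f ->
  dot (Delta f) (Delta f) <= (5 + 4 * c1) * dot f f.
Proof.
move=> lf ef; have /l2_rows rf := lf.
rewrite dot_Delta_even// dot_even//.
set a := evnorm f.
have a0 : a 0%N = 0 by exact: evnorm0.
have aN : a N.+1 = 0 by exact: evnormS.
have le1 k : dot (ev f k + hop (ev f k.+1)) (ev f k + hop (ev f k.+1)) <=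
    a k ^+ 2 + 4 * a k.+1 ^+ 2 + 2 * (2 * (a k * a k.+1)).
  have lh := l2_hop (rf k.+1.*2); rewrite -sqr_l2norm; last exact: l2D.
  have -> : a k ^+ 2 + 4 * a k.+1 ^+ 2 + 2 * (2 * (a k * a k.+1))
     = (a k + 2 * a k.+1) ^+ 2 by ring.
  rewrite ler_pXn2r ?nnegrE ?addr_ge0 ?mulr_ge0 ?l2norm_ge0//.
  apply: le_trans (l2norm_triangle (rf _) lh) _.
  by rewrite lerD2l; exact: l2norm_hop.
apply: (@le_trans _ _ (\sum_(k < N.+1) (a k ^+ 2 + 4 * a k.+1 ^+ 2
    + 2 * (2 * (a k * a k.+1))))); first by apply: ler_sum => k _; exact: le1.
rewrite !big_split /= -!mulr_sumr big_ord_recl [X in _ + 4 * X + _]big_ord_recr /=.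
rewrite a0 aN expr0n add0r addr0.
have := path_form_le a0 aN; rewrite -mulr_sumr.
set S := \sum_(k < N) a k.+1 ^+ 2; set P := \sum_(k < N.+1) _.
by move=> ?; lra.
Qed.

(** With [v_k] the even rows and [J_k = v_k + S^-1 v_(k+2)], where [S] is the
    translation,
    [|Delta f|^2 = |f|^2 + sum |hop v_(k+1) + J_k / 2|^2 - (1/4) sum |J_k|^2],
    and the last sum is bounded by [path_norm_le]. *)
Lemma Delta_even_ge f : l2 f -> even_supported f ->
  (1 - c1 ^+ 2) * dot f f <= dot (Delta f) (Delta f).
Proof.
move=> lf ef; have /l2_rows rf := lf.
rewrite dot_Delta_even// dot_even//.
set a := evnorm f.
have a0 : a 0%N = 0 by exact: evnorm0.
have aN : a N.+1 = 0 by exact: evnormS.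
pose v k := ev f k; have lv k : l2 (v k) by exact: rf.
pose J k := shiftz (- 1) (v k.+2) + v k.
have lJ k : l2 (J k) by apply: l2D => //; exact: l2_shiftz.
have lh k : l2 (hop (v k)) by exact: l2_hop.
pose m k := dot (v k) (hop (v k.+1)).
have mE k : dot (hop (v k.+1)) (J k) = m k.+1 + m k.
  rewrite /J dotDr//; last exact: l2_shiftz.
  rewrite [X in _ + X]dotC; congr (_ + _).
  rewrite dotC dot_shiftzl opprK shiftz1_hop -dot_hop// dotC.
  by [].
have sq k : 0 <= dot (hop (v k.+1)) (hop (v k.+1)) + (m k.+1 + m k)
     + dot (J k) (J k) / 4.
  have lJ2 := l2Z ((2 : R)^-1)%:C (lJ k).
  have := dot_ge0 (l2D (lh k.+1) lJ2).
  rewrite dot_sqrD// dotZr// dotZZ// mE.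
  have -> : nsq ((2 : R)^-1)%:C = 1 / 4 by rewrite /nsq /=; field.
  by move=> ?; lra.
have Jle k : dot (J k) (J k) <= (a k.+2 + a k) ^+ 2.
  rewrite -sqr_l2norm// ler_pXn2r ?nnegrE ?addr_ge0 ?l2norm_ge0//.
  apply: le_trans (l2norm_triangle (l2_shiftz _ (lv _)) (lv _)) _.
  by rewrite l2norm_shiftz.
have m0 : m 0%N = 0 by rewrite /m /v ev0 dot0l.
have mN : m N = 0.
  rewrite /m /v evS dotC (_ : hop _ = 0) ?dot0l//.
  by apply/funext => n; rewrite /hop /shiftz !fctE addr0.
pose P k := dot (hop (v k.+1)) (hop (v k.+1)).
have split2 (n : nat) (F G : nat -> R) :
    \sum_(k < n) (F k + G k) = \sum_(k < n) F k + \sum_(k < n) G k.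
  by rewrite big_split.
have split3 (n : nat) (F G H : nat -> R) : \sum_(k < n) (F k + G k + H k) =
    \sum_(k < n) F k + \sum_(k < n) G k + \sum_(k < n) H k.
  by rewrite !big_split.
have expand : \sum_(k < N.+1) dot (ev f k + hop (ev f k.+1)) (ev f k + hop (ev f k.+1))
   = \sum_(k < N) (a k.+1 ^+ 2 + dot (hop (v k.+1)) (hop (v k.+1)) + (m k.+1 + m k)).
  transitivity (\sum_(k < N.+1) (a k ^+ 2 + 2 * m k
      + dot (hop (v k.+1)) (hop (v k.+1)))).
    apply: eq_bigr => k _; rewrite (dot_sqrD (lv k) (lh k.+1)).
    by rewrite -(sqr_l2norm (lv k)).
  rewrite (split3 N.+1 (fun k => a k ^+ 2) (fun k => 2 * m k) P).
  rewrite (split3 N (fun k => a k.+1 ^+ 2) (fun k => P k) (fun k => m k.+1 + m k)).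
  rewrite (split2 N (fun k => m k.+1) m) (sum_shift_ends m0 mN).
  rewrite big_ord_recl a0 expr0n add0r -mulr_sumr.
  rewrite [X in _ + 2 * X + _]big_ord_recr /= mN addr0.
  rewrite [X in _ + _ + X]big_ord_recr /= {2}/P {1}/v evS.
  rewrite (_ : hop 0 = 0) ?dot0l ?addr0; last first.
    by apply/funext => n; rewrite /hop /shiftz !fctE addr0.
  by ring.
rewrite expand; have := path_norm_le a0 aN.
have : \sum_(k < N) dot (J k) (J k) <= \sum_(k < N) (a k.+2 + a k) ^+ 2.
  by apply: ler_sum => k _; exact: Jle.
have : 0 <= \sum_(k < N) (dot (hop (v k.+1)) (hop (v k.+1)) + (m k.+1 + m k)
     + dot (J k) (J k) / 4).
  by apply: sumr_ge0 => k _; exact: sq.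
rewrite (split3 N P (fun k => m k.+1 + m k) (fun k => dot (J k) (J k) / 4)).
rewrite (split3 N (fun k => a k.+1 ^+ 2) P (fun k => m k.+1 + m k)) -mulr_suml.
set S := \sum_(k < N) a k.+1 ^+ 2; set SP := \sum_(k < N) P k.
set SJ := \sum_(k < N) dot _ _; set SM := \sum_(k < N) (_ + _).
by move=> ? ? ?; lra.
Qed.

End Rows.

(** ** The operator norm and the spectral gap *)

Section DeltaBounds.
Context (R : realType) (N : nat).
Hypothesis N1 : (1 <= N)%N.
Implicit Types (f g : Gamma N -> R[i]) (x : R).
Local Notation ev f k := (row f k.*2).
Local Notation od f k := (row f k.*2.+1).
Local Notation c1 := (cos (1%:R * step R N)).
Local Notation s1 := (sin (1%:R * step R N)).

Definition Delta_norm : R := Num.sqrt (5 + 4 * c1).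
Local Notation L := Delta_norm.

Let L0 : 0 <= L. Proof. exact: sqrtr_ge0. Qed.

Let sqrL : L ^+ 2 = 5 + 4 * c1.
Proof. by rewrite sqr_sqrtr//; have := cos_step1_ge0 R N1 => ?; lra. Qed.

Let s1_gt0 : 0 < s1.
Proof. by apply: sin_step_gt0; rewrite N1. Qed.

Definition even_part f : Gamma N -> R[i] := fun v => if odd v.2 then f v else 0.

Lemma row_even_part f j : row (even_part f) j = if odd j then 0 else row f j.
Proof.
case: j => [|j]; first by [].
have [jN|Nj] := ltnP j N.*2.+1; last by rewrite !row_out//; case: ifP.
rewrite !(row_ord _ (Ordinal jN)); apply/funext => n; rewrite /even_part /=.
by case: (odd j).
Qed.

Lemma l2_even_part f : l2 f -> l2 (even_part f).
Proof.
move=> /l2_rows rf; apply/l2_rows => j; rewrite row_even_part.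
by case: ifP => _ //; exact: l2_0.
Qed.

Lemma even_part_supported f : even_supported (even_part f).
Proof. by move=> k; rewrite row_even_part /= odd_double. Qed.

Lemma odd_part_supported f : odd_supported (f - even_part f).
Proof.
move=> k; rewrite -(scaleN1f (even_part f)) rowD rowZ row_even_part odd_double.
by apply/funext => n; rewrite !fctE /= mulN1r subrr.
Qed.

Lemma dot_even_odd f g : l2 f -> l2 g -> even_supported f -> odd_supported g ->
  dot f g = 0.
Proof.
move=> lf lg ef og; rewrite dot_rows// !big1 ?addr0// => k _.
  by rewrite og dotC dot0l.
by rewrite ef dot0l.
Qed.

Lemma l2norm_Delta_even f : l2 f -> even_supported f ->
  s1 * l2norm f <= l2norm (Delta f) <= L * l2norm f.
Proof.
move=> lf ef; have lD := l2_Delta lf.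
have s0 := ltW s1_gt0.
apply/andP; split; rewrite -(ler_pXn2r (n := 2)) ?nnegrE ?mulr_ge0 ?l2norm_ge0//.
  by rewrite exprMn (sqr_l2norm lf) (sqr_l2norm lD) sqr_sinE mul1r Delta_even_ge.
by rewrite exprMn (sqr_l2norm lf) (sqr_l2norm lD) sqrL mul1r Delta_even_le.
Qed.

Lemma sqr_l2norm_Delta_le f : l2 f ->
  l2norm (Delta f) ^+ 2 <= l2norm (Delta (Delta f)) * l2norm f.
Proof.
move=> lf; have lD := l2_Delta lf; rewrite sqr_l2norm// -dot_Delta//.
by apply: dot_le => //; exact: l2_Delta.
Qed.

(** Follows from the even case since [|Delta f|^2 <= |Delta^2 f| |f|]. *)
Lemma l2norm_Delta_odd f : l2 f -> odd_supported f ->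
  l2norm (Delta f) <= L * l2norm f.
Proof.
move=> lf of_; have lD := l2_Delta lf.
have := sqr_l2norm_Delta_le lf.
have /andP[_] := l2norm_Delta_even lD (Delta_odd of_).
have := l2norm_ge0 (Delta f); have := l2norm_ge0 f.
move: (l2norm f) (l2norm (Delta f)) (l2norm (Delta (Delta f))) => x y z x0 y0 zy yz.
have [->|yn0] := eqVneq y 0; first by rewrite mulr_ge0.
have yp : 0 < y by rewrite lt_def yn0.
rewrite -(ler_pM2l yp); apply: le_trans (_ : z * x <= _); first by rewrite -expr2.
by rewrite mulrCA mulrA; apply: ler_wpM2r => //; rewrite mulrC.
Qed.

Lemma Delta_parts f : l2 f ->
  [/\ l2 (even_part f), l2 (f - even_part f), f = even_part f + (f - even_part f) &
      Delta f = Delta (even_part f) + Delta (f - even_part f)].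
Proof.
move=> lf; have le := l2_even_part lf; split => //; first exact: l2B.
  by rewrite addrC subrK.
by rewrite -DeltaD addrC subrK.
Qed.

Lemma l2norm_Delta f : l2 f -> l2norm (Delta f) <= L * l2norm f.
Proof.
move=> lf; have [le lo fE DE] := Delta_parts lf.
have Ee := even_part_supported f; have Oo := odd_part_supported f.
rewrite -(ler_pXn2r (n := 2)) ?nnegrE ?mulr_ge0 ?l2norm_ge0//.
rewrite exprMn !sqr_l2norm//; last exact: l2_Delta.
rewrite DE; have -> : dot f f = dot (even_part f + (f - even_part f))
    (even_part f + (f - even_part f)) by rewrite -fE.
have lDe := l2_Delta le; have lDo := l2_Delta lo.
rewrite (dot_sqrD le lo) (dot_sqrD lDe lDo).
rewrite (dot_even_odd le lo Ee Oo) (dotC (Delta (even_part f)) (Delta (f - _))).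
rewrite (dot_even_odd lDo lDe (Delta_odd Oo) (Delta_even Ee)).
rewrite mulr0 !addr0 mulrDr -(sqr_l2norm le) -(sqr_l2norm lo).
rewrite -(sqr_l2norm lDe) -(sqr_l2norm lDo).
rewrite -!exprMn; apply: lerD; rewrite ler_pXn2r ?nnegrE ?mulr_ge0 ?l2norm_ge0//.
  by have /andP[] := l2norm_Delta_even le Ee.
exact: l2norm_Delta_odd.
Qed.

Lemma Delta_bsa : bounded_selfadjoint (@Delta R N) L.
Proof.
split => //; [exact: DeltaD|exact: DeltaZ|exact: l2_Delta|exact: dot_Delta|].
exact: l2norm_Delta.
Qed.

(** The kernel of [Delta] is separated from the rest of the spectrum by [s1].
    On odd families this is the even bound for [Delta f]; on even ones it
    follows from [|Delta f|^2 <= |Delta^2 f| |f|]. *)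
Lemma Delta_gap f : l2 f -> s1 * l2norm (Delta f) <= l2norm (Delta (Delta f)).
Proof.
move=> lf; have [le lo fE DE] := Delta_parts lf.
have Ee := even_part_supported f; have Oo := odd_part_supported f.
have lDe := l2_Delta le; have lDo := l2_Delta lo.
have s0 := ltW s1_gt0.
have he : s1 * l2norm (Delta (even_part f)) <= l2norm (Delta (Delta (even_part f))).
  have := sqr_l2norm_Delta_le le.
  have /andP[+ _] := l2norm_Delta_even le Ee.
  have := l2norm_ge0 (Delta (even_part f)); have := l2norm_ge0 (even_part f).
  have := l2norm_ge0 (Delta (Delta (even_part f))).
  move: (l2norm (even_part f)) (l2norm (Delta _)) (l2norm (Delta (Delta _))).
  move=> x y z z0 x0 y0 xy yz; have [->|yn0] := eqVneq y 0; first by rewrite mulr0.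
  have yp : 0 < y by rewrite lt_def yn0.
  rewrite -(ler_pM2l yp) mulrCA -expr2.
  apply: le_trans (ler_wpM2l s0 yz) _.
  by rewrite mulrCA mulrC; apply: ler_wpM2r.
have ho : s1 * l2norm (Delta (f - even_part f)) <= l2norm (Delta (Delta (f - even_part f))).
  by have /andP[] := l2norm_Delta_even lDo (Delta_odd Oo).
rewrite DE (DeltaD (Delta (even_part f)) (Delta (f - _))) -(ler_pXn2r (n := 2)) ?nnegrE ?mulr_ge0 ?l2norm_ge0//.
have lDDe := l2_Delta lDe; have lDDo := l2_Delta lDo.
rewrite exprMn (sqr_l2norm (l2D lDe lDo)) (sqr_l2norm (l2D lDDe lDDo)).
rewrite (dot_sqrD lDe lDo) (dot_sqrD lDDe lDDo).
rewrite (dot_even_odd lDDe lDDo (Delta_odd (Delta_even Ee)) (Delta_even (Delta_odd Oo))).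
rewrite (dotC (Delta (even_part f)) (Delta (f - _))) (dot_even_odd lDo lDe (Delta_odd Oo) (Delta_even Ee)).
rewrite mulr0 !addr0 mulrDr -(sqr_l2norm lDe) -(sqr_l2norm lDo).
rewrite -(sqr_l2norm lDDe) -(sqr_l2norm lDDo) -!exprMn.
by apply: lerD; rewrite ler_pXn2r ?nnegrE ?mulr_ge0 ?l2norm_ge0.
Qed.

(** For [0 < |x| < s1], [Delta_gap] bounds [Delta f] by [(Delta - x) f], and then
    [x f = Delta f - (Delta - x) f] bounds [f]. *)
Lemma spectrum_Delta_real x : spectrum (@Delta R N) x%:C ->
  (s1 <= `|x| <= L) \/ x = 0.
Proof.
move=> spec; have [->|x0] := eqVneq x 0; [by right|left].
have xp : 0 < `|x| by rewrite normr_gt0.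
have normx f : l2 f -> l2norm (x%:C \*o f) = `|x| * l2norm f by exact: l2normZr.
apply/andP; split; rewrite leNgt; apply/negP => xs; apply: spec.
- have sx : 0 < s1 - `|x| by rewrite subr_gt0.
  pose K := L / (s1 - `|x|) + 1.
  have K0 : 0 < K by rewrite ltr_wpDl// divr_ge0// ltW.
  apply: (resolvent_of_lower_bound Delta_bsa (d := `|x| / K)); first by rewrite divr_gt0.
  move=> f lf; set g := shifted _ _ f.
  have lg : l2 g by exact: (l2_shifted Delta_bsa).
  have lD := l2_Delta lf; have lxf := l2Z x%:C lf.
  have gE : g = Delta f - x%:C \*o f by [].
  have gap : (s1 - `|x|) * l2norm (Delta f) <= L * l2norm g.
    apply: le_trans (l2norm_Delta lg).
    have -> : Delta g = Delta (Delta f) - x%:C \*o Delta f.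
      by rewrite gE -scaleN1f DeltaD !DeltaZ scaleN1f.
    have := l2norm_triangleB (l2_Delta lD) (l2Z x%:C lD).
    by rewrite normx// mulrBl; have := Delta_gap lf => ? ?; lra.
  have fD : `|x| * l2norm f <= l2norm (Delta f) + l2norm g.
    rewrite -normx//.
    have -> : x%:C \*o f = Delta f - g by rewrite gE subKr.
    by rewrite -(l2normN lg); exact: l2norm_triangle (l2N lg).
  rewrite mulrAC ler_pdivrMr//; apply: le_trans fD _.
  rewrite /K mulrDr mulr1 lerD2r mulrC mulrAC ler_pdivlMr//.
  by rewrite mulrC.
- apply: (resolvent_of_lower_bound Delta_bsa (d := `|x| - L)); first by rewrite subr_gt0.
  move=> f lf; have lD := l2_Delta lf; have lxf := l2Z x%:C lf.
  rewrite shiftedE mulrBl -normx//.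
  have := l2norm_triangleB lxf lD.
  have -> : x%:C \*o f - Delta f = - (Delta f - x%:C \*o f) by rewrite opprB.
  rewrite l2normN; last exact: l2B.
  by have := l2norm_Delta lf => ? ?; lra.
Qed.

Lemma spectrum_Delta_complex (z : R[i]) : spectrum (@Delta R N) z ->
  z = (complex.Re z)%:C.
Proof.
move=> spec; apply/eqP; rewrite eq_complex eqxx /=; apply/negPn/negP => z0.
by apply: spec; exact: (resolvent_nonreal Delta_bsa).
Qed.

End DeltaBounds.

(** * Eigenvalues of the nanoribbon operator *)

Section PointSpectrum.
Context (R : realType).
Implicit Types (g : int -> R[i]) (P Q : {poly R[i]}).
Local Notation S := (@shiftz R 1).
Local Notation op := (cpoly_op S).

Let SD (f g : int -> R[i]) : S (f + g) = S f + S g. Proof. by []. Qed.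
Let SZ (z : R[i]) (f : int -> R[i]) : S (z \*o f) = z \*o S f. Proof. by []. Qed.

(** Translation is an isometry, so [|z| = 1] and the modulus of [g] is
    constant. *)
Lemma shift_eigenvector_eq0 (z : R[i]) g : l2 g -> S g = z \*o g -> g = 0.
Proof.
move=> lg Sg; apply: l2norm_eq0 => //; apply/eqP/negPn/negP => g0.
have nz : nsq z = 1.
  have := l2norm_shiftz 1 lg; rewrite Sg l2normZ// => /eqP.
  rewrite -{2}[l2norm g]mul1r (inj_eq (mulIf g0)) => /eqP/(congr1 (fun x => x ^+ 2)).
  by rewrite sqr_sqrtr ?nsq_ge0// expr1n.
have cst n (i : nat) : nsq (g (n + i%:Z)) = nsq (g n).
  elim: i => [|i ih]; first by rewrite addr0.
  rewrite -[i.+1]addn1 PoszD addrA.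
  by rewrite -[g (_ + _ + 1)]/(S g _) Sg /= nsqM nz mul1r.
have gz n : nsq (g n) = 0.
  apply/eqP/negPn/negP => gn0.
  have gp : 0 < nsq (g n) by rewrite lt_def gn0 nsq_ge0.
  pose k := Num.bound (dot g g / nsq (g n)).
  have bd : dot g g / nsq (g n) < k%:R by apply: archi_boundP; rewrite divr_ge0 ?dot_ge0 ?nsq_ge0.
  have := @rsum_ge_seq _ _ (fun i => nsq (g i)) [seq n + i%:Z | i <- iota 0 k] _ _ ((l2E _).1 lg).
  rewrite map_inj_uniq ?iota_uniq; last by move=> i j /addrI [].
  move=> /(_ isT (fun i => nsq_ge0 (g i))).
  rewrite big_map; under eq_bigr do rewrite cst.
  rewrite big_const_seq count_predT size_iota iter_addr_0 -mulr_natl.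
  move: bd; rewrite ltr_pdivrMr// => bd le.
  by have := le_lt_trans le bd; rewrite ltxx.
by move/eqP: g0; apply; rewrite (_ : g = 0) ?l2norm0//; apply/funext => n; exact: nsq_eq0.
Qed.

(** Factoring the polynomial over the complex numbers reduces to equations of
    the first order. *)
Lemma shift_polynomial_eq0 P g : P != 0 -> l2 g -> op P g = 0 -> g = 0.
Proof.
have [n] := ubnP (size P); elim: n => // n ih in P g *.
move=> sP P0 lg Pg; have [sP1|sP1] := eqVneq (size P) 1%N.
  have /size_poly1P[c c0 Pc] : size P == 1%N by rewrite sP1.
  move: Pg; rewrite Pc cpoly_opC => cg; apply/funext => i.
  by have := congr1 (fun h => h i) cg => /= /eqP; rewrite mulf_eq0 (negbTE c0) => /eqP.
have [r /factor_theorem[Q PQ]] : exists r, root P r by apply/closed_rootP.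
have Q0 : Q != 0 by apply: contra P0 => /eqP Q0; rewrite PQ Q0 mul0r.
have sQ : (size Q < n)%N.
  move: sP; rewrite PQ size_Mmonic ?monicXsubC// size_XsubC addn2 /=.
  by rewrite ltnS.
move: Pg; rewrite PQ (cpoly_opM SD SZ) => Qg.
have lh : l2 (op ('X - r%:P) g).
  by apply: l2_cpoly_op => //; exact: l2_shiftz.
have := ih _ _ sQ Q0 lh Qg => h.
apply: (shift_eigenvector_eq0 (z := r)) => //.
move: h; rewrite -polyCN cpoly_opD cpoly_opC -['X]mul1r (cpoly_opMX SD SZ) cpoly_opC scale1f.
by move=> /eqP; rewrite addr_eq0 => /eqP ->; apply/funext => i; rewrite !fctE /= mulNr opprK.
Qed.

Context (N : nat).
Hypothesis N1 : (1 <= N)%N.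
Implicit Types (f : Gamma N -> R[i]).
Local Notation ev f k := (row f k.*2).
Local Notation od f k := (row f k.*2.+1).

(** It vanishes on the even sublattice, and each odd row cancels the
    contribution of the previous one to the even row between them. *)
Definition flat_state : Gamma N -> R[i] := fun v =>
  if odd v.2 then 0 else iter (v.2)./2 (fun g => - hop_adj g) (delta R 0) v.1.

Lemma od_flat_state k : (k <= N)%N ->
  od flat_state k = iter k (fun g => - hop_adj g) (delta R 0).
Proof.
move=> kN; have kN2 : (k.*2 < N.*2.+1)%N by rewrite ltnS leq_double.
rewrite (row_ord _ (Ordinal kN2)); apply/funext => n.
by rewrite /flat_state /= odd_double doubleK.
Qed.

Lemma ev_flat_state k : ev flat_state k = 0.
Proof.
case: k => [|k]; first exact: ev0.
have [kN|Nk] := ltnP k N; last by apply: row_out; rewrite doubleS !ltnS leq_double.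
have kN2 : (k.*2.+1 < N.*2.+1)%N by rewrite ltnS ltn_double.
rewrite doubleS (row_ord _ (Ordinal kN2)); apply/funext => n.
by rewrite /flat_state /= odd_double.
Qed.

Lemma l2_flat_state : l2 flat_state.
Proof.
apply/l2_rows => j; have [jo|je] := boolP (odd j); last first.
  by rewrite -[j]odd_double_half (negbTE je) ev_flat_state; exact: l2_0.
rewrite -[j]odd_double_half jo add1n.
have [kN|Nk] := leqP j./2 N; last by rewrite row_out ?ltnS ?ltn_double//; exact: l2_0.
rewrite od_flat_state//; elim: (j./2) => [|k ih] /=; first exact: l2_delta.
by apply: l2N; exact: l2_hop_adj.
Qed.

Lemma Delta_flat_state : Delta flat_state = 0.
Proof.
apply: rows_eq => j; rewrite row0; have [jo|je] := boolP (odd j); last first.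
  rewrite -[j]odd_double_half (negbTE je) add0n; case: (j./2) => [|k]; first exact: ev0.
  have [kN|Nk] := ltnP k N; last by apply: row_out; rewrite doubleS !ltnS leq_double.
  by rewrite ev_Delta// !od_flat_state ?(ltnW kN)//= subrr.
rewrite -[j]odd_double_half jo add1n.
have [kN|Nk] := leqP j./2 N; last by rewrite row_out ?ltnS ?ltn_double.
rewrite od_Delta// !ev_flat_state; apply/funext => n.
by rewrite /hop /shiftz !fctE !addr0.
Qed.

Lemma flat_state_neq0 : flat_state <> (fun=> 0).
Proof.
move=> /(congr1 (fun h => h (0, ord0))); rewrite /flat_state /= /delta eqxx.
by move/eqP; rewrite oner_eq0.
Qed.

(** Eliminating the odd rows from the eigenvalue equation leaves a recurrence
    on the even rows, [(1 + S) v_(k+2) = - Q(S) v_(k+1) - S (1 + S) v_k], where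
    [S] is the translation.  By induction [(1 + S)^k v_(k+1) = P(S) v_1], with a
    polynomial [P] that does not vanish at 0.  As [v_(N+1) = 0], this is a
    difference equation for [v_1]. *)
Lemma Delta_eigenvector_eq0 (z : R[i]) f : z != 0 -> l2 f ->
  Delta f = z \*o f -> f = 0.
Proof.
move=> z0 /l2_rows rf Df.
pose v k := ev f k; pose u k := od f k.
have uE k : (k <= N)%N -> z \*o u k = v k + hop (v k.+1).
  by move=> kN; rewrite /u -rowZ -Df od_Delta.
have vE k : (k < N)%N -> z \*o v k.+1 = hop_adj (u k) + u k.+1.
  by move=> kN; rewrite /v -rowZ -Df ev_Delta.
pose E : {poly R[i]} := 1 + 'X.
pose Q : {poly R[i]} := E ^+ 2 + (1 - z ^+ 2) *: 'X.
have opX g : op 'X g = S g by rewrite -['X]mul1r (cpoly_opMX SD SZ) cpoly_opC scale1f.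
have opE g : op E g = hop_adj g by rewrite cpoly_opD opX -polyC1 cpoly_opC scale1f.
have op0 P : op P 0 = 0.
  by rewrite -[X in op P X](scale0f 0) (cpoly_op_linZ SD SZ) scale0f.
have opN P g : op (- P) g = - op P g by rewrite -scaleN1r cpoly_opZ scaleN1f.
have rec k : (k < N)%N -> op E (v k.+2) = op (- Q) (v k.+1) + op (- ('X * E)) (v k).
  move=> kN; have := vE _ kN; have := uE _ kN; have := uE _ (ltnW kN).
  rewrite !opN /Q (cpoly_opD _ (E ^+ 2)) cpoly_opZ opX.
  rewrite expr2 !(cpoly_opM SD SZ) !opE opX => u0 u1 v1.
  apply/funext => n.
  have a0 := congr1 (fun h => h (n + 1)) u0; have a1 := congr1 (fun h => h (n + 1 + 1)) u0.
  have b1 := congr1 (fun h => h (n + 1)) u1.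
  have d1 := congr1 (fun h => z * h (n + 1)) v1.
  move: a0 a1 b1 d1; rewrite /hop_adj /hop /shiftz !fctE /= !addrK !mulrDr.
  move: (v k.+2 n) (v k.+2 (n + 1)) (v k.+1 n) (v k.+1 (n + 1)) (v k.+1 (n + 1 + 1)).
  move: (v k (n + 1)) (v k (n + 1 + 1)) (z * u k (n + 1)) (z * u k (n + 1 + 1)).
  move: (z * u k.+1 (n + 1)) => up ua ub x1 x2 y0 y1 w0 w1 w2 -> -> ->.
  move=> d1; rewrite expr2 mulrBl mul1r -mulrA d1; ring.
(* The second identity is carried along because the recurrence has order 2. *)
have claim k : (k <= N)%N -> exists P P' : {poly R[i]},
    [/\ P.[0] != 0, op (E ^+ k) (v k.+1) = op P (v 1%N) &
        op (E ^+ k) (v k) = op P' (v 1%N)].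
  elim: k => [|k ih] kN.
    exists 1, 0; rewrite hornerC oner_eq0 expr0 cpoly_op0 -polyC1 !cpoly_opC.
    by split => //; rewrite scale1f /v ev0.
  have [P [P' [P0 hP hP']]] := ih (ltnW kN).
  exists (- Q * P - 'X * E * P'), (E * P); split.
  - have QZ : Q.[0] = 1.
      rewrite /Q /E hornerD horner_exp hornerZ hornerD hornerC hornerX.
      by rewrite addr0 mulr0 addr0 expr1n.
    rewrite mulNr hornerD !hornerN -mulrA !hornerM hornerX mul0r subr0 QZ.
    by rewrite mul1r oppr_eq0.
  - rewrite exprSr (cpoly_opM SD SZ) rec// (cpoly_op_linD SD SZ).
    rewrite -!(cpoly_opM SD SZ) ![E ^+ k * _]mulrC !(cpoly_opM SD SZ) hP hP'.
    by rewrite -!(cpoly_opM SD SZ) [RHS]cpoly_opD !mulNr.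
  - by rewrite exprS (cpoly_opM SD SZ) hP -(cpoly_opM SD SZ).
have v1 : v 1%N = 0.
  have [P [P' [P0 hP _]]] := claim N (leqnn N).
  apply: (shift_polynomial_eq0 (P := P)) => //; first by apply: contra P0 => /eqP ->; rewrite horner0.
    exact: rf.
  by rewrite -hP /v evS op0.
have E0 : E != 0.
  by apply/negP => /eqP/(congr1 (fun p => p.[0])); rewrite /E !hornerE => /eqP; rewrite oner_eq0.
have vv k : v k = 0 /\ v k.+1 = 0.
  elim: k => [|k [vk vk1]]; first by split => //; exact: ev0.
  split => //; have [kN|Nk] := ltnP k N; last first.
    by apply: row_out; rewrite -!addnn; lia.
  apply: (shift_polynomial_eq0 E0); first exact: rf.
  by rewrite rec// vk vk1 !op0 addr0.
apply: rows_eq => j; rewrite row0; have [jo|je] := boolP (odd j); last first.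
  by rewrite -[j]odd_double_half (negbTE je) add0n; have [] := vv (j./2).
rewrite -[j]odd_double_half jo add1n.
have [kN|Nk] := leqP j./2 N; last by rewrite row_out ?ltnS ?ltn_double.
have := uE _ kN; have [-> ->] := vv (j./2).
rewrite (_ : hop 0 = 0) ?addr0; last first.
  by apply/funext => n; rewrite /hop /shiftz !fctE addr0.
move=> zu; apply/funext => n.
have := congr1 (fun h => h n) zu => /= /eqP; rewrite mulf_eq0 (negbTE z0) => /eqP.
by [].
Qed.

Lemma pp_spectrum_Delta : pp_spectrum (@Delta R N) = [set 0].
Proof.
apply/seteqP; split => [z [f [lf f0 Df]]|z -> /=].
  apply: contrapT => z0; apply: f0.
  apply: (@Delta_eigenvector_eq0 z) => //; exact/eqP.
exists flat_state; split; [exact: l2_flat_state|exact: flat_state_neq0|].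
by rewrite Delta_flat_state; apply/funext => v; rewrite mul0r.
Qed.

Lemma spectrum_Delta0 : spectrum (@Delta R N) 0.
Proof.
move=> [[_ inj _] _]; apply: flat_state_neq0.
apply: (inj flat_state 0); [exact/mem_set/l2_flat_state|exact/mem_set/l2_0|].
rewrite !shiftedE Delta_flat_state scale0f scalef0.
by rewrite -[X in Delta X](scale0f 0) DeltaZ scale0f.
Qed.

End PointSpectrum.

(** * Moments of the operator on a site *)

Section DiscreteOrthogonality.
Context (R : realType) (N : nat).
Implicit Types (k m r : nat).
Local Notation step := (step R N).

Lemma cos_nat_pi r : cos (r%:R * pi) = (- 1) ^+ r :> R.
Proof.
elim: r => [|r ih]; first by rewrite mul0r cos0.
rewrite -[r.+1]addn1 natrD mulrDl mul1r cosD ih sinpi cospi mulr0 subr0.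
by rewrite exprD expr1.
Qed.

(** The geometric sum, multiplied by [2 sin (r step / 2)] to telescope. *)
Lemma sum_cos_step r : (0 < r < N.+1.*2)%N ->
  \sum_(k < N.+1) cos (r%:R * (k%:R * step)) = (1 - (- 1) ^+ r) / 2.
Proof.
move=> /andP[r0 rN]; set y := r%:R * step / 2.
have yy : y + y = r%:R * step by rewrite /y; field.
have sy : 0 < sin y.
  have rs : 0 < r%:R * step by rewrite pmulr_lgt0 ?step_gt0// ltr0n.
  apply: sin_gt0_pi; rewrite /y (divr_gt0 rs)//=.
  rewrite ltr_pdivrMr// -(natM_step R N) mulrAC ltr_pM2r ?step_gt0//.
  by rewrite -natrM ltr_nat muln2.
have tele n : 2 * sin y * \sum_(k < n) cos (r%:R * (k%:R * step))
    = sin (n%:R * (y + y) - y) + sin y.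
  elim: n => [|n ih]; first by rewrite big_ord0 mul0r sub0r sinN mulr0 addNr.
  rewrite big_ord_recr /= mulrDr ih.
  have -> : n.+1%:R * (y + y) - y = n%:R * (y + y) + y.
    by rewrite -[n.+1]addn1 natrD; ring.
  have -> : r%:R * (n%:R * step) = n%:R * (y + y) by rewrite yy; ring.
  by rewrite sinB sinD; ring.
have := tele N.+1.
have -> : N.+1%:R * (y + y) = r%:R * pi by rewrite yy mulrCA natM_step.
rewrite sinB sin_nat_pi cos_nat_pi mul0r sub0r => h.
apply: (mulfI (lt0r_neq0 sy)); apply: (mulfI (_ : 2 != 0 :> R)) => //.
by rewrite mulrA h; field.
Qed.

(** Orthogonality of the first eigenvector of the path to the other ones. *)
Lemma sum_sin_sin m : (0 < m <= N)%N ->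
  \sum_(k < N) sin (k.+1%:R * step) * sin (m%:R * (k.+1%:R * step))
  = if m == 1%N then N.+1%:R / 2 else 0.
Proof.
move=> /andP[m0 mN].
have -> : \sum_(k < N) sin (k.+1%:R * step) * sin (m%:R * (k.+1%:R * step))
   = \sum_(k < N.+1) (cos (m.-1%:R * (k%:R * step)) - cos (m.+1%:R * (k%:R * step))) / 2.
  rewrite big_ord_recl /= !mul0r !mulr0 subrr mul0r add0r.
  apply: eq_bigr => k _; rewrite /bump /= add1n.
  set t := k.+1%:R * step.
  have -> : m.+1%:R * t = m%:R * t + t by rewrite -[m.+1]addn1 natrD; ring.
  have -> : m.-1%:R * t = m%:R * t - t.
    by rewrite -{2}(prednK m0) -[m.-1.+1]addn1 natrD; ring.
  by rewrite cosB cosD; field.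
rewrite -mulr_suml big_split /= sumrN.
have [m1|m1] := eqVneq m 1%N.
  rewrite m1 (sum_cos_step (r := 2)); last by rewrite -addnn; lia.
  rewrite sqrrN expr1n subrr mul0r subr0.
  by under eq_bigr do rewrite mul0r cos0; rewrite sumr_const card_ord.
move/eqP: m1 => m1.
rewrite (sum_cos_step (r := m.-1)); last by rewrite -addnn; lia.
rewrite (sum_cos_step (r := m.+1)); last by rewrite -addnn; lia.
have -> : m.+1 = m.-1.+2 by lia.
by rewrite !exprSr mulrN1 mulrN1 opprK subrr mul0r.
Qed.

End DiscreteOrthogonality.

Section UniformMeasure.
Context (R : realType).
Local Notation leb := (@lebesgue_measure R).

Definition unif : {finite_measure set (measurableTypeR R) -> \bar R} :=
  uniform_prob (pi_gt0 R).

Lemma unifT : unif setT = 1%E.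
Proof. exact: (@probability_setT _ (measurableTypeR R) R (uniform_prob (pi_gt0 R))). Qed.

Lemma unifE (E : set (measurableTypeR R)) : measurable E ->
  unif E = ((pi^-1)%:E * leb (E `&` `[0%R, pi]%classic))%E.
Proof.
move=> mE.
have -> : unif E = (\int[leb]_(x in E) (uniform_pdf 0 pi x)%:E)%E by [].
rewrite integral_uniform_pdf.
rewrite (eq_integral (fun=> (pi^-1)%:E)); last first.
  by move=> x /set_mem[_] /=; rewrite in_itv /= => x0; rewrite /uniform_pdf x0 subr0.
by rewrite integral_cst//; apply: measurableI.
Qed.

Lemma unif_bounded_integrable (h : R -> R) (C : R) :
  continuous h -> (forall x, `|h x| <= C) -> unif.-integrable setT (EFin \o h).
Proof.
move=> ch hC; apply: (@bounded_integrable _ unif setT h C) => //.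
exact: continuous_measurable_fun.
Qed.

Lemma integral_unif_cst (c : R) : \int[unif]_(x in setT) (cst c x) = c.
Proof.
rewrite Rintegral_cst// -[RHS]mulr1; congr (_ * _).
exact: (congr1 fine unifT).
Qed.

(** Adding 1 makes the integrand nonnegative, as the formula for the integral
    against the uniform law requires. *)
Lemma integral_cos_even (n : int) :
  \int[unif]_x cos (2 * n%:~R * x) = (n == 0)%:R :> R.
Proof.
have [->|n0] := eqVneq n 0.
  under eq_Rintegral do rewrite mulr0 mul0r cos0.
  exact: (integral_unif_cst 1).
set r : R := 2 * n%:~R.
have r0 : r != 0 by rewrite mulf_neq0// intr_eq0.
have cc : continuous (fun x : R => cos (r * x)).
  move=> x; apply: (@continuous_comp _ _ _ (fun x => r * x) (@cos R)).
    exact: mulrl_continuous.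
  exact: continuous_cos.
have ic : unif.-integrable setT (EFin \o (fun x : R => cos (r * x))).
  apply: (@unif_bounded_integrable _ 1) => // x.
  by rewrite ler_norml cos_geN1 cos_le1.
have c1 : continuous (fun x : R => 1 + cos (r * x)).
  by move=> x; apply: cvgD; [exact: cvg_cst|exact: cc].
have : \int[unif]_x (1 + cos (r * x)) = 1.
  rewrite /Rintegral integral_uniform; last 2 first.
  - by apply/measurable_EFinP; exact: continuous_measurable_fun.
  - by move=> x; rewrite lee_fin; have := cos_geN1 (r * x) => ?; lra.
  have dF (x : R) : is_derive x 1 (fun x : R => x + sin (r * x) / r) (1 + cos (r * x)).
    have h : is_derive x 1 (fun x : R => r * x) r.
      by apply: is_derive_eq; rewrite /GRing.scale /= mulr1.
    apply: is_derive_eq; rewrite /GRing.scale /=; field; exact: r0.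
  rewrite (@continuous_FTC2 R _ (fun x => x + sin (r * x) / r) 0 pi) ?pi_gt0//.
  - rewrite mulr0 sin0 mul0r addr0 sube0 subr0 /=.
    have -> : sin (r * pi) = 0.
      rewrite /r; case: (n) => m.
        by rewrite -[2]/(2%:R) -natrM sin_nat_pi.
      by rewrite NegzE mulrNz mulrN mulNr sinN -[2]/(2%:R) -natrM sin_nat_pi oppr0.
    by rewrite mul0r addr0 mulVf// gt_eqF// pi_gt0.
  - exact: continuous_subspaceT.
  - have cF x : {for x, continuous (fun x : R => x + sin (r * x) / r)}.
      by apply: differentiable_continuous; apply/derivable1_diffP.
    split => [x _| |]; first by case: (dF x).
      by apply: cvg_at_right_filter; exact: cF.
    by apply: cvg_at_left_filter; exact: cF.
  - by move=> x _; rewrite derive1E; apply: derive_val.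
rewrite RintegralD//; last first.
  by have := @unif_bounded_integrable (cst 1) 1; apply => //; [exact: cst_continuous|move=> x; rewrite normr1].
by rewrite integral_unif_cst => h; apply: (addrI 1); rewrite addr0 -[RHS]h.

Qed.

End UniformMeasure.

Section BoundedContinuous.
Context (R : realType).
Local Notation unif := (unif R).

(** A class closed under sums and products on which integrals against [unif]
    are additive. *)
Definition bounded_continuous (h : R -> R) :=
  continuous h /\ exists C : R, forall x, `|h x| <= C.
Local Notation cb := bounded_continuous.

Lemma bounded_continuous_cst (a : R) : cb (fun=> a).
Proof. by split; [move=> x; exact: cvg_cst|exists `|a|]. Qed.

Lemma bounded_continuousD g h : cb g -> cb h -> cb (fun x => g x + h x).
Proof.
move=> [cg [C hC]] [ch [D hD]]; split; first by move=> x; apply: cvgD; [exact: cg|exact: ch].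
by exists (C + D) => x; apply: le_trans (ler_normD _ _) _; rewrite lerD.
Qed.

Lemma bounded_continuousM g h : cb g -> cb h -> cb (fun x => g x * h x).
Proof.
move=> [cg [C hC]] [ch [D hD]]; split; first by move=> x; apply: cvgM; [exact: cg|exact: ch].
by exists (C * D) => x; rewrite normrM ler_pM.
Qed.

Lemma bounded_continuousX h n : cb h -> cb (fun x => h x ^+ n).
Proof.
move=> ch; elim: n => [|n ih]; first exact: bounded_continuous_cst.
by under [X in cb X]funext do rewrite exprS; exact: bounded_continuousM.
Qed.

Lemma bounded_continuous_cos (r : R) : cb (fun x => cos (r * x)).
Proof.
split; last by exists 1 => x; rewrite ler_norml cos_geN1 cos_le1.
move=> x; apply: (@continuous_comp _ _ _ (fun x => r * x) (@cos R)).
  exact: mulrl_continuous.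
exact: continuous_cos.
Qed.

Lemma unif_integrable h : cb h -> unif.-integrable setT (EFin \o h).
Proof. by move=> [ch [C hC]]; exact: (unif_bounded_integrable ch hC). Qed.

Lemma integral_unifD g h : cb g -> cb h ->
  \int[unif]_x (g x + h x) = \int[unif]_x g x + \int[unif]_x h x.
Proof. by move=> cg ch; rewrite RintegralD//; exact: unif_integrable. Qed.

Lemma integral_unifZ a h : cb h ->
  \int[unif]_x (a * h x) = a * \int[unif]_x h x.
Proof. by move=> ch; rewrite RintegralZl//; exact: unif_integrable. Qed.

End BoundedContinuous.

Section Moments.
Context (R : realType) (N : nat).
Hypothesis N1 : (1 <= N)%N.
Implicit Types (k m l : nat) (n : int) (x : R).
Local Notation unif := (unif R).
Local Notation step := (step R N).
Local Notation theta k := (k%:R * step).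
Local Notation ev f k := (row f k.*2).

Lemma ev_Delta2 (f : Gamma N -> R[i]) m n : (m < N)%N ->
  ev (Delta (Delta f)) m.+1 n =
  ev f m n + ev f m (n + 1) +
  (ev f m.+1 (n - 1) + ev f m.+1 n *+ 3 + ev f m.+1 (n + 1)) +
  (ev f m.+2 (n - 1) + ev f m.+2 n).
Proof.
move=> mN; rewrite ev_Delta// !od_Delta//; last exact: ltnW.
rewrite /hop_adj /hop !fctE /shiftz addrK.
by ring.
Qed.

(** The symbol of the square of the operator in the [k]-th channel. *)
Definition symbol k x : R := 4 * cos x ^+ 2 + 4 * cos x * cos (theta k) + 1.

(** The half-integral shift along the ribbon with [m] makes the translations by
    0 and 1 between neighbouring rows act as the phases [- x] and [x]. *)
Definition wave k x m n : R := cos ((2 * n%:~R + m%:R - 1) * x) * sin (m%:R * theta k).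

(** The left-hand side is [Delta^2] applied to the wave, as in [ev_Delta2]. *)
Lemma wave_eigen k x m n :
  wave k x m n + wave k x m (n + 1) +
  (wave k x m.+1 (n - 1) + wave k x m.+1 n *+ 3 + wave k x m.+1 (n + 1)) +
  (wave k x m.+2 (n - 1) + wave k x m.+2 n) = symbol k x * wave k x m.+1 n.
Proof.
set phi : R := (2 * n%:~R + m%:R) * x.
have W0 : wave k x m n = cos (phi - x) * sin (m%:R * theta k).
  by rewrite /wave /phi; congr (cos _ * _); ring.
have W0p : wave k x m (n + 1) = cos (phi + x) * sin (m%:R * theta k).
  by rewrite /wave /phi; congr (cos _ * _); rewrite intrD; ring.
have W1m : wave k x m.+1 (n - 1) = cos (phi - (x + x)) * sin (m.+1%:R * theta k).
  by rewrite /wave /phi; congr (cos _ * _); rewrite intrB -[m.+1%:R]natr1; ring.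
have W1 : wave k x m.+1 n = cos phi * sin (m.+1%:R * theta k).
  by rewrite /wave /phi; congr (cos _ * _); rewrite -[m.+1%:R]natr1; ring.
have W1p : wave k x m.+1 (n + 1) = cos (phi + (x + x)) * sin (m.+1%:R * theta k).
  by rewrite /wave /phi; congr (cos _ * _); rewrite intrD -[m.+1%:R]natr1; ring.
have W2m : wave k x m.+2 (n - 1) = cos (phi - x) * sin (m.+2%:R * theta k).
  by rewrite /wave /phi; congr (cos _ * _); rewrite intrB -[m.+2%:R]natr1 -[m.+1%:R]natr1; ring.
have W2 : wave k x m.+2 n = cos (phi + x) * sin (m.+2%:R * theta k).
  by rewrite /wave /phi; congr (cos _ * _); rewrite -[m.+2%:R]natr1 -[m.+1%:R]natr1; ring.
rewrite W0 W0p W1m W1 W1p W2m W2 /symbol.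
have three := sin_three_term (theta k) m.
have -> : sin (m.+2%:R * theta k) =
  2 * cos (theta k) * sin (m.+1%:R * theta k) - sin (m%:R * theta k).
  by rewrite -three; ring.
rewrite !cosB !cosD sinD.
have s2 : sin x ^+ 2 = 1 - cos x ^+ 2 by rewrite -[X in X - _](cos2Dsin2 x); ring.
have -> : cos x * cos x - sin x * sin x = 2 * cos x ^+ 2 - 1.
  by rewrite -!expr2 s2; ring.
by ring.
Qed.

(** The coefficients that expand the delta function at the first vertex of the
    path in the eigenvectors [sin (m theta k)]. *)
Definition weight k : R := 2 * sin (theta k) / N.+1%:R.

Definition moment l m n : R :=
  \sum_(k < N) weight k.+1 * \int[unif]_x (symbol k.+1 x ^+ l * wave k.+1 x m n).

Lemma bounded_continuous_symbol k : bounded_continuous (symbol k).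
Proof.
have h : bounded_continuous (@cos R).
  by have := bounded_continuous_cos (1 : R); under [X in _ X -> _]funext do rewrite mul1r.
apply: bounded_continuousD; last exact: bounded_continuous_cst.
apply: bounded_continuousD.
  apply: bounded_continuousM; first exact: bounded_continuous_cst.
  exact: bounded_continuousX.
apply: bounded_continuousM; last exact: bounded_continuous_cst.
by apply: bounded_continuousM => //; exact: bounded_continuous_cst.
Qed.

Lemma bounded_continuous_wave k l m n :
  bounded_continuous (fun x => symbol k x ^+ l * wave k x m n).
Proof.
apply: bounded_continuousM; first exact/bounded_continuousX/bounded_continuous_symbol.
apply: bounded_continuousM; last exact: bounded_continuous_cst.
exact: bounded_continuous_cos.
Qed.

Lemma momentS l m n :
  moment l m n + moment l m (n + 1) +
  (moment l m.+1 (n - 1) + moment l m.+1 n *+ 3 + moment l m.+1 (n + 1)) +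
  (moment l m.+2 (n - 1) + moment l m.+2 n) = moment l.+1 m.+1 n.
Proof.
rewrite -sumrMnl -!big_split /=; apply: eq_bigr => k _.
rewrite -mulrnAr -!mulrDr; congr (_ * _).
have bc := @bounded_continuous_wave k.+1 l.
pose g m n x := symbol k.+1 x ^+ l * wave k.+1 x m n.
have -> : (\int[unif]_x g m.+1 n x) *+ 3 = \int[unif]_x (3 * g m.+1 n x).
  by rewrite integral_unifZ; [rewrite mulr_natl|exact: bc].
rewrite -?integral_unifD; do ?[exact: bc|exact: bounded_continuousD|
   by apply: bounded_continuousM; [exact: bounded_continuous_cst|exact: bc]|
   apply: bounded_continuousD].
apply: eq_Rintegral => x _; rewrite /g exprSr -mulrA -wave_eigen.
by ring.
Qed.

(** Orthogonality along the ribbon ([integral_cos_even]) and across it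
    ([sum_sin_sin]). *)
Lemma moment0 m n : (m <= N.+1)%N ->
  moment 0 m n = ((n == 0) && (m == 1%N))%:R.
Proof.
move=> mN.
have E : moment 0 m n = (\int[unif]_x cos ((2 * n%:~R + m%:R - 1) * x)) *
   (2 / N.+1%:R * \sum_(k < N) sin (k.+1%:R * step) * sin (m%:R * (k.+1%:R * step))).
  rewrite mulr_sumr mulr_sumr; apply: eq_bigr => k _.
  under eq_Rintegral do rewrite expr0 mul1r /wave mulrC.
  rewrite integral_unifZ; last exact: bounded_continuous_cos.
  by rewrite /weight; ring.
rewrite E; have [m0|m0] := posnP m.
  by rewrite m0 andbF big1 ?mulr0// => k _; rewrite mul0r sin0 mulr0.
have [mS|mS] := eqVneq m N.+1.
  rewrite mS eqSS eqn0Ngt N1 andbF big1 ?mulr0// => k _.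
  by rewrite [N.+1%:R * _]mulrCA natM_step sin_nat_pi mulr0.
rewrite sum_sin_sin; last by rewrite m0/=; lia.
case: eqP => [->|_]; last by rewrite andbF !mulr0.
rewrite andbT mulrA divfK ?pnatr_eq0// mulfV ?mulr1//.
under eq_Rintegral do rewrite addrK.
exact: integral_cos_even.
Qed.

Local Notation v0 := ((0 : int), inord 1 : 'I_N.*2.+1).

Lemma ev_iter_Delta2 l m n : (m <= N.+1)%N ->
  ev (iter l (fun f => Delta (Delta f)) (delta R (v0 : Gamma N))) m n = (moment l m n)%:C.
Proof.
elim: l m n => [|l ih] m n mN /=.
  rewrite moment0//.
  case: m mN => [|m] mN; first by rewrite ev0 andbF.
  have [->|mN'] := eqVneq m N; first by rewrite evS eqSS eqn0Ngt N1 andbF.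
  have jN : (m.*2.+1 < N.*2.+1)%N by lia.
  rewrite doubleS (row_ord _ (Ordinal jN)) /delta xpair_eqE.
  rewrite -val_eqE /= inordK; last by lia.
  by rewrite eqSS; case: m {mN mN' jN} => [|m] //=; case: eqP.
case: m mN => [|m] mN.
  by rewrite ev0 /moment big1// => k _; rewrite /wave; under eq_Rintegral do rewrite mul0r sin0 !mulr0; rewrite integral_unif_cst mulr0.
have [->|mN'] := eqVneq m N.
  rewrite evS /moment big1// => k _; under eq_Rintegral do
    rewrite /wave [N.+1%:R * (_ * _)]mulrCA natM_step sin_nat_pi !mulr0.
  by rewrite integral_unif_cst mulr0.
rewrite ev_Delta2; last by lia.
rewrite !ih; try lia.
by rewrite -momentS !rmorphD.
Qed.

End Moments.

(** * Mixtures of distributions *)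

Section FiniteSum.
Context d (T : measurableType d) (R : realType).
Variables (mu nu : {finite_measure set T -> \bar R}).
Local Open Scope ereal_scope.

Let add : set T -> \bar R := fun E => mu E + nu E.

Let addE : add = measure_add mu nu.
Proof. by apply/funext => E; rewrite measure_addE. Qed.

Let add0 : add set0 = 0. Proof. by rewrite /add !measure0 adde0. Qed.

Let add_ge0 E : 0 <= add E. Proof. by rewrite adde_ge0. Qed.

Let add_sigma_additive : semi_sigma_additive add.
Proof. by rewrite addE; exact: (@measure_semi_sigma_additive _ _ _ (measure_add mu nu)). Qed.

HB.instance Definition _ := isMeasure.Build _ _ _ add add0 add_ge0 add_sigma_additive.

Let add_fin : fin_num_fun add.
Proof. by move=> E mE; rewrite /add fin_numD !fin_num_measure. Qed.

HB.instance Definition _ := @Measure_isFinite.Build _ _ _ add add_fin.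

Definition fmeasure_add : {finite_measure set T -> \bar R} := add.

Lemma fmeasure_addE E : fmeasure_add E = mu E + nu E.
Proof. by []. Qed.

Let integral_add h : \int[fmeasure_add]_x h x = \int[measure_add mu nu]_x h x.
Proof. by apply: (eq_measure_integral (measure_add mu nu)) => E mE _; exact: (congr1 (@^~ E) addE). Qed.

Lemma integrable_fmeasure_add h : mu.-integrable setT h -> nu.-integrable setT h ->
  fmeasure_add.-integrable setT h.
Proof.
move=> /integrableP[mh hm] /integrableP[_ hn]; apply/integrableP; split => //.
rewrite integral_add ge0_integral_measure_add//; last exact: measurableT_comp.
exact: lte_add_pinfty.
Qed.

Lemma integral_fmeasure_add h : mu.-integrable setT h -> nu.-integrable setT h ->
  \int[fmeasure_add]_x h x = \int[mu]_x h x + \int[nu]_x h x.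
Proof. by move=> im inu; rewrite integral_add; apply: integral_measure_add => //; exact: measurable_int im. Qed.

End FiniteSum.

Section Mixture.
Context (R : realType).
Local Notation unif := (unif R).
Local Notation fmeasure := {finite_measure set (measurableTypeR R) -> \bar R}.

Lemma bounded_continuous_horner (p : {poly R}) h :
  bounded_continuous h -> bounded_continuous (fun x => p.[h x]).
Proof.
move=> bh; elim/poly_ind: p => [|p c ih].
  by under [X in bounded_continuous X]funext do rewrite horner0; exact: bounded_continuous_cst.
under [X in bounded_continuous X]funext do rewrite hornerMXaddC.
by apply: bounded_continuousD; [exact: bounded_continuousM|exact: bounded_continuous_cst].
Qed.

Lemma distribution_exists (w : R) h : 0 <= w -> bounded_continuous h ->
  exists mu : fmeasure,
  [/\ forall E, measurable E -> mu E = (w%:E * unif (h @^-1` E))%E,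
      forall p : {poly R}, mu.-integrable setT (EFin \o horner p) &
      forall p : {poly R}, \int[mu]_(x in setT) p.[x] = w * \int[unif]_x p.[h x]].
Proof.
move=> w0 bh.
have mh : measurable_fun [set: measurableTypeR R] (h : _ -> measurableTypeR R).
  by apply: continuous_measurable_fun; case: bh.
pose hm := isMeasurableFun.Build _ _ _ _ _ mh.
pose H : {mfun measurableTypeR R >-> measurableTypeR R} :=
  MeasurableFun.Pack (MeasurableFun.Class hm).
pose nu : fmeasure := distribution (uniform_prob (pi_gt0 R)) H.
have iw : nu.-integrable setT (fun=> w%:E).
  by apply: (@bounded_integrable _ nu setT (fun=> w) `|w|).
have iph (p : {poly R}) : unif.-integrable setT (EFin \o (fun x => p.[h x])).
  by apply: unif_integrable; exact: bounded_continuous_horner.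
have mp (p : {poly R}) : measurable_fun [set: measurableTypeR R] (EFin \o horner p).
  by apply/measurable_EFinP; exact: (@measurable_horner R p setT).
have nuE E : nu E = unif (h @^-1` E) by [].
pose mu := density_fmeasure (fun _ : measurableTypeR R => (w0 : 0 <= w%:E)%E) iw.
have muE E : measurable E -> mu E = (w%:E * unif (h @^-1` E))%E.
  by move=> mE; rewrite /mu /density_fmeasure /= /density_measure integral_cst.
have [_ [C hC]] := bh.
pose S : set (measurableTypeR R) := [set` `[- C, C]].
have mS : measurable S by exact: measurable_itv.
have hS : h @^-1` (~` S) = set0.
  apply/seteqP; split => // x; apply.
  by rewrite /S /= in_itv/= -ler_norml.
have nuS : nu (~` S) = 0%E by rewrite nuE hS measure0.
have muS : mu (~` S) = 0%E by apply: density_null => //; exact: measurableC.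
have int (m : fmeasure) (p : {poly R}) : m (~` S) = 0%E ->
    m.-integrable setT (EFin \o horner p).
  move=> mS0; have [K _ hK] := horner_bounded p C.
  apply: (Rintegral_concentrated mS mS0 (@measurable_horner R p setT) _).1 => x Sx.
  by apply: hK; move: Sx; rewrite /S /= in_itv/= ler_norml.
have imu p := int mu p muS; have inu p := int nu p nuS.
exists mu; split => // p.
rewrite /Rintegral integral_density; last exact: imu.
have -> : (\int[nu]_x ((EFin \o horner p) x * w%:E))%E = (\int[nu]_x (EFin \o horner p) x * w%:E)%E.
  by rewrite integralZr.
rewrite fineM//; last exact: integrable_fin_num.
rewrite mulrC; congr (_ * fine _).
by rewrite integral_distribution//; exact: iph.
Qed.

(** Only the values on measurable sets and the integrals of polynomials are
    recorded, as they are all that spectral measures involve. *)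
Lemma mixture_exists n (w : nat -> R) (h : nat -> R -> R) :
  (forall i, 0 <= w i) -> (forall i, bounded_continuous (h i)) ->
  exists mu : fmeasure,
  [/\ forall E, measurable E -> mu E = (\sum_(i < n) (w i)%:E * unif (h i @^-1` E))%E,
      forall p : {poly R}, mu.-integrable setT (EFin \o horner p) &
      forall p : {poly R}, \int[mu]_(x in setT) p.[x]
        = \sum_(i < n) w i * \int[unif]_x p.[h i x]].
Proof.
move=> w0 bh; elim: n => [|n [mu [muE imu mup]]].
  have [mu [muE imu mup]] := distribution_exists (lexx 0) (bh 0%N).
  exists mu; split=> // [E mE|p]; first by rewrite muE// mul0e big_ord0.
  by rewrite mup mul0r big_ord0.
have [nu [nuE inu nup]] := distribution_exists (w0 n) (bh n).
exists (fmeasure_add mu nu); split=> [E mE|p|p].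
- by rewrite fmeasure_addE muE// nuE// big_ord_recr.
- exact: integrable_fmeasure_add.
rewrite /Rintegral (integral_fmeasure_add (imu p) (inu p)) fineD; try exact: integrable_fin_num.
by rewrite big_ord_recr /= -mup -nup.
Qed.

End Mixture.

(** * Null sets and the channels *)

Section NullPreimages.
Context (R : realType).
Local Notation leb := (@lebesgue_measure R).
Local Notation e n := (n.+1%:R^-1 : R).

Lemma negligible_preimage_pieces (F : R -> R) (D : nat -> set R) (k : nat -> R) E :
  (forall n, 0 < k n) ->
  (forall n x y, D n x -> D n y -> k n * `|x - y| <= `|F x - F y|) ->
  leb.-negligible E -> leb.-negligible ((\bigcup_n D n) `&` F @^-1` E).
Proof.
move=> k0 Fk E0; rewrite setI_bigcupl; apply: negligible_bigcup => n.
exact: (negligible_preimage_expanding (k0 n) (Fk n)).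
Qed.

Lemma negligible_point (a : R) : leb.-negligible [set a].
Proof. by apply/negligibleP => //; exact: lebesgue_measure_set1. Qed.

Let leb_negligibleS (A B : set R) : B `<=` A -> leb.-negligible A -> leb.-negligible B.
Proof. by move=> BA [N [mN N0 AN]]; exists N; split => // x /BA /AN. Qed.

Lemma archimedean_piece (x : R) : 0 < x -> exists n, e n <= x.
Proof.
move=> x0; exists (Num.truncn x^-1).
rewrite invf_ple ?posrE ?ltr0n//.
by apply/ltW; rewrite truncnS_gt.
Qed.

(** By the mean value theorem, [sin] being at least [sin d] between the points. *)
Lemma cos_expanding (d x y : R) : 0 < d <= pi / 2 ->
  d <= x <= pi - d -> d <= y <= pi - d ->
  sin d * `|x - y| <= `|cos x - cos y|.
Proof.
move=> /andP[d0 d2].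
wlog xy : x y / x <= y.
  move=> h xd yd; have [|/ltW] := leP x y; first by move=> ?; exact: h.
  by move=> yx; rewrite distrC [leRHS]distrC; exact: h.
move=> /andP[dx xd] /andP[dy yd].
have [z] : exists2 z, z \in `[x, y]%R & cos y - cos x = - sin z * (y - x).
  apply: (@MVT_segment R (@cos R) (fun z => - sin z) x y xy).
    by apply: continuous_subspaceT; exact: continuous_cos.
rewrite in_itv/= => /andP[xz zy] h.
rewrite distrC [leRHS]distrC h normrM normrN ler_wpM2r//.
apply: le_trans (ler_norm _).
have dz : d <= z by exact: le_trans xz.
have zd : z <= pi - d by exact: le_trans yd.
have mono (u v : R) : d <= u -> u <= v -> v <= pi / 2 -> sin u <= sin v.
  move=> du.
  rewrite le_eqVlt => /orP[/eqP->//|uv] v2; apply: ltW.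
  by rewrite ltr_sin// in_itv/=; apply/andP; split; lra.
have [z2|z2] := leP z (pi / 2); first exact: mono.
have -> : sin z = sin (pi - z) by rewrite sinB sinpi cospi mul0r sub0r mulN1r opprK.
by apply: mono; lra.
Qed.

(** The intervals [[e n, pi - e n]] exhaust [[0, pi]] up to its endpoints. *)
Lemma cos_preimage_negligible E : leb.-negligible E ->
  leb.-negligible ([set x : R | 0 <= x <= pi] `&` (@cos R) @^-1` E).
Proof.
move=> E0; pose D n : set R := [set x | e n <= x <= pi - e n].
have e1 n : 0 < e n <= pi / 2.
  rewrite invr_gt0 ltr0n/=; apply: (@le_trans _ _ 1); last by have := pi_ge2 R; lra.
  by rewrite invf_le1 ?ltr0n// ler1n.
have sub : [set x : R | 0 <= x <= pi] `&` (@cos R) @^-1` E `<=`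
    [set 0] `|` [set pi] `|` ((\bigcup_n D n) `&` (@cos R) @^-1` E).
  move=> x [/andP[x0 xpi] Ex].
  have [->|xn0] := eqVneq x 0; first by left; left.
  have [->|xnpi] := eqVneq x pi; first by left; right.
  right; split => //.
  have [|n hn] := @archimedean_piece (Num.min x (pi - x)).
    by rewrite lt_min subr_gt0 !lt_neqAle x0 xpi eq_sym xn0 xnpi.
  exists n => //; rewrite /D /=; move: hn; rewrite le_min => /andP[-> hp] /=.
  by move: hp; rewrite !lerBrDr addrC.
apply: (leb_negligibleS sub).
apply: negligibleU; first by apply: negligibleU; exact: negligible_point.
apply: (@negligible_preimage_pieces _ _ (fun n => sin (e n))) => // [n|n x y].
  by apply: sin_gt0_pi; have /andP[-> h]/= := e1 n; move: h (pi_gt0 R); move: (e n) => d *; lra.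
exact: cos_expanding.
Qed.

(** The derivative [8 a + 4 c] of [4 a^2 + 4 a c + 1] vanishes at one point only;
    away from it, on each side, the square root is expanding.  The map [g] is
    this square root up to sign. *)
Lemma sqrt_quadratic_preimage_negligible (c : R) (g : R -> R) E : `|c| <= 1 ->
  (forall a b, `|Num.sqrt (4 * a ^+ 2 + 4 * a * c + 1)
                - Num.sqrt (4 * b ^+ 2 + 4 * b * c + 1)| <= `|g a - g b|) ->
  leb.-negligible E ->
  leb.-negligible ([set a : R | `|a| <= 1] `&` g @^-1` E).
Proof.
move=> c1 hg E0.
have sq1 (t : R) : `|t| <= 1 -> t ^+ 2 <= 1.
  by move=> t1; rewrite -real_normK ?num_real// exprn_ile1.
pose D (b : bool) n : set R := [set a | `|a| <= 1 /\ e n <= (-1) ^+ b * (2 * a + c)].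
have sub : [set a : R | `|a| <= 1] `&` g @^-1` E `<=` [set - c / 2] `|`
    ((\bigcup_n D false n) `&` g @^-1` E `|` (\bigcup_n D true n) `&` g @^-1` E).
  move=> a [a1 Ea]; have [h|h|h] := ltgtP (2 * a + c) 0.
  - right; right; split => //; have [|n hn] := @archimedean_piece (- (2 * a + c)).
      by rewrite oppr_gt0.
    by exists n => //; split => //; rewrite expr1 mulN1r.
  - right; left; split => //; have [n hn] := archimedean_piece h.
    by exists n => //; split => //; rewrite mul1r.
  - by left => /=; lra.
apply: (leb_negligibleS sub).
apply: negligibleU; first exact: negligible_point.
have piece b : leb.-negligible ((\bigcup_n D b n) `&` g @^-1` E).
  apply: (@negligible_preimage_pieces _ _ (fun n => 2 / 3 * e n)) => // n x y [x1 xD] [y1 yD].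
  apply: le_trans (hg _ _).
  set q := fun a : R => 4 * a ^+ 2 + 4 * a * c + 1.
  have q0 a : 0 <= q a.
    have -> : q a = (2 * a + c) ^+ 2 + (1 - c ^+ 2) by rewrite /q; ring.
    by rewrite addr_ge0 ?sqr_ge0// subr_ge0 sq1.
  have q9 a : `|a| <= 1 -> Num.sqrt (q a) <= 3.
    move=> a1; rewrite -[leRHS]ger0_norm// -sqrtr_sqr ler_wsqrtr//.
    have a2 : a ^+ 2 <= 1 by rewrite sq1.
    have ac : a * c <= 1.
      by apply: le_trans (ler_norm _) _; rewrite normrM -[leRHS]mulr1 ler_pM.
    by rewrite /q -mulrA; lra.
  rewrite -/(q x) -/(q y).
  set u := Num.sqrt (q x); set v := Num.sqrt (q y).
  have [u0 v0] : 0 <= u /\ 0 <= v by rewrite !sqrtr_ge0.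
  have uv : u + v <= 6 by have := q9 _ x1; have := q9 _ y1; rewrite -/u -/v; lra.
  have uv2 : `|u - v| * (u + v) = 2 * `|x - y| * `|2 * x + c + (2 * y + c)|.
    rewrite -[in LHS](ger0_norm (addr_ge0 u0 v0)) -!normrM.
    have -> : (u - v) * (u + v) = u ^+ 2 - v ^+ 2 by ring.
    rewrite !sqr_sqrtr//.
    have -> : q x - q y = 2 * (x - y) * (2 * x + c + (2 * y + c)) by rewrite /q; ring.
    by rewrite !normrM ger0_norm.
  have big : 2 * e n <= `|2 * x + c + (2 * y + c)|.
    have -> : `|2 * x + c + (2 * y + c)| = `|(-1) ^+ b * (2 * x + c + (2 * y + c))|.
      by rewrite normrM normrX normrN1 expr1n mul1r.
    by apply: le_trans (ler_norm _); rewrite mulrDr -[2]/(1 + 1) mulrDl mul1r lerD.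
  have : `|u - v| * (u + v) <= `|u - v| * 6 by rewrite ler_wpM2l.
  rewrite uv2; have := ler_wpM2l (normr_ge0 (x - y)) big.
  move: `|x - y| `|u - v| `|_ + _| (e n) => A B C d; lra.
by apply: negligibleU.
Qed.

End NullPreimages.

(** * The spectral measure of a site *)

Section Channels.
Context (R : realType) (N : nat).
Hypothesis N1 : (1 <= N)%N.
Implicit Types (k m l : nat) (x y : R).
Local Notation unif := (unif R).
Local Notation leb := (@lebesgue_measure R).
Local Notation step := (step R N).
Local Notation symbol := (@symbol R N).
Local Notation band := (@band R N).
Local Notation c k := (cos (k%:R * step)).
Local Notation s k := (sin (k%:R * step)).

(** The band function [band k] along the ribbon, at [a = - 2 cos x]. *)
Definition channel k x : R := Num.sqrt (symbol k x).

Lemma symbol_sqr k x : symbol k x = (2 * cos x + c k) ^+ 2 + s k ^+ 2.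
Proof. by rewrite sqr_sinE /symbol; ring. Qed.

Lemma symbol_ge0 k x : 0 <= symbol k x.
Proof. by rewrite symbol_sqr addr_ge0 ?sqr_ge0. Qed.

Lemma sqr_channel k x : channel k x ^+ 2 = symbol k x.
Proof. by rewrite sqr_sqrtr// symbol_ge0. Qed.

Lemma channel_range k x : (0 < k <= N)%N -> s 1%N <= channel k x <= band N 2.
Proof.
move=> kN; have s1 : 0 < s 1%N by apply: sin_step_gt0.
have sE : s 1%N = Num.sqrt (s 1%N ^+ 2) by rewrite sqrtr_sqr gtr0_norm.
rewrite bandN2// sE /channel.
apply/andP; split; apply: ler_wsqrtr.
  by apply: le_trans (sqr_sin_step_ge R N1 kN) _; rewrite symbol_sqr lerDr sqr_ge0.
have /andP[l r] := abs_cos_step_le R kN; have := cos_geN1 x; have := cos_le1 x.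
have := cos_step1_ge0 R N1; rewrite /symbol.
move: (c k) (c 1%N) (cos x) l r => p q t *.
have tp : t * p <= q by nra.
have t2 : t ^+ 2 <= 1 by nra.
by rewrite -mulrA; lra.
Qed.

Lemma bounded_continuous_channel k : bounded_continuous (channel k).
Proof.
have [cs [C hC]] := bounded_continuous_symbol R N k; split.
  by move=> x; apply: (@continuous_comp _ _ _ (symbol k)); [exact: cs|exact: sqrt_continuous].
exists (Num.sqrt C) => x; rewrite ger0_norm ?sqrtr_ge0// ler_wsqrtr//.
exact: le_trans (ler_norm _) (hC x).
Qed.

Lemma band_channel k a : (0 < k <= N)%N -> 0 <= a <= 2 ->
  exists2 x : R, 0 <= x <= pi & channel k x = band k a.
Proof.
move=> kN /andP[a0 a2]; have a1 : -1 <= - (a / 2) <= 1 by lra.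
exists (acos (- (a / 2))); first by rewrite acos_ge0// acos_lepi.
apply: (@pexpIrn _ 2); rewrite ?nnegrE ?sqrtr_ge0// 1?ltW ?band_gt0//.
rewrite sqr_channel sqr_band// /symbol acosK; last by rewrite in_itv.
by field.
Qed.

(** The spectrum is symmetric: each channel contributes with both signs. *)
Definition schannel (b : bool) k x : R := (-1) ^+ b * channel k x.

(** A channel is a square root of a quadratic function, composed with the
    cosine. *)
Lemma channel_preimage_null b k E : measurable E ->
  leb E = 0%E -> unif (schannel b k @^-1` E) = 0%E.
Proof.
move=> mE E0; pose q a := Num.sqrt (4 * a ^+ 2 + 4 * a * c k + 1).
pose g a := (-1) ^+ b * q a.
have NE : leb.-negligible E by apply/negligibleP.
have Ng : leb.-negligible ([set a : R | `|a| <= 1] `&` g @^-1` E).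
  apply: (@sqrt_quadratic_preimage_negligible _ (c k)) => //.
    by rewrite ler_norml cos_geN1 cos_le1.
  move=> u v; rewrite -/(q u) -/(q v) /g -mulrBr.
  by rewrite normrM normrX normrN1 expr1n mul1r.
have [M [mM M0 sub]] := cos_preimage_negligible Ng.
have ms : measurable (schannel b k @^-1` E).
  rewrite -[X in measurable X]setTI.
  have : measurable_fun [set: measurableTypeR R] (schannel b k : _ -> measurableTypeR R).
    apply: continuous_measurable_fun => x; apply: cvgM; first exact: cvg_cst.
    by have [cc _] := bounded_continuous_channel k; exact: cc.
  by apply.
rewrite unifE//; apply/eqP; rewrite mule_eq0; apply/orP; right.
rewrite -measure_le0 -M0; apply: le_measure; [by apply/mem_set/measurableI|exact/mem_set|].
move=> x [Ex]; rewrite /= in_itv/= => x0; apply: sub; split => //; split.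
  by rewrite /= ler_norml cos_geN1 cos_le1.
exact: Ex.
Qed.

(** By continuity the preimage contains an interval around [t], whose
    intersection with [[0, pi]] has positive length. *)
Lemma channel_preimage_pos b k (t : R) (d : R) (S : set (measurableTypeR R)) :
  0 <= t <= pi -> 0 < d ->
  measurable S -> (forall x : R, S (schannel b k x)) ->
  (0 < unif (schannel b k @^-1`
      (S `&` [set x : R | ((x - schannel b k t) ^+ 2 <= d)%R])))%E.
Proof.
move=> /andP[t0 tpi] d0 mS SF; set F := schannel b k.
have cF : continuous F.
  move=> x; apply: cvgM; first exact: cvg_cst.
  by have [cc _] := bounded_continuous_channel k; exact: cc.
pose G : set (measurableTypeR R) := [set x : R | ((x - F t) ^+ 2 <= d)%R].
have mG : measurable G.
  rewrite (_ : G = setT `&` (horner (('X - (F t)%:P) ^+ 2)) @^-1` `]-oo, d]%classic).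
    by apply: (@measurable_horner R _ setT) => //; exact: measurable_itv.
  by apply/seteqP; split => x /=; rewrite in_itv/= horner_exp !hornerE; [split|case].
have mF : measurable (F @^-1` (S `&` G)).
  rewrite -[X in measurable X]setTI.
  have mF : measurable_fun [set: measurableTypeR R] (F : _ -> measurableTypeR R).
    exact: continuous_measurable_fun.
  by apply: mF => //; exact: measurableI.
have [r r0 rF] : exists2 r : R, 0 < r & forall x : R, `|t - x| < r -> (F x - F t) ^+ 2 <= d.
  have ch : (fun x => (F x - F t) ^+ 2) x @[x --> t] --> (F t - F t) ^+ 2.
    by apply: cvgM; (apply: cvgB; [exact: cF|exact: cvg_cst]).
  have : \forall x \near t, (F x - F t) ^+ 2 < d.
    by apply: (cvgr_lt _ ch); rewrite subrr expr0n.
  by move=> /nbhs_ballP[r r0 h]; exists r => // x tx; apply/ltW/h.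
pose lo := Num.max 0 (t - r); pose hi := Num.min pi (t + r).
have lohi : lo < hi.
  rewrite lt_min !gt_max pi_gt0 /=; apply/and3P; split; lra.
have pos : (0 < unif `]lo, hi[%classic)%E.
  rewrite unifE// (_ : _ `&` _ = `]lo, hi[%classic).
    rewrite lebesgue_measure_itv /= lte_fin lohi -EFinB -EFinM lte_fin.
    by rewrite mulr_gt0 ?invr_gt0 ?pi_gt0// subr_gt0.
  apply/seteqP; split => x /=; rewrite !in_itv/=; first by case.
  rewrite gt_max lt_min => /andP[/andP[x0 xr] /andP[xpi tr]].
  by rewrite x0 xr xpi tr !ltW.
apply: lt_le_trans pos _; apply: le_measure; [exact/mem_set|exact/mem_set|].
move=> x /=; rewrite in_itv/= gt_max lt_min => /andP[/andP[x0 xr] /andP[xpi tr]].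
split; first exact: SF.
by apply: rF; rewrite ltr_norml; apply/andP; split; lra.
Qed.

Lemma bounded_continuous_schannel b k : bounded_continuous (schannel b k).
Proof.
by apply: bounded_continuousM; [exact: bounded_continuous_cst|exact: bounded_continuous_channel].
Qed.

(** [weight k * sin (theta k)], half of it for each sign of the channel. *)
Definition site_weight k : R := s k ^+ 2 / N.+1%:R.

Lemma site_weight_ge0 k : 0 <= site_weight k.
Proof. by rewrite divr_ge0 ?sqr_ge0. Qed.

Lemma site_weight_gt0 k : (0 < k <= N)%N -> 0 < site_weight k.
Proof. by move=> kN; rewrite divr_gt0// exprn_gt0// sin_step_gt0. Qed.

Lemma site_measure_exists :
  exists mu : {finite_measure set (measurableTypeR R) -> \bar R},
  (forall E, measurable E -> mu E =
    (\sum_(i < N) (site_weight i.+1)%:E * unif (schannel false i.+1 @^-1` E) +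
     \sum_(i < N) (site_weight i.+1)%:E * unif (schannel true i.+1 @^-1` E))%E) /\
  (forall p : {poly R}, \int[mu]_(x in setT) p.[x] =
    \sum_(i < N) site_weight i.+1 *
      \int[unif]_x (p.[schannel false i.+1 x] + p.[schannel true i.+1 x])).
Proof.
have mix b := @mixture_exists R N (fun i => site_weight i.+1) (fun i => schannel b i.+1)
  (fun i => site_weight_ge0 i.+1) (fun i => bounded_continuous_schannel b i.+1).
have [mu [muE imu mup]] := mix false; have [nu [nuE inu nup]] := mix true.
exists (fmeasure_add mu nu); split => [E mE|p].
  by rewrite fmeasure_addE muE// nuE.
rewrite /Rintegral (integral_fmeasure_add (imu p) (inu p)) fineD; try exact: integrable_fin_num.
rewrite -/(Rintegral mu setT (horner p)) -/(Rintegral nu setT (horner p)) mup nup.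
rewrite -big_split /=; apply: eq_bigr => i _; rewrite -mulrDr.
by congr (_ * _); apply/esym/integral_unifD; apply/bounded_continuous_horner/bounded_continuous_schannel.
Qed.

Lemma integral_unif_sum n (a : nat -> R) (h : nat -> R -> R) :
  (forall j, bounded_continuous (h j)) ->
  \int[unif]_x (\sum_(j < n) a j * h j x) = \sum_(j < n) a j * \int[unif]_x h j x.
Proof.
move=> bh; have ba j : bounded_continuous (fun x => a j * h j x).
  by apply: bounded_continuousM => //; exact: bounded_continuous_cst.
have bs m : bounded_continuous (fun x => \sum_(j < m) a j * h j x).
  elim: m => [|m ih].
    by under [X in bounded_continuous X]funext do rewrite big_ord0; exact: bounded_continuous_cst.
  under [X in bounded_continuous X]funext do rewrite big_ord_recr.
  exact: bounded_continuousD.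
elim: n => [|n ih].
  by rewrite big_ord0; under eq_Rintegral do rewrite big_ord0; exact: integral_unif_cst.
rewrite [RHS]big_ord_recr /= -ih -integral_unifZ// -integral_unifD//.
by apply: eq_Rintegral => x _; rewrite big_ord_recr.
Qed.

Local Notation v0 := ((0 : int), inord 1 : 'I_N.*2.+1).
Local Notation dl := (delta R (v0 : Gamma N)).

Lemma iter_double (T : Type) (f : T -> T) l z :
  iter l.*2 f z = iter l (fun u => f (f u)) z.
Proof. by elim: l => //= l ->. Qed.

Lemma at_v0 (f : Gamma N -> R[i]) : f v0 = row f 2 0.
Proof.
have jN : (1 < N.*2.+1)%N by lia.
rewrite (row_ord _ (Ordinal jN)); congr (f (_, _)).
by apply: val_inj; rewrite /= inordK.
Qed.

Lemma even_supported_iter l : even_supported (iter l.*2 (@Delta R N) dl).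
Proof.
elim: l => [|l ih] /=; last exact/Delta_odd/Delta_even.
move=> k; have [kN|kN] := leqP k N; last by apply: row_out; lia.
have jN : (k.*2 < N.*2.+1)%N by lia.
rewrite (row_ord _ (Ordinal jN)); apply/funext => n; rewrite /delta xpair_eqE -val_eqE /= inordK; last by lia.
by rewrite [k.*2 == 1%N](_ : _ = false) ?andbF//; lia.
Qed.

(** Odd powers of the two signed channels cancel, as the iterates of odd order
    vanish on the even sublattice; for even powers this is the moment at the
    site. *)
Lemma iter_Delta_v0 j : iter j (@Delta R N) dl v0 =
  (\sum_(i < N) site_weight i.+1 *
      \int[unif]_x (schannel false i.+1 x ^+ j + schannel true i.+1 x ^+ j))%:C.
Proof.
rewrite at_v0 -[j]odd_double_half; case: (odd j); move: j./2 => l; rewrite ?add0n ?add1n.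
  rewrite iterS (Delta_even (@even_supported_iter l) 1) big1// => i _.
  under eq_Rintegral => x _.
    rewrite /schannel expr0 mul1r expr1 mulN1r exprNn -signr_odd /= odd_double expr1 mulN1r subrr.
    over.
  by rewrite integral_unif_cst mulr0.
rewrite iter_double (@ev_iter_Delta2 R N N1 l 1 0) ?ltnS//; congr (_%:C).
apply: eq_bigr => i _.
under eq_Rintegral => x _.
  rewrite /wave mulr0 add0r subrr mul0r cos0 !mul1r mulrC.
  over.
rewrite integral_unifZ; last exact/bounded_continuousX/bounded_continuous_symbol.
under [in RHS]eq_Rintegral => x _.
  rewrite /schannel expr0 mul1r expr1 mulN1r exprNn -signr_odd odd_double expr0 mul1r.
  rewrite -mul2n exprM sqr_channel -mulr2n -mulr_natl.
  over.
rewrite integral_unifZ; last exact/bounded_continuousX/bounded_continuous_symbol.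
by rewrite /weight /site_weight; move: (N.+1%:R^-1) => q; ring.
Qed.

Lemma dot_poly_op_v0 (p : {poly R}) : dot (poly_op (@Delta R N) p dl) dl =
  \sum_(i < N) site_weight i.+1 *
      \int[unif]_x (p.[schannel false i.+1 x] + p.[schannel true i.+1 x]).
Proof.
have -> : dot (poly_op (@Delta R N) p dl) dl = complex.Re (poly_op (@Delta R N) p dl v0).
  by rewrite -(inner_delta _ v0) innerE.
rewrite /poly_op; under eq_bigr do rewrite iter_Delta_v0 -rmorphM.
rewrite -rmorph_sum /=.
under eq_bigr do rewrite mulr_sumr.
rewrite exchange_big; apply: eq_bigr => i _ /=.
under [in RHS]eq_Rintegral => x _.
  rewrite !horner_coef -big_split /=.
  under eq_bigr do rewrite -mulrDr.
  over.
rewrite (@integral_unif_sum _ (fun j => p`_j) (fun j x => schannel false i.+1 x ^+ j + schannel true i.+1 x ^+ j)).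
  by rewrite mulr_sumr; apply: eq_bigr => j _; rewrite mulrCA.
by move=> j; apply: bounded_continuousD; apply/bounded_continuousX/bounded_continuous_schannel.
Qed.

End Channels.

(** * The spectra of the nanoribbon *)

Section NanoribbonSpectra.
Context (R : realType) (N : nat).
Hypothesis N1 : (1 <= N)%N.
Local Notation leb := (@lebesgue_measure R).
Local Notation step := (step R N).
Local Notation D := (@Delta R N).
Local Notation s1 := (sin (1%:R * step)).
Local Notation L := (band N N 2 : R).
Local Notation v0 := ((0 : int), inord 1 : 'I_N.*2.+1).
Local Notation dl := (delta R (v0 : Gamma N)).

Definition band_union : set (measurableTypeR R) := [set x : R | s1 <= `|x| <= L].
Local Notation S := band_union.

Let normE : Delta_norm R N = L.
Proof. by rewrite bandN2. Qed.

Let mS : measurable S.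
Proof.
rewrite (_ : S = `[s1, L]%classic `|` `[- L, - s1]%classic).
  by apply: measurableU; exact: measurable_itv.
have s10 : 0 < s1 by apply: sin_step_gt0.
apply/seteqP; split => x; rewrite /S /= !in_itv /=.
  have [x0|x0] := leP 0 x; [rewrite ger0_norm//|rewrite ltr0_norm//] => /andP[a b];
    [left|right]; apply/andP; split; lra.
by case=> /andP[a b]; [rewrite ger0_norm|rewrite ler0_norm]; try lra; apply/andP; split; lra.
Qed.

Let SL (x : R) : S x -> `|x| <= L.
Proof. by case/andP. Qed.

Let schannel_in b k (x : R) : (0 < k <= N)%N -> S (schannel N b k x).
Proof.
have -> : S (schannel N b k x) = (s1 <= `|schannel N b k x| <= L) by [].
have -> : `|schannel N b k x| = channel N k x.
  by rewrite /schannel normrM normrX normrN1 expr1n mul1r ger0_norm// sqrtr_ge0.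
exact: channel_range.
Qed.

(** Absolute continuity and the support are read off the signed channels, whose
    ranges cover [band_union] by [band_cover]. *)
Lemma site_spectral_measure :
  exists mu : {finite_measure set (measurableTypeR R) -> \bar R},
  [/\ represents D S dl mu, mu (~` S) = 0%E,
      forall E, measurable E -> leb E = 0%E -> mu E = 0%E &
      forall (x0 : R) d, S x0 -> 0 < d ->
        (0 < mu (S `&` [set x : R | ((x - x0) ^+ 2 <= d)%R]))%E].
Proof.
have [mu [muE mup]] := site_measure_exists R N.
have mu_null E : measurable E -> (forall b k, (0 < k <= N)%N ->
    unif R (schannel N b k @^-1` E) = 0%E) -> mu E = 0%E.
  move=> mE h; rewrite muE// !big1 ?adde0// => i _; by rewrite h ?mule0//= ltn_ord.
have muS : mu (~` S) = 0%E.
  apply: mu_null; first exact: measurableC.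
  move=> b k kN; rewrite (_ : _ @^-1` _ = set0) ?measure0//.
  by apply/seteqP; split => // x /=; apply; exact: schannel_in.
exists mu; split => //.
- move=> p; rewrite (dot_poly_op_v0 N1) -mup; have [C _ hC] := horner_bounded p L.
  apply: (Rintegral_concentrated mS muS (@measurable_horner R p setT) _).2 => x Sx.
  by apply: hC; exact: SL.
- by move=> E mE E0; apply: mu_null => // b k _; exact: channel_preimage_null.
move=> x0 d Sx0 d0; set A := S `&` _.
have mA : measurable A.
  apply: measurableI => //.
  rewrite (_ : mkset _ = setT `&` (horner (('X - x0%:P) ^+ 2)) @^-1` `]-oo, d]%classic).
    by apply: (@measurable_horner R _ setT) => //; exact: measurable_itv.
  by apply/seteqP; split => x /=; rewrite in_itv/= horner_exp !hornerE; [split|case].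
have [k [a [kN a02 xk]]] := band_cover N1 Sx0.
have [t t0pi tk] := band_channel kN a02.
have xt : schannel N (x0 < 0) k t = x0.
  rewrite /schannel tk -xk; case: (ltrP x0 0) => x00.
    by rewrite expr1 mulN1r ltr0_norm// opprK.
  by rewrite expr0 mul1r ger0_norm.
have pos : (0 < unif R (schannel N (x0 < 0)%R k @^-1` A))%E.
  rewrite /A -{2}xt; apply: channel_preimage_pos => // x; exact: schannel_in.
case: k kN xk tk xt pos => // k kN _ _ _ pos.
have i0 : 'I_N := Ordinal kN.
have term_ge0 b i : (0 <= (site_weight R N i.+1)%:E * unif R (schannel N b i.+1 @^-1` A))%E.
  by rewrite mule_ge0// lee_fin site_weight_ge0.
have term b : (0 < unif R (schannel N b k.+1 @^-1` A))%E ->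
    (0 < \sum_(i < N) (site_weight R N i.+1)%:E * unif R (schannel N b i.+1 @^-1` A))%E.
  move=> bpos; rewrite (bigD1 (Ordinal kN))//=; apply: lt_le_trans (leeDl _ _).
    by rewrite mule_gt0// lte_fin site_weight_gt0.
  by apply: sume_ge0 => i _; exact: term_ge0.
rewrite muE//; move: pos; case: (x0 < 0) => pos.
  by apply: lt_le_trans (leeDr _ _); [exact: term|apply: sume_ge0 => i _; exact: term_ge0].
by apply: lt_le_trans (leeDl _ _); [exact: term|apply: sume_ge0 => i _; exact: term_ge0].
Qed.

Let ldl : l2 dl := l2_delta R _.

Let S_spectrum (x : R) : S x -> spectrum D x%:C.
Proof.
move=> Sx; have [mu [rep _ _ pos]] := site_spectral_measure.
apply: (spectrum_on_at_support (Delta_bsa R N1) mS SL ldl rep).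
  by move=> q; exact: (l2_poly_op (Delta_bsa R N1)).
by move=> d; exact: pos.
Qed.

Let spectrum_S (x : R) : spectrum D x%:C -> S x \/ x = 0.
Proof. by move/(spectrum_Delta_real N1); rewrite normE. Qed.

Lemma spectrum_DeltaE : spectrum D = toC (S `|` [set 0]).
Proof.
apply/seteqP; split => [z Dz|_ [x [Sx|->] <-]].
- have zE := spectrum_Delta_complex N1 Dz; exists (complex.Re z) => //.
  by rewrite zE in Dz; exact: spectrum_S.
- exact: S_spectrum.
- exact: spectrum_Delta0.
Qed.

(** A point off [band_union], be it 0, is at a positive distance from it, which is
    all that [ac_resolvent] asks for. *)
Lemma ac_spectrum_Delta : ac_spectrum D = toC S.
Proof.
have bsa := Delta_bsa R N1.
have [mu [rep muS ac pos]] := site_spectral_measure.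
have acd : ac_subspace D dl by exact: (ac_subspaceI bsa mS SL S_spectrum ldl rep ac muS).
apply/seteqP; split => [z Dz|_ [x Sx <-]]; last first.
  apply: (spectrum_on_at_support bsa mS SL ldl rep); last by move=> d; exact: pos.
  by move=> q; exact: (ac_poly_op bsa mS SL S_spectrum spectrum_S).
apply: contrapT => zS; apply: Dz.
have res d : 0 < d -> (forall x, S x -> d <= (quad z).[x]) -> resolvent_set D (ac_subspace D) z.
  exact: (ac_resolvent bsa mS SL S_spectrum spectrum_S).
have [z0|z0] := eqVneq (complex.Im z) 0; last first.
  apply: (res (complex.Im z ^+ 2)); first by rewrite exprn_even_gt0.
  by move=> x _; rewrite quadE lerDr sqr_ge0.
have zE : z = (complex.Re z)%:C by apply/eqP; rewrite eq_complex z0 !eqxx.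
set y := complex.Re z in zE.
have nSy : ~ S y by move=> Sy; apply: zS; exists y.
have : `|y| < s1 \/ L < `|y|.
  have [|ys] := ltP `|y| s1; first by left.
  have [|yL] := ltP L `|y|; first by right.
  by case: nSy; rewrite /S /= ys yL.
have far (e : R) : 0 < e -> (forall x, S x -> e <= `|x - y|) ->
    resolvent_set D (ac_subspace D) z.
  move=> e0 he; apply: (res (e ^+ 2)); first exact: exprn_gt0.
  move=> x /he h; rewrite quadE z0 expr0n addr0 -/y -[leRHS]real_normK ?num_real//.
  by rewrite lerXn2r ?nnegrE// ltW.
case=> hy.
  apply: (far (s1 - `|y|)); first by rewrite subr_gt0.
  move=> x /andP[sx _]; apply: le_trans (lerB_dist _ _).
  by rewrite lerD2r.
apply: (far (`|y| - L)); first by rewrite subr_gt0.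
move=> x /andP[_ xL]; rewrite distrC; apply: le_trans (lerB_dist _ _).
by rewrite lerB.
Qed.

End NanoribbonSpectra.

(** * The eigenvalue curves *)

Section EigenvalueCurves.
Context (R : realType) (N : nat).
Hypothesis N1 : (1 <= N)%N.
Local Notation sigma := (@sigma0 R N).
Local Notation band := (@band R N).
Local Notation band_union := (@band_union R N).

Lemma sigma0E : sigma 0 = [set 0].
Proof.
apply/seteqP; split => [_ [a /= a02 <-]|_ -> /=].
  by rewrite in_itv/= in a02; have /andP[a0 _] := a02; rewrite (lam0_pos N1 a0 (leq0n N)).
by exists 0; rewrite ?(lam0_pos N1 (lexx 0) (leq0n N))//= in_itv/= lexx ler0n.
Qed.

Lemma sigma_pos m : (m <= N)%N -> sigma m%:Z = [set band m a | a in [set` `[(0 : R), 2]]].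
Proof.
move=> mN; apply: eq_imagel => a /=; rewrite in_itv/= => /andP[a0 _].
exact: lam0_pos.
Qed.

Lemma sigma_neg m : (m <= N)%N -> sigma (- m%:Z) = [set - x | x in sigma m%:Z].
Proof.
move=> mN; apply/seteqP; split => [_ [a a02 <-]|_ [_ [a a02 <-] <-]].
  have /andP[a0 _] : 0 <= a <= 2 by move: a02; rewrite /= in_itv.
  exists (lam0 N m%:Z a); first by exists a.
  by rewrite (lam0_pos N1 a0 mN) (lam0_neg N1 a0 mN).
have /andP[a0 _] : 0 <= a <= 2 by move: a02; rewrite /= in_itv.
by exists a => //; rewrite (lam0_pos N1 a0 mN) (lam0_neg N1 a0 mN).
Qed.

(** The bands with positive index cover the positive part of [band_union], those
    with negative index its reflection, and the flat band is the point 0. *)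
Lemma bigcup_sigma :
  \bigcup_(k in [set k : int | - N%:Z <= k <= N%:Z]) sigma k = band_union `|` [set 0].
Proof.
apply/seteqP; split => [y [k kN]|y [Sy|->]]; last first.
- by exists 0; [rewrite /=; lia|rewrite sigma0E].
- have [m [a [mN a02 ya]]] := band_cover N1 Sy.
  have /andP[m0 mN'] := mN; have aI : [set` `[(0 : R), 2]] a by rewrite /= in_itv.
  have Sm : sigma m%:Z (band m a) by rewrite sigma_pos//; exists a.
  have [y0|y0] := leP 0 y.
    exists m%:Z; first by rewrite /= lez_nat mN' andbT; lia.
    by rewrite -[y]ger0_norm// ya.
  exists (- m%:Z); first by rewrite /=; lia.
  by rewrite sigma_neg//; exists (band m a) => //; rewrite -ya ltr0_norm// opprK.
- have pos m : (0 < m <= N)%N -> sigma m%:Z `<=` [set x | 0 < x] `&` band_union.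
    move=> mN; have /andP[_ mN'] := mN; rewrite sigma_pos// => _ [a aI <-].
    have a02 : 0 <= a <= 2 by move: aI; rewrite /= in_itv.
    split; first exact: band_gt0.
    by rewrite /band_union /= gtr0_norm ?band_gt0//; exact: band_range.
  have kE : k = 0 \/ (exists2 m, (0 < m <= N)%N & k = m%:Z \/ k = - m%:Z).
    move: kN => /= kN; case: (ltrgtP k 0) => k0; [right|right|by left].
      by exists `|k|%N; [lia|right; lia].
    by exists `|k|%N; [lia|left; lia].
  case: kE => [->|[m mN [->|->]]]; first by rewrite sigma0E; right.
    by move=> /(pos _ mN)[_]; left.
  rewrite sigma_neg; last by case/andP: mN.
  by move=> [x /(pos _ mN)[_ Sx] <-]; left; rewrite /band_union /= normrN.
Qed.

Lemma band_union_itv : band_union = [set` `[- band N 2, band N 2]] `\` [set` `]- sk R N 1, sk R N 1[].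
Proof.
rewrite (skE R N 1); apply/seteqP; split => x; rewrite /band_union /=.
  move=> /andP[sx xL]; split; first by rewrite in_itv/= -ler_norml.
  by rewrite in_itv/= -ltr_norml => /lt_geF; rewrite sx.
rewrite !in_itv/= -ler_norml -ltr_norml => -[xL /negP]; rewrite -leNgt => sx.
by rewrite sx.
Qed.

End EigenvalueCurves.

Unset Implicit Arguments.
Theorem theorem1p2 (R : realType) (N : nat) (hN : (1 <= N)%N) :
  let c := @ck R N in
  let s := @sk R N in
  let lam := @lam0 R N in
  let sigma := @sigma0 R N in
  let D := @Delta R N in
  (forall a : R, 0 <= a <= 2 ->
    (forall k : int, 1 <= k <= N%:Z ->
       - lam (- k) a = lam k a /\
       lam k a = Num.sqrt (a ^+ 2 - 2 * a * c k + 1)) /\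
    lam 0 a = 0) /\
  (spectrum D = ac_spectrum D `|` pp_spectrum D /\
   spectrum D =
     toC (\bigcup_(k in [set k : int | - N%:Z <= k <= N%:Z]) sigma k)) /\
  (pp_spectrum D = toC (sigma 0) /\ sigma 0 = [set 0]) /\
  (ac_spectrum D =
     toC ([set` `[- lam N%:Z 2, lam N%:Z 2]] `\` [set` `]- s 1, s 1[]) /\
   lam N%:Z 2 = Num.sqrt (5 + 4 * c 1)) /\
  (forall k : int, 1 <= k <= N%:Z ->
     sigma (- k) = [set - x | x in sigma k] /\
     (0 < c k -> sigma k = [set` `[s k, lam k 2]]) /\
     (c k <= 0 -> sigma k = [set` `[1, lam k 2]])).

Proof.
move=> c s lam sigma D.
have lamN2 : lam N%:Z 2 = band N N 2 by rewrite /lam lam0_pos// ler0n.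
split; [move=> a /andP[a0 a2]|split; [|split; [|split]]].
- split; last by rewrite /lam (lam0_pos hN a0 (leq0n N)).
  case=> // m /andP[m0 mN]; have m0' : (0 < m)%N by lia.
  have mN' : (m <= N)%N by lia.
  rewrite /lam (lam0_pos hN a0 mN') (lam0_neg hN a0 mN') opprK; split => //.
  by rewrite /c ckE /band eqn0Ngt m0'.
- rewrite bigcup_sigma// spectrum_DeltaE// ac_spectrum_Delta// pp_spectrum_Delta//.
  split => //; rewrite /toC image_setU; congr (_ `|` _).
  by rewrite image_set1.
- rewrite pp_spectrum_Delta// /sigma sigma0E// /toC image_set1.
  by split.
- rewrite lamN2 ac_spectrum_Delta// band_union_itv//; split => //.
  by rewrite bandN2// /c (ckE R N 1).
- case=> // m /andP[m0 mN]; have m0' : (0 < m)%N by lia.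
  have mN' : (m <= N)%N by lia.
  have mI : (0 < m <= N)%N by rewrite m0' mN'.
  rewrite /sigma sigma_neg// sigma_pos// /lam lam0_pos// ?ler0n// /c ckE /s skE.
  split => //; split => h; [exact: band_image_pos|exact: band_image_neg].
Qed.
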